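(* Every finite digraph with minimum outdegree at least $5$ contains $3$ pairwise vertex-disjoint directed cycles.
   Context: Digraphs are finite and simple: no loops and no parallel arcs, but a pair of opposite arcs $uv, vu$ (a directed $2$-cycle) is allowed. A cycle means a directed cycle. *)

(* Defs.v *)
From mathcomp Require Import all_boot.
Set Implicit Arguments.
Unset Strict Implicit.
Unset Printing Implicit Defensive.

(* A digraph is an irreflexive relation e on a finType V, where e u v means that
   uv is an arc. No symmetry or antisymmetry is imposed, so both uv and vu may
   be arcs. *)

Definition outdegree (V : finType) (e : rel V) (v : V) : nat :=
  #|[set w | e v w]|.

(* ucycle holds of the empty sequence, so nonemptiness is required separately.
   When e is irreflexive, such a sequence has at least 2 vertices. *)
Definition dicycle (V : finType) (e : rel V) (c : seq V) : Prop :=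
  c <> [::] /\ ucycle e c.

(* Main.v *)
Require Import Defs.
From mathcomp Require Import all_boot zify.
Set Implicit Arguments.
Unset Strict Implicit.
Unset Printing Implicit Defensive.

(* In a minimal counterexample all outdegrees are 5 and every arc uv has a common in-neighbour
   of u and v, so every in-neighbourhood contains a cycle. Deleting a cycle leaves a digraph
   without two disjoint cycles, which by a two-cycle theorem with up to two exceptional vertices
   of outdegree 2 must contain at least three vertices sending three arcs to the deleted cycle;
   in particular there are no 2-cycles and every triangle has three dominating vertices.
   If Z is a triangle (or a square), x sends three arcs to Z and C is a shortest cycle in the
   in-neighbourhood of x, then at most two vertices of C, necessarily consecutive, have a cycle
   in their in-neighbourhood that avoids Z; this forces many paths from Z to x. In the presence
   of a triangle, all triangles share a vertex; without triangles, some in-neighbourhood contains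
   a square. Each of the resulting local configurations is extended to three disjoint cycles by a
   finite case analysis, recorded as a tree and replayed by a verified checker. *)

(** Contraction yields common in-neighbours because contracting uv lowers only the outdegrees of
    vertices that dominate both ends. A vertex that sends three arcs to a deleted cycle keeps
    outdegree at least 2, and the two-cycle theorem tolerates two such vertices; this is why three
    of them must exist, and why the bound 5 works. If no in-neighbourhood contains a triangle or a
    square, counting arcs makes every in-neighbourhood an induced 5-cycle; deleting a vertex and a
    cycle in its out-neighbourhood then leaves two disjoint cycles, which is absurd. Cycles are
    handled as [cycset]s, sets in which every vertex keeps an out-neighbour: cutting and pasting
    then never requires a simple closed walk, and an induced cycle is just a minimal such set. Of
    the certificates only soundness matters: each node appeals to a fact of the critical digraph,
    and a search that misses a contradiction merely makes the check fail. *)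

(** * Cycle sets and induced cycles *)

Section CycleSets.
Variable V : finType.
Implicit Types (e : rel V) (A B C W : {set V}) (u v w x : V).

(* Every such set contains the vertex set of a directed cycle, and every vertex set of a
   directed cycle is one. *)
Definition cycset e A := (A != set0) && [forall v in A, [exists w in A, e v w]].

Lemma cycsetP e A :
  reflect (A != set0 /\ forall v, v \in A -> exists2 w, w \in A & e v w) (cycset e A).
Proof.
apply: (iffP andP) => -[A0 h]; split=> //.
  by move=> v vA; have /existsP[w /andP[]] := forall_inP h v vA; exists w.
by apply/forall_inP => v /h[w wA vw]; apply/existsP; exists w; rewrite wA.
Qed.

Lemma sub_cycset e e' A : subrel e e' -> cycset e A -> cycset e' A.
Proof.
move=> ee' /cycsetP[A0 h]; apply/cycsetP; split=> // v /h[w wA /ee' vw].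
by exists w.
Qed.

Lemma cycle_cycset e (c : seq V) : c != [::] -> cycle e c -> cycset e [set x in c].
Proof.
move=> c0 ec; apply/cycsetP; split.
  by case: c c0 {ec} => // x c _; apply/set0Pn; exists x; rewrite inE mem_head.
move=> v; rewrite inE => vc; exists (next c v); first by rewrite inE mem_next.
exact: next_cycle.
Qed.

Lemma minimal_cycset e A : cycset e A -> exists2 C : {set V}, C \subset A & minset (cycset e) C.
Proof. by move=> /minset_exists[C mC CA]; exists C. Qed.

(** The image of [f] is itself a cycle set inside [C], so by minimality [f] permutes [C]. *)
Lemma min_cycset_inj e C f : minset (cycset e) C ->
  {in C, forall v, f v \in C /\ e v (f v)} -> f @: C = C /\ {in C &, injective f}.
Proof.
move=> /minsetP[cC mC] fC.
have fsub : f @: C \subset C by apply/subsetP => _ /imsetP[v vC ->]; case: (fC v vC).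
have fE : f @: C = C.
  apply: mC => //; apply/cycsetP; split.
    have /cycsetP[/set0Pn[v vC] _] := cC.
    by apply/set0Pn; exists (f v); apply: imset_f.
  move=> _ /imsetP[v vC ->]; have [fvC _] := fC v vC.
  by exists (f (f v)); [apply: imset_f | case: (fC (f v) fvC)].
by split=> //; apply/imset_injP; rewrite fE.
Qed.

Definition succ_in e A v := odflt v [pick w in A | e v w].

Lemma succ_inP e A : cycset e A -> {in A, forall v, succ_in e A v \in A /\ e v (succ_in e A v)}.
Proof.
move=> /cycsetP[_ h] v vA; rewrite /succ_in; case: pickP => [w /andP[]//|none].
by have [w wA vw] := h v vA; have := none w; rewrite wA vw.
Qed.

(** A second out-neighbour [w] of [v] could replace the chosen one; as [w] is already the successor
    of some other [u], the new choice would not be injective. So a minimal cycle set induces a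
    chordless cycle. *)
Lemma min_cycset_succ e C v w :
  minset (cycset e) C -> v \in C -> w \in C -> e v w -> w = succ_in e C v.
Proof.
move=> mC vC wC vw; have cC := minsetp mC; have fC := succ_inP cC.
have [fE _] := min_cycset_inj mC fC; set f := succ_in e C in fC fE *.
apply/eqP; apply: contraT => wf.
have : w \in f @: C by rewrite fE.
case/imsetP => u uC wE; have uv : u != v by apply: contraNneq wf => <-; rewrite wE.
have gC : {in C, forall x, (if x == v then w else f x) \in C /\ e x (if x == v then w else f x)}.
  by move=> x xC; case: (eqVneq x v) => [->|_] //; apply: fC.
have [_ ginj] := min_cycset_inj mC gC.
by have := ginj u v uC vC; rewrite eqxx (negbTE uv) -wE => /(_ erefl) uE; rewrite uE eqxx in uv.
Qed.

Lemma min_cycset_pred e C v : minset (cycset e) C -> v \in C ->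
  exists p, [/\ p \in C, e p v & forall q, q \in C -> e q v -> q = p].
Proof.
move=> mC vC; have cC := minsetp mC; have fC := succ_inP cC.
have [fE finj] := min_cycset_inj mC fC.
have : v \in succ_in e C @: C by rewrite fE.
case/imsetP=> p pC vE; exists p; split=> //; first by rewrite vE; case: (fC p pC).
move=> q qC /(min_cycset_succ mC qC vC) qE; apply: finj => //; by rewrite -qE.
Qed.

Lemma cycset_ucycle e A : cycset e A ->
  exists c : seq V, [/\ c != [::], ucycle e c & {subset c <= A}].
Proof.
move=> /minimal_cycset[C CA mC]; have cC := minsetp mC; have fC := succ_inP cC.
have [fE finj] := min_cycset_inj mC fC; set f := succ_in e C in fC fE finj.
have f_in : {homo f : x / x \in C} by move=> x /fC[].
have /cycsetP[/set0Pn[x xC] _] := cC.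
have sub : {subset orbit f x <= C}.
  by move=> y; rewrite -fconnect_orbit => /iter_findex <-; elim: (findex _ _ _) => //= n; apply: f_in.
exists (orbit f x); split.
- by rewrite -size_eq0 size_orbit -lt0n order_gt0.
- rewrite /ucycle orbit_uniq andbT; have := cycle_orbit_in f_in finj xC.
  apply: (sub_in_cycle (P := [in C])); last by apply/allP => y /sub.
  by move=> y z yC zC /= /eqP <-; case: (fC y yC).
- by move=> y /sub yC; apply: (subsetP CA).
Qed.

Lemma incyclic_cycset e A : A != set0 ->
  (forall v, v \in A -> exists2 u, u \in A & e u v) -> exists2 B : {set V}, B \subset A & cycset e B.
Proof.
move=> A0 h; have : cycset (fun x y => e y x) A by apply/cycsetP.
case/cycset_ucycle=> c [c0 /andP[ec _] cA]; exists [set x in rev c].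
  by apply/subsetP => x; rewrite inE mem_rev => /cA.
apply: cycle_cycset; last by rewrite rev_cycle.
by rewrite -size_eq0 size_rev size_eq0.
Qed.

Lemma cycset_card3 e A : (forall x y, e x y -> ~~ e y x) -> cycset e A -> 2 < #|A|.
Proof.
move=> asym /cycsetP[/set0Pn[x xA] h].
have [y yA xy] := h x xA; have [z zA yz] := h y yA.
have xny : x != y by apply: contraTneq xy => ->; apply/negP => yy; have := asym _ _ yy; rewrite yy.
have ynz : y != z by apply: contraTneq yz => ->; apply/negP => yy; have := asym _ _ yy; rewrite yy.
have xnz : x != z by apply: contraTneq yz => <-; apply: asym.
have sub : [set x; y; z] \subset A by apply/subsetP => t; rewrite !inE -orbA => /or3P[]/eqP->.
apply: leq_trans (subset_leq_card sub).
by rewrite cardsU cards2 xny cards1 [_ :&: _](_ : _ = set0) ?cards0 //;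
   apply/setP => t; rewrite !inE; case: (eqVneq t z) => [->|];
     rewrite ?andbF // eq_sym (negbTE xnz) eq_sym (negbTE ynz).
Qed.

Lemma acyclic_sink e A : A != set0 -> (forall B, B \subset A -> ~~ cycset e B) ->
  exists2 v, v \in A & forall w, w \in A -> ~~ e v w.
Proof.
move=> A0 acyc; have := acyc A (subxx _); rewrite /cycset A0 /= => /forall_inPn[v vA /existsPn h].
exists v => // w wA; by have := h w; rewrite wA.
Qed.

End CycleSets.

(** * Disjoint cycles, trimming and contraction *)

Section TwoCycles.
Variable V : finType.
Implicit Types (e : rel V) (A B C W S : {set V}) (u v w x : V).

Definition outd e W v := #|[set w in W | e v w]|.

Definition two_cycles e W :=
  [exists A : {set V}, exists B : {set V},
    [&& A \subset W, B \subset W, cycset e A, cycset e B & [disjoint A & B]]].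

Lemma two_cyclesP e W :
  reflect (exists A B : {set V},
             [/\ A \subset W, B \subset W, cycset e A, cycset e B & [disjoint A & B]])
          (two_cycles e W).
Proof.
apply: (iffP existsP) => -[A].
  by case/existsP=> B /and5P[*]; exists A, B.
by case=> B [*]; exists A; apply/existsP; exists B; apply/and5P.
Qed.

Lemma two_cyclesS e e' W W' : subrel e e' -> W \subset W' ->
  two_cycles e W -> two_cycles e' W'.
Proof.
move=> ee' WW' /two_cyclesP[A [B [AW BW cA cB AB]]]; apply/two_cyclesP; exists A, B.
split=> //; try exact: (subset_trans _ WW'); exact: (sub_cycset ee').
Qed.

Lemma outdD e W Z v : outd e W v <= outd e (W :\: Z) v + #|[set w in Z | e v w]|.
Proof.
rewrite /outd; set X := [set w in W | e v w]; set Y := [set w in Z | e v w].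
apply: leq_trans (leq_card_setU _ _); apply/subset_leq_card/subsetP => w.
by rewrite !inE => /andP[-> ->]; case: (w \in Z).
Qed.

Lemma subset_of_card (T : finType) (X : {set T}) k : k <= #|X| ->
  exists2 Y : {set T}, Y \subset X & #|Y| = k.
Proof.
move=> kX; exists [set x in take k (enum X)].
  by apply/subsetP => x; rewrite inE => /mem_take; rewrite mem_enum.
rewrite cardsE (card_uniqP _) ?take_uniq ?enum_uniq // size_take -cardE.
by case: ltngtP kX => // ->.
Qed.

(** Removing arcs creates no cycles, so exact outdegrees may be assumed when disjoint cycles are
    sought. *)
Lemma trim_outd e W (k : V -> nat) : (forall v, v \in W -> k v <= outd e W v) ->
  exists e', [/\ subrel e' e, forall x y, e' x y -> x \in W /\ y \in W
                & forall v, v \in W -> outd e' W v = k v].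
Proof.
move=> kW; pose X v := [set w in W | e v w].
have /fin_all_exists[Y Yh] (v : V) :
    exists Y : {set V}, v \in W -> Y \subset X v /\ #|Y| = k v.
  case: (boolP (v \in W)) => [/kW/subset_of_card[Y YX Yk]|_]; first by exists Y.
  by exists set0.
exists (fun x y => (x \in W) && (y \in Y x)); split.
- by move=> x y /andP[xW yY]; have [/subsetP/(_ y yY)] := Yh x xW; rewrite inE => /andP[].
- move=> x y /andP[xW yY]; split=> //.
  by have [/subsetP/(_ y yY)] := Yh x xW; rewrite inE => /andP[].
- move=> v vW; have [/subsetP YX <-] := Yh v vW; apply: eq_card => w.
  rewrite inE vW /=; case: (boolP (w \in Y v)) => [/YX|]; rewrite ?andbF // inE.
  by case/andP => ->.
Qed.

(* Contraction of the arc uv: the vertex u disappears and its in-arcs are redirected to v. *)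
Definition contract e u v : rel V := fun x y => e x y || (y == v) && e x u.

(** A redirected arc from [x] to [v] stands for the path from [x] through [u] to [v], so adding [u]
    whenever [v] is present restores a cycle set. *)
Lemma contract_lift e u v A : e u v -> u \notin A -> cycset (contract e u v) A ->
  cycset e (if v \in A then u |: A else A).
Proof.
move=> uv uA /cycsetP[A0 h]; case: ifP => vA; apply/cycsetP; split=> //.
- by apply/set0Pn; exists u; rewrite setU11.
- move=> x; rewrite !inE => /orP[/eqP->|xA].
    by exists v; rewrite // inE vA orbT.
  have [y yA] := h x xA; case/orP => [xy|/andP[_ xu]].
    by exists y; rewrite // inE yA orbT.
  by exists u; rewrite // setU11.
- move=> x xA; have [y yA] := h x xA; case/orP => [xy|/andP[/eqP yv _]]; first by exists y.
  by rewrite -yv yA in vA.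
Qed.

Lemma contract_lift_sub v u A W : A \subset W :\ u -> u \in W ->
  (if v \in A then u |: A else A) \subset W.
Proof.
move=> AW uW; have AW' : A \subset W by apply: subset_trans AW (subD1set _ _).
by case: ifP => // _; rewrite subUset sub1set uW.
Qed.

Lemma contract_lift_disjoint v u A B W : A \subset W :\ u -> B \subset W :\ u ->
  [disjoint A & B] ->
  [disjoint (if v \in A then u |: A else A) & (if v \in B then u |: B else B)].
Proof.
move=> AW BW AB; have nu C : C \subset W :\ u -> u \notin C.
  by move=> /subsetP CW; apply/negP => /CW; rewrite !inE eqxx.
have uA := nu _ AW; have uB := nu _ BW.
case: ifP => vA; case: ifP => vB //.
- by rewrite (disjointFr AB vA) in vB.
- by rewrite disjoints_subset subUset sub1set inE uB -disjoints_subset.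
- by rewrite disjoint_sym disjoints_subset subUset sub1set inE uA -disjoints_subset disjoint_sym.
Qed.

(** Only arcs from [x] to both [u] and [v] would merge; an arc to [u] alone is exchanged for one to
    [v]. *)
Lemma outd_contract e W u v x : u \in W -> v \in W -> e u v -> ~~ (e x u && e x v) ->
  outd e W x <= outd (contract e u v) (W :\ u) x.
Proof.
move=> uW vW uv; rewrite /outd => xuv.
case: (boolP (e x u)) xuv => [xu /= xv|xu _].
  have -> : [set w in W | e x w] = u |: ([set w in W | e x w] :\ u).
    by rewrite setD1K // inE uW.
  have unv : u != v by apply: contraNneq xv => <-.
  rewrite cardsU1 !inE eqxx /=.
  have -> : [set w in W :\ u | contract e u v x w] = v |: ([set w in W | e x w] :\ u).
    apply/setP => w; rewrite !inE /contract xu andbT.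
    case: (eqVneq w v) => [->|_] /=; first by rewrite vW eq_sym unv !orbT.
    by rewrite orbF andbA.
  by rewrite [X in _ <= X]cardsU1 !inE (negbTE xv) !andbF.
apply/subset_leq_card/subsetP => w; rewrite !inE => /andP[wW xw]; rewrite wW /contract xw !andbT.
by apply: contraNneq xu => <-.
Qed.

Lemma sum_outd_ind e W : \sum_(v in W) outd e W v = \sum_(v in W) #|[set u in W | e u v]|.
Proof.
rewrite /outd; under eq_bigr do rewrite -sum1dep_card big_mkcondr /=.
rewrite exchange_big /=; apply: eq_bigr => v vW.
by rewrite -sum1dep_card [RHS]big_mkcondr.
Qed.

(** A common in-neighbour of [u] and [v] is an in-neighbour of [u] within the in-neighbourhood of
    [v], which therefore contains a cycle. *)
Lemma common_in_cycset e W v u : u \in W -> e u v ->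
  (forall u, u \in W -> e u v -> exists2 w, w \in W & e w u && e w v) ->
  exists2 A : {set V}, A \subset [set x in W | e x v] & cycset e A.
Proof.
move=> uW uv h; apply: incyclic_cycset; first by apply/set0Pn; exists u; rewrite inE uW.
move=> x; rewrite inE => /andP[xW xv]; have [w wW /andP[wx wv]] := h x xW xv.
by exists w; rewrite // inE wW.
Qed.

End TwoCycles.

(** * Two disjoint cycles with two exceptional vertices *)

Section L2.
Variable V : finType.
Implicit Types (e : rel V) (A B C W S : {set V}) (u v w x : V).

(** The induction hypothesis is a premise about all arc relations, so that it applies to
    contractions. Without digons, cycles in the in-neighbourhoods give too many arcs; a digon, on
    the other hand, calls for more than two exceptional vertices. *)
Lemma two_cycles_exact e W S :
  (forall e' W', #|W'| < #|W| -> W' != set0 -> (forall v, v \in W' -> ~~ e' v v) ->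
     (forall v, v \in W' -> 2 <= outd e' W' v) -> #|[set v in W' | outd e' W' v <= 2]| <= 2 ->
     two_cycles e' W') ->
  W != set0 -> (forall x y, e x y -> x \in W /\ y \in W) -> (forall v, ~~ e v v) ->
  S \subset W -> #|S| = 2 -> (forall v, v \in W -> outd e W v = if v \in S then 2 else 3) ->
  two_cycles e W.
Proof.
move=> IH W0 eW irr SW S2 dW; apply: contraT => no2.
have d2 v : v \in W -> 2 <= outd e W v by move=> /dW ->; case: ifP.
have special W' e' : W' \subset W -> (forall v, v \in W' -> outd e W v <= outd e' W' v) ->
    #|[set v in W' | outd e' W' v <= 2]| <= 2.
  move=> W'W dd; suff: #|[set v in W' | outd e' W' v <= 2]| <= #|S| by rewrite S2.
  apply/subset_leq_card/subsetP => v; rewrite !inE => /andP[vW' v2].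
  by have := leq_trans (dd v vW') v2; rewrite (dW _ (subsetP W'W v vW')); case: ifP.
(* Deleting a vertex without in-neighbours changes no other outdegree. *)
have indeg v : v \in W -> exists2 u, u \in W & e u v.
  move=> vW; apply/exists_inP; apply: contraNT no2 => /exists_inPn nov.
  have dE x : x \in W :\ v -> outd e W x <= outd e (W :\ v) x.
    rewrite !inE => /andP[_ xW]; apply/subset_leq_card/subsetP => y; rewrite !inE => /andP[-> xy].
    by rewrite xy !andbT; apply: contraTneq xy => ->; apply: nov.
  apply: (@two_cyclesS _ e e (W :\ v)) (subD1set _ _) _ => //; apply: IH => //.
  - by rewrite (cardsD1 v W) vW.
  - apply/set0Pn; have : 0 < outd e W v by apply: leq_trans (d2 v vW).
    case/card_gt0P=> y; rewrite inE => /andP[yW vy]; exists y; rewrite !inE yW andbT.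
    by apply: contraTneq vy => ->.
  - by move=> x xW'; apply: leq_trans (dE x xW'); apply: d2; case/setD1P: xW'.
  - exact: special (subD1set _ _) dE.
(* No cycle avoids a digon, so the remainder has a sink; its out-neighbours all lie in the digon,
   hence it is exceptional. *)
have digon u v : e u v -> e v u -> exists w,
    [/\ w \in S, w != u, w != v & [set x | e w x] = [set u; v]].
  move=> uv vu; have [uW vW] := eW _ _ uv.
  have unv : u != v by apply: contraTneq uv => ->.
  have cuv : cycset e [set u; v].
    apply/cycsetP; split; first by apply/set0Pn; exists u; rewrite !inE eqxx.
    by move=> x; rewrite !inE => /orP[]/eqP->; [exists v|exists u]; rewrite // !inE eqxx ?orbT.
  have suv : [set u; v] \subset W by apply/subsetP => x; rewrite !inE => /orP[]/eqP->.
  have rest0 : W :\: [set u; v] != set0.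
    rewrite -card_gt0 cardsD (setIidPr suv) cards2 unv subn_gt0.
    have : u |: [set w in W | e u w] \subset W.
      by rewrite subUset sub1set uW; apply/subsetP => x; rewrite inE => /andP[].
    move/subset_leq_card; rewrite cardsU1 inE (negbTE (irr u)) andbF /=.
    by apply: leq_trans; rewrite add1n ltnS; apply: d2.
  have ncyc B : B \subset W :\: [set u; v] -> ~~ cycset e B.
    move=> BW; apply: contra no2 => cB; apply/two_cyclesP; exists [set u; v], B; split=> //.
      by apply: subset_trans BW (subsetDl _ _).
    by move: BW; rewrite subsetD disjoint_sym => /andP[].
  have [w] := acyclic_sink rest0 ncyc.
  rewrite !inE negb_or => /andP[/andP[wu wv] wW] wout.
  have wsub : [set x | e w x] \subset [set u; v].
    apply/subsetP => x; rewrite inE => wx; apply: contraT => xuv.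
    have [_ xW] := eW _ _ wx; have := wout x; by rewrite in_setD xuv xW wx => /(_ erefl).
  have wd : outd e W w = #|[set x | e w x]|.
    by apply: eq_card => x; rewrite !inE; case: (boolP (e w x)) => [/eW[_ ->]|]; rewrite ?andbF.
  have wE : [set x | e w x] = [set u; v].
    by apply/eqP; rewrite eqEcard wsub cards2 unv -wd; apply: d2.
  exists w; split=> //; apply: contraT => wS; have := dW w wW.
  by rewrite wd wE cards2 unv (negbTE wS).
(* Contracting an arc of a digon would create a loop; there the sink found above is the common
   in-neighbour. *)
have common u v : e u v -> exists2 w, w \in W & e w u && e w v.
  move=> uv; have [uW vW] := eW _ _ uv.
  case: (boolP (e v u)) => [vu|nvu].
    have [w [wS _ _ wE]] := digon u v uv vu; exists w; first exact: (subsetP SW).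
    have wz z : e w z = (z == u) || (z == v) by move/setP/(_ z): wE; rewrite !inE.
    by rewrite !wz !eqxx orbT.
  apply/exists_inP; apply: contraNT no2 => /exists_inPn nocom.
  have unv : u != v by apply: contraTneq uv => ->.
  have dE x : x \in W :\ u -> outd e W x <= outd (contract e u v) (W :\ u) x.
    by case/setD1P=> _ xW; apply: outd_contract => //; apply: nocom.
  have : two_cycles (contract e u v) (W :\ u).
    apply: IH.
    - by rewrite (cardsD1 u W) uW.
    - by apply/set0Pn; exists v; rewrite !inE eq_sym unv.
    - move=> x _; rewrite /contract (negbTE (irr x)) /=; apply/negP => /andP[/eqP->].
      by rewrite (negbTE nvu).
    - by move=> x xW'; apply: leq_trans (dE x xW'); apply: d2; case/setD1P: xW'.
    - exact: special (subD1set _ _) dE.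
  case/two_cyclesP=> A [B [AW BW cA cB AB]].
  have notin C : C \subset W :\ u -> u \notin C.
    by move=> /subsetP CW; apply/negP => /CW; rewrite !inE eqxx.
  apply/two_cyclesP; do 2!eexists; split; last exact: (contract_lift_disjoint v AW BW AB).
  - exact: contract_lift_sub AW uW.
  - exact: contract_lift_sub BW uW.
  - exact: contract_lift uv (notin _ AW) cA.
  - exact: contract_lift uv (notin _ BW) cB.
have guard v : v \in W -> exists2 A : {set V}, A \subset [set x in W | e x v] & cycset e A.
  move=> vW; have [u uW uv] := indeg v vW.
  apply: (common_in_cycset uW uv) => x xW xv; exact: common.
have [/existsP[u /existsP[v /andP[uv vu]]]|nodigon] :=
    boolP [exists u, exists v, e u v && e v u]; last first.
  have asym x y : e x y -> ~~ e y x.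
    move=> xy; have /existsPn/(_ x)/existsPn/(_ y) := nodigon; by rewrite xy.
  (* Every indegree is at least 3, whereas the outdegrees sum to two less than three per vertex. *)
  have : \sum_(v in W) 3 <= \sum_(v in W) outd e W v.
    rewrite sum_outd_ind; apply: leq_sum => v /guard[A Asub cA].
    by apply: leq_trans (subset_leq_card Asub); apply: (cycset_card3 asym).
  rewrite (big_setID S) /= [X in _ <= X](big_setID S) /= (setIidPr SW).
  rewrite [X in _ <= X + _](eq_bigr (fun=> 2)); last by move=> v vS; rewrite dW ?vS ?(subsetP SW).
  rewrite [X in _ <= _ + X](eq_bigr (fun=> 3)); last first.
    by move=> v /setDP[vW vS]; rewrite dW // (negbTE vS).
  by rewrite leq_add2r !sum_nat_const S2.
(* The cycle in the in-neighbourhood of [w] must meet the digon, so an arc returns to [w] and forms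
   another digon. *)
have digonS u' v' : e u' v' -> e v' u' -> exists w, [/\ w \in S, w != u', w != v',
    [set x | e w x] = [set u'; v'] & e u' w || e v' w].
  move=> uv' vu'; have [w [wS wu wv wE]] := digon _ _ uv' vu'; exists w; split=> //.
  have wW := subsetP SW w wS; have [uW vW] := eW _ _ uv'.
  have [A Asub cA] := guard w wW; apply: contraR no2; rewrite negb_or => /andP[nu nv].
  apply/two_cyclesP; exists A, [set u'; v']; split=> //.
  - by apply: subset_trans Asub _; apply/subsetP => x; rewrite inE => /andP[].
  - by apply/subsetP => x; rewrite !inE => /orP[]/eqP->.
  - apply/cycsetP; split; first by apply/set0Pn; exists u'; rewrite !inE eqxx.
    by move=> x; rewrite !inE => /orP[]/eqP->; [exists v'|exists u']; rewrite // !inE eqxx ?orbT.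
  - rewrite disjoint_sym disjoints_subset subUset !sub1set !inE.
    by apply/andP; split; apply: contra (nu) => /(subsetP Asub); rewrite inE ?(negbTE nu) ?(negbTE nv) ?andbF.
have Sle x y z : x \in S -> y \in S -> z \in S -> x != y -> (z == x) || (z == y).
  move=> xS yS zS xy; have sub : [set x; y] \subset S by rewrite subUset !sub1set xS.
  have : [set x; y] == S by rewrite eqEcard sub S2 cards2 xy.
  by move/eqP/setP/(_ z); rewrite !inE zS.
have out2 w x y z : [set t | e w t] = [set x; y] -> e w z = (z == x) || (z == y).
  by move/setP/(_ z); rewrite !inE.
(* w and w' dominate {u,v} and {u,w}; a third digon then needs a third exceptional vertex. *)
have contra_case a b w : e a b -> e b a -> w \in S -> w != a -> w != b ->
    [set x | e w x] = [set a; b] -> e a w -> False.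
  move=> ab ba wS wa wb wE aw.
  have wA : e w a by rewrite (out2 _ _ _ _ wE) eqxx.
  have [w' [w'S w'a w'w w'E /orP h]] := digonS _ _ aw wA.
  have third z t : z \in [set w; w'] -> e z t -> e t z -> z = w \/ z = w' ->
      (z == w) && (t == w') || (z == w') && (t == w) -> False.
    move=> _ zt tz _ zw.
    have [y [yS yz yt _ _]] := digonS _ _ zt tz.
    have := Sle w w' y wS w'S yS; rewrite eq_sym w'w => /(_ erefl).
    by case/orP: zw => /andP[/eqP zE /eqP tE]; subst z t; case/orP=> /eqP yE; subst y; rewrite eqxx in yz yt.
  have w'W : e w' w by rewrite (out2 _ _ _ _ w'E) eqxx orbT.
  have ww'F : e w w' -> False.
    move=> ww'; apply: (third w w') => //; [by rewrite !inE eqxx|by left|by rewrite !eqxx].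
  case: h => [aw'|//].
  have w'A : e w' a by rewrite (out2 _ _ _ _ w'E) eqxx.
  (* The exceptional vertex for the digon on [a] and [w'] can only be [w]; then [w] and [w'] form a
     digon themselves, and none is left for it. *)
  have [y [yS ya yw' yE _]] := digonS _ _ aw' w'A.
  have := Sle w w' y wS w'S yS; rewrite eq_sym w'w => /(_ erefl) /orP[]/eqP yy.
    by subst y; apply: ww'F; rewrite (out2 _ _ _ _ yE) eqxx orbT.
  by subst y; rewrite eqxx in yw'.
have [w [wS wu wv wE /orP[uw|vw]]] := digonS u v uv vu.
  by case: (contra_case u v w).
case: (contra_case v u w) => //; by rewrite wE setUC.
Qed.

(** The exceptional set is padded to exactly two vertices and outdegrees are trimmed to 2 on it and
    3 elsewhere, so that arcs can be counted exactly. *)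
Lemma two_cycles_outd e W : W != set0 -> (forall v, v \in W -> ~~ e v v) ->
  (forall v, v \in W -> 2 <= outd e W v) -> #|[set v in W | outd e W v <= 2]| <= 2 ->
  two_cycles e W.
Proof.
have [n] := ubnP #|W|; elim: n e W => // n IHn e W Wn W0 irr d2 sp.
have /set0Pn[x xW] := W0.
have W3 : 2 < #|W|.
  have : x |: [set w in W | e x w] \subset W.
    by rewrite subUset sub1set xW; apply/subsetP => y; rewrite inE => /andP[].
  move/subset_leq_card; rewrite cardsU1 inE (negbTE (irr x xW)) andbF /=.
  by apply: leq_trans; rewrite add1n ltnS; apply: d2.
have [S [spS SW S2]] : exists S : {set V},
    [/\ [set v in W | outd e W v <= 2] \subset S, S \subset W & #|S| = 2].
  set P := [set v in W | _] in sp *.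
  have PW : P \subset W by apply/subsetP => v; rewrite inE => /andP[].
  have : 2 - #|P| <= #|W :\: P| by rewrite cardsD (setIidPr PW) leq_sub2r // ltnW.
  case/subset_of_card=> Q QW Qc; exists (P :|: Q); split; first exact: subsetUl.
    by rewrite subUset PW (subset_trans QW (subsetDl _ _)).
  move: QW; rewrite subsetD => /andP[_]; rewrite disjoint_sym -setI_eq0 => /eqP PQ.
  by rewrite cardsU PQ cards0 subn0 Qc subnKC.
pose k v := if v \in S then 2 else 3.
have kW v : v \in W -> k v <= outd e W v.
  move=> vW; rewrite /k; case: ifP => [_|vS]; first exact: d2.
  rewrite ltnNge; apply/negP => v2; move/negP: vS; apply; apply: (subsetP spS).
  by rewrite inE vW.
have [e' [e'e e'W e'd]] := trim_outd kW.
apply: (two_cyclesS e'e (subxx W)); apply: (two_cycles_exact (S := S)) => //.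
- move=> e2 W2 W2W; apply: IHn; exact: leq_trans W2W _.
- by move=> v; apply/negP => vv; have [vW _] := e'W _ _ vv; have := irr v vW; rewrite (e'e _ _ vv).
Qed.

End L2.

(** * Critical digraphs and the reduction to them *)

Section ThreeCycles.
Variable V : finType.
Implicit Types (e : rel V) (A B C W : {set V}) (u v w x : V).

Definition three_cycles e W :=
  [exists A : {set V}, [&& A \subset W, cycset e A & two_cycles e (W :\: A)]].

Lemma three_cyclesP e W :
  reflect (exists A B C : {set V},
    [/\ [/\ A \subset W, B \subset W & C \subset W], [/\ cycset e A, cycset e B & cycset e C]
      & [/\ [disjoint A & B], [disjoint A & C] & [disjoint B & C]]]) (three_cycles e W).
Proof.
apply: (iffP existsP) => [[A /and3P[AW cA /two_cyclesP[B [C []]]]]|].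
  rewrite !subsetD => /andP[BW BA] /andP[CW CA] cB cC BC; exists A, B, C.
  by split; split; rewrite // disjoint_sym.
move=> [A [B [C [[AW BW CW] [cA cB cC] [AB AC BC]]]]]; exists A; rewrite AW cA.
by apply/two_cyclesP; exists B, C; rewrite !subsetD BW CW ![[disjoint _ & A]]disjoint_sym AB AC.
Qed.

Lemma three_cyclesS e e' W W' : subrel e e' -> W \subset W' ->
  three_cycles e W -> three_cycles e' W'.
Proof.
move=> ee' WW' /existsP[A /and3P[AW cA two]]; apply/existsP; exists A; apply/and3P; split.
- exact: subset_trans AW WW'.
- exact: sub_cycset cA.
- by apply: two_cyclesS two => //; apply: setSD.
Qed.

End ThreeCycles.

(** The properties of a smallest counterexample after trimming: a vertex without in-neighbours could
    be deleted, an arc without common in-neighbour contracted. *)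
Record critical (V : finType) (e : rel V) : Prop := Critical {
  crit_vertex : 0 < #|V|;
  crit_irr : forall v, ~~ e v v;
  crit_out : forall v, #|[set w | e v w]| = 5;
  crit_in : forall v, exists u, e u v;
  crit_common : forall u v, e u v -> exists w, e w u && e w v;
  crit_no3 : ~~ three_cycles e setT }.

Section Reduction.
Hypothesis no_critical : forall (V : finType) (e : rel V), critical e -> False.

Lemma three_cycles_outd (V : finType) (e : rel V) (W : {set V}) :
  W != set0 -> (forall v, v \in W -> ~~ e v v) -> (forall v, v \in W -> 5 <= outd e W v) ->
  three_cycles e W.
Proof.
have [n] := ubnP #|W|; elim: n e W => // n IHn e0 W Wn W0 irr0 d5.
have [e [ee0 eW dW]] := trim_outd (k := fun=> 5) d5.
apply: (three_cyclesS ee0 (subxx W)); apply: contraT => no3.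
have irr v : ~~ e v v.
  by apply/negP => vv; have [vW _] := eW _ _ vv; have := irr0 v vW; rewrite (ee0 _ _ vv).
have indeg v : v \in W -> exists2 u, u \in W & e u v.
  move=> vW; apply/exists_inP; apply: contraNT no3 => /exists_inPn nov.
  have dE x : x \in W :\ v -> 5 <= outd e (W :\ v) x.
    rewrite !inE => /andP[_ xW]; rewrite -(dW x xW); apply/subset_leq_card/subsetP => y.
    rewrite !inE => /andP[-> xy].
    by rewrite xy !andbT; apply: contraTneq xy => ->; apply: nov.
  apply: (@three_cyclesS _ e e (W :\ v)) (subD1set _ _) _ => //; apply: IHn => //.
  - by move: Wn; rewrite (cardsD1 v W) vW.
  - apply/set0Pn; have : 0 < outd e W v by rewrite dW.
    case/card_gt0P=> y; rewrite inE => /andP[yW vy]; exists y; rewrite !inE yW andbT.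
    by apply: contraTneq vy => ->.
(* Deleting a digon leaves outdegrees at least 3. Digons are excluded before contracting, since
   contracting one of their arcs would create a loop. *)
have nodigon u v : e u v -> ~~ e v u.
  move=> uv; apply: contra no3 => vu; have [uW vW] := eW _ _ uv.
  apply/existsP; exists [set u; v]; apply/and3P; split.
  - by rewrite subUset !sub1set uW.
  - apply/cycsetP; split; first by apply/set0Pn; exists u; rewrite !inE eqxx.
    by move=> x; rewrite !inE => /orP[]/eqP->; [exists v|exists u]; rewrite // !inE eqxx ?orbT.
  - have dE x : x \in W :\: [set u; v] -> 3 <= outd e (W :\: [set u; v]) x.
      case/setDP=> xW _; have := outdD e W [set u; v] x; rewrite dW //.
      have : #|[set w in [set u; v] | e x w]| <= #|[set u; v]|.
        by apply/subset_leq_card/subsetP => w; rewrite inE => /andP[].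
      by rewrite cards2; case: (u != v) => /=; lia.
    apply: two_cycles_outd => //.
    + rewrite -card_gt0; have := outdD e W [set u; v] u; rewrite dW // => h.
      have : outd e (W :\: [set u; v]) u <= #|W :\: [set u; v]|.
        by apply/subset_leq_card/subsetP => w; rewrite inE => /andP[].
      have : #|[set w in [set u; v] | e u w]| <= #|[set u; v]|.
        by apply/subset_leq_card/subsetP => w; rewrite inE => /andP[].
      by rewrite cards2; case: (u != v) => /=; lia.
    + by move=> x /dE; lia.
    + set X := [set _ in _ | _]; suff -> : X = set0 by rewrite cards0.
      by apply/eqP; rewrite -subset0; apply/subsetP => x; rewrite inE => /andP[/dE]; lia.
have common u v : e u v -> exists2 w, w \in W & e w u && e w v.
  move=> uv; have [uW vW] := eW _ _ uv.
  apply/exists_inP; apply: contraNT no3 => /exists_inPn nocom.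
  have unv : u != v by apply: contraTneq uv => ->.
  have : three_cycles (contract e u v) (W :\ u).
    apply: IHn.
    - by move: Wn; rewrite (cardsD1 u W) uW.
    - by apply/set0Pn; exists v; rewrite !inE eq_sym unv.
    - move=> x _; rewrite /contract (negbTE (irr x)) /=; apply/negP => /andP[/eqP->].
      by rewrite (negbTE (nodigon _ _ uv)).
    - move=> x /setD1P[_ xW]; rewrite -(dW _ xW); apply: outd_contract => //; exact: nocom.
  case/three_cyclesP=> A [B [C [[AW BW CW] [cA cB cC] [AB AC BC]]]].
  have notin (X : {set V}) : X \subset W :\ u -> u \notin X.
    by move=> /subsetP XW; apply/negP => /XW; rewrite !inE eqxx.
  apply/three_cyclesP; do 3!eexists; split; split; last exact: (contract_lift_disjoint v BW CW BC).
  - exact: contract_lift_sub AW uW.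
  - exact: contract_lift_sub BW uW.
  - exact: contract_lift_sub CW uW.
  - exact: contract_lift uv (notin _ AW) cA.
  - exact: contract_lift uv (notin _ BW) cB.
  - exact: contract_lift uv (notin _ CW) cC.
  - exact: contract_lift_disjoint AW BW AB.
  - exact: contract_lift_disjoint AW CW AC.
(* [critical] speaks of a whole type, so the digraph is moved to the subtype of [W]. *)
pose T := {x | x \in W}; pose eT : rel T := fun x y => e (val x) (val y).
have liftW (A : {set T}) : val @: A \subset W.
  by apply/subsetP => _ /imsetP[x _ ->]; apply: valP.
have lift_cyc (A : {set T}) : cycset eT A -> cycset e (val @: A).
  case/cycsetP=> /set0Pn[x xA] h; apply/cycsetP; split.
    by apply/set0Pn; exists (val x); apply: imset_f.
  by move=> _ /imsetP[y /h[z zA yz] ->]; exists (val z); first exact: imset_f.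
have lift_dis (A B : {set T}) : [disjoint A & B] -> [disjoint val @: A & val @: B].
  rewrite -!setI_eq0 => /eqP AB; rewrite -imsetI; last by move=> x y _ _; apply: val_inj.
  by rewrite AB imset0.
exfalso; apply: (@no_critical T eT); split.
- by have /set0Pn[x xW] := W0; apply/card_gt0P; exists (Sub x xW).
- by move=> v; apply: irr.
- move=> v; rewrite -(dW _ (valP v)) /outd -(card_imset _ val_inj).
  suff -> : val @: [set w : T | eT v w] = [set w in W | e (val v) w] by [].
  apply/setP => w; apply/imsetP/idP => [[y]|].
    by move=> vy wE; move: vy; rewrite !inE wE (valP y).
  by case/setIdP=> wW vw; exists (Sub w wW) => //; rewrite inE.
- by move=> v; have [u uW uv] := indeg _ (valP v); exists (Sub u uW).
- move=> u v /common[w wW /andP[wu wv]]; exists (Sub w wW); by rewrite /eT /= wu.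
- apply: contra no3 => /three_cyclesP[A [B [C [_ [cA cB cC] [AB AC BC]]]]].
  apply/three_cyclesP; exists (val @: A), (val @: B), (val @: C).
  by split; split; rewrite ?liftW ?lift_cyc ?lift_dis.
Qed.

Lemma three_disjoint_dicycles (V : finType) (e : rel V) :
  0 < #|V| -> irreflexive e -> (forall v, 5 <= outdegree e v) ->
  exists C : 'I_3 -> seq V, (forall i, dicycle e (C i)) /\
    (forall i j, i != j -> [disjoint C i & C j]).
Proof.
move=> V0 irr d5; have : three_cycles e setT.
  apply: three_cycles_outd; first by rewrite -card_gt0 cardsT.
    by move=> v _; rewrite irr.
  move=> v _; apply: leq_trans (d5 v) _; rewrite /outd /outdegree.
  by apply/subset_leq_card/subsetP => w; rewrite !inE.
case/three_cyclesP=> A [B [C [_ [/cycset_ucycle[a [a0 ea aA]] /cycset_ucycle[b [b0 eb bB]]]]]].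
move=> /cycset_ucycle[c [c0 ec cC]] [AB AC BC].
have dis (s t : seq V) (X Y : {set V}) : {subset s <= X} -> {subset t <= Y} ->
    [disjoint X & Y] -> [disjoint s & t].
  move=> sX tY XY; rewrite disjoint_has; apply/hasPn => x /sX xX; apply/negP => /tY xY.
  by rewrite (disjointFr XY xX) in xY.
exists (fun i : 'I_3 => nth [::] [:: a; b; c] i); split.
  by case=> [[|[|[|//]]] ?] /=; split=> //; apply/eqP.
case=> [[|[|[|//]]] ?] [[|[|[|//]]] ?] //= _; try exact: (dis _ _ _ _ _ _ AB);
  try exact: (dis _ _ _ _ _ _ AC); try exact: (dis _ _ _ _ _ _ BC).
- by rewrite disjoint_sym; apply: dis AB.
- by rewrite disjoint_sym; apply: dis AC.
- by rewrite disjoint_sym; apply: dis BC.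
Qed.

End Reduction.

(** * Guarded vertices on a cycle dominating a vertex *)

Section Intercyclic.
Variables (V : finType) (e : rel V).
Implicit Types (A B C G W : {set V}) (u v w x y z : V).

Definition guarded W v :=
  [exists A : {set V}, [&& A \subset W, A \subset [set x | e x v] & cycset e A]].

Lemma path_succ a (q : seq V) v : path e a q -> v \in q ->
  v = last a q \/ exists2 w, w \in q & e v w.
Proof.
move=> ep vq; case/splitPr: q / vq ep => q1 [|w q2]; first by rewrite last_cat; left.
rewrite cat_path /= => /and4P[_ _ vw _]; right; exists w => //.
by rewrite mem_cat !inE eqxx !orbT.
Qed.

Hypothesis asym : forall u v, e u v -> ~~ e v u.
Variables (W C : {set V}) (x i j : V).
Hypotheses (no2 : ~~ two_cycles e W) (CW : C \subset W) (mC : minset (cycset e) C).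
Hypotheses (xW : x \in W) (Cx : forall c, c \in C -> e c x).
Hypothesis outW : forall v, v \in W -> 0 < outd e W v.
(** Outside a triangle every vertex keeps two out-neighbours, so this holds vacuously; outside a
    square a vertex may keep just one, and is then guarded. *)
Hypothesis out1 : forall v, v \in W -> outd e W v = 1 ->
  guarded W v /\ forall a b c, e a b -> e b c -> ~~ e c a.
Hypotheses (iC : i \in C) (jC : j \in C) (nij : i != j) (eij : ~~ e i j) (eji : ~~ e j i).

Let irr v : ~~ e v v.
Proof. by apply/negP => vv; have := asym vv; rewrite vv. Qed.

Let meet A B : A \subset W -> B \subset W -> cycset e A -> cycset e B ->
  exists2 v, v \in A & v \in B.
Proof.
move=> AW BW cA cB; apply/exists_inP; apply: contraNT no2 => /exists_inPn h.
apply/two_cyclesP; exists A, B; split=> //.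
by rewrite disjoints_subset; apply/subsetP => v vA; rewrite inE h.
Qed.

(* If both i and j were guarded, by cycles gi and gj, then every path that starts at x and
   leaves C and the guards alone until its last step must end in a vertex of both guards. *)
Section Guards.
Variables (gi gj : seq V).
Hypotheses (ui : ucycle e gi) (uj : ucycle e gj) (gi0 : gi != [::]) (gj0 : gj != [::]).
Hypotheses (giW : {subset gi <= W}) (gjW : {subset gj <= W}).
Hypotheses (gii : forall v, v \in gi -> e v i) (gjj : forall v, v \in gj -> e v j).

Let cyc_set (g : seq V) : ucycle e g -> g != [::] -> cycset e [set v in g].
Proof. by case/andP=> ec _ g0; apply: cycle_cycset. Qed.

Let setW (g : seq V) : {subset g <= W} -> [set v in g] \subset W.
Proof. by move=> gW; apply/subsetP => v; rewrite inE => /gW. Qed.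

Let step : rel V := fun a b =>
  [&& e a b, b \in W, b \notin C, b \notin gi & b \notin gj].
Let S := [set s | connect step x s].

Let Sx : x \in S. Proof. by rewrite inE connect0. Qed.

Let S_out s : s \in S -> [/\ s \in W, s \notin C, s \notin gi & s \notin gj].
Proof.
rewrite inE => /connectP[p]; case/lastP: p => [_ ->|p z]; last first.
  by rewrite rcons_path last_rcons => /andP[_ /and5P[_ ? ? ? ?]] ->.
split=> //; apply/negP.
- by move=> /Cx; apply/negP.
- by move=> /gii; apply/negP/asym/Cx.
- by move=> /gjj; apply/negP/asym/Cx.
Qed.

(* c :: x :: p closes up to a cycle that meets S, z and c only. *)
Let S_cycle s z c : s \in S -> e s z -> e z c -> c \in C -> z \in W ->
  exists B : {set V}, [/\ B \subset W, cycset e B & forall v, v \in B -> [\/ v \in S, v = z | v = c]].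
Proof.
rewrite inE => /connectP[p ep sE] sz zc cC zW.
have pS v : v \in x :: p -> v \in S.
  by move=> vp; rewrite inE; apply: (path_connect ep).
have ep' : path e x p by apply: sub_path ep => a b /and5P[].
exists [set v in [:: c, x & rcons p z]]; split.
- apply/subsetP => v; rewrite !inE mem_rcons inE => /or4P[/eqP->|/eqP->|/eqP->|vp] //.
    exact: (subsetP CW).
  by have [] := S_out (pS v _); rewrite // inE vp orbT.
- by apply: cycle_cycset => //=; rewrite Cx // rcons_path last_rcons zc andbT rcons_path ep' -sE sz.
- move=> v; rewrite !inE mem_rcons inE => /or4P[/eqP->|/eqP->|/eqP->|vp].
  + by constructor 3.
  + by constructor 1.
  + by constructor 2.
  + by constructor 1; have := pS v; rewrite !inE vp orbT => /(_ erefl).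
Qed.

Let S_cycle0 s c : s \in S -> e s c -> c \in C ->
  exists B : {set V}, [/\ B \subset W, cycset e B & forall v, v \in B -> v \in S \/ v = c].
Proof.
rewrite inE => /connectP[p ep sE] sc cC.
have pS v : v \in x :: p -> v \in S.
  by move=> vp; rewrite inE; apply: (path_connect ep).
have ep' : path e x p by apply: sub_path ep => a b /and5P[].
exists [set v in [:: c, x & p]]; split.
- apply/subsetP => v; rewrite !inE => /or3P[/eqP->|/eqP->|vp] //; first exact: (subsetP CW).
  by have [] := S_out (pS v _); rewrite // inE vp orbT.
- by apply: cycle_cycset => //=; rewrite Cx // rcons_path ep' -sE sc.
- move=> v; rewrite inE in_cons => /orP[/eqP->|/pS]; by [right|left].
Qed.

Let pred_unique k a b : k \in C -> a \in C -> b \in C -> e a k -> e b k -> a = b.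
Proof. by move=> kC aC bC ak bk; have [p [_ _ h]] := min_cycset_pred mC kC;
  rewrite (h _ aC ak) (h _ bC bk). Qed.

(** A cycle through [c], [x] and [S] can meet the two guards only in [c]; then [c] precedes both [i]
    and [j] on the induced cycle [C]. *)
Let no_exit s c : s \in S -> c \in C -> ~~ e s c.
Proof.
move=> sS cC; apply/negP => sc; have [B [BW cB hB]] := S_cycle0 sS sc cC.
have [v vB] := meet BW (setW giW) cB (cyc_set ui gi0); rewrite inE => vi.
have [w wB] := meet BW (setW gjW) cB (cyc_set uj gj0); rewrite inE => wj.
case: (hB v vB) => [/S_out[_ _]|vc]; first by rewrite vi.
case: (hB w wB) => [/S_out[_ _ _]|wc]; first by rewrite wj.
subst v w; have ci := gii vi; have cj := gjj wj.
by have := min_cycset_succ mC cC iC ci; rewrite -(min_cycset_succ mC cC jC cj) => /eqP; rewrite (negbTE nij).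
Qed.

(** If [z] lay on [gi] only, the cycle from [i] through [x], [S] and [z] back to [i] would meet [gj]
    in [i], against the absence of an arc from [i] to [j]. *)
Let hit s z : s \in S -> e s z -> z \in W -> z \notin S -> z \in gi /\ z \in gj.
Proof.
move=> sS sz zW zS; have zC : z \notin C by apply: contraL sz => /(no_exit sS).
have [zi|zi] := boolP (z \in gi); have [zj|zj] := boolP (z \in gj) => //.
- have [B [BW cB hB]] := S_cycle sS sz (gii zi) iC zW.
  have [w wB] := meet BW (setW gjW) cB (cyc_set uj gj0); rewrite inE => wj.
  case: (hB w wB) => [/S_out[_ _ _]|wz|wi]; first by rewrite wj.
    by rewrite -wz wj in zj.
  by have := gjj wj; rewrite wi (negbTE eij).
- have [B [BW cB hB]] := S_cycle sS sz (gjj zj) jC zW.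
  have [w wB] := meet BW (setW giW) cB (cyc_set ui gi0); rewrite inE => wi.
  case: (hB w wB) => [/S_out[_ _]|wz|wj]; first by rewrite wi.
    by rewrite -wz wi in zi.
  by have := gii wi; rewrite wj (negbTE eji).
- case/negP: zS; move: sS; rewrite !inE => /connect_trans; apply; apply: connect1.
  by rewrite /step sz zW zC zi zj.
Qed.

Let S_acyclic B : B \subset S -> ~~ cycset e B.
Proof.
move=> BS; apply/negP => cB.
have BW : B \subset W by apply: subset_trans BS _; apply/subsetP => v /S_out[].
have [v /(subsetP BS)/S_out[_ vC _ _]] := meet BW CW cB (minsetp mC).
by rewrite (negbTE vC).
Qed.

(** If [y] were the only exit, a sink [t] of [S] would have outdegree 1 and be guarded by some [G].
    As [t] sends an arc to [y], [G] misses [y], and then also [S], which can be left only through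
    [y]. The cycle through [i], [x], [t] and [y] thus meets [G] in [i], so that [i], [t], [y] form a
    triangle. *)
Let two_hits : exists s1 z1 s2 z2, [/\ s1 \in S, s2 \in S, e s1 z1 & e s2 z2] /\
  [/\ z1 \in W :\: S, z2 \in W :\: S & z1 != z2].
Proof.
have S0 : S != set0 by apply/set0Pn; exists x.
have [t tS tout] := acyclic_sink S0 S_acyclic; have [tW _ _ _] := S_out tS.
have := outW tW; case/card_gt0P=> y; rewrite inE => /andP[yW ty].
have yS : y \notin S by apply: contraL ty; apply: tout.
case: (boolP [exists s in S, [exists z in W :\: S, e s z && (z != y)]]).
  case/exists_inP=> s sS /exists_inP[z zW /andP[sz zy]]; exists t, y, s, z.
  by split; split; rewrite // ?in_setD ?yS // eq_sym.
move=> /exists_inPn nohit; have uniq_hit s z : s \in S -> e s z -> z \in W -> z \notin S -> z = y.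
  move=> sS sz zW zS; have /exists_inPn/(_ z) := nohit s sS.
  by rewrite in_setD zS zW sz /= negbK => /(_ erefl)/eqP.
have d1 : outd e W t = 1.
  rewrite /outd; suff -> : [set w in W | e t w] = [set y] by rewrite cards1.
  apply/setP => w; apply/setIdP/set1P => [[wW tw]|-> //].
  by apply: (uniq_hit t) => //; apply: contraL tw; apply: tout.
have [/existsP[G /and3P[GW Gt cG]] tf] := out1 tW d1.
have [yi yj] := hit tS ty yW yS.
have Gt' g : g \in G -> e g t by move=> /(subsetP Gt); rewrite inE.
have yG : y \notin G by apply/negP => /Gt'; apply/negP/asym.
have GS g : g \in G -> g \notin S.
  move=> gG; apply/negP => gS; have : G :&: S \subset S by apply: subsetIr.
  move=> /S_acyclic/negP; apply; apply/cycsetP; split; first by apply/set0Pn; exists g; rewrite in_setI gG.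
  move=> s /setIP[sG sS]; have /cycsetP[_ h] := cG.
  have [w wG sw] := h s sG; exists w => //; rewrite in_setI wG /=.
  apply: contraT => wS; have wy := uniq_hit s w sS sw (subsetP GW w wG) wS.
  by rewrite -wy wG in yG.
have [B [BW cB hB]] := S_cycle tS ty (gii yi) iC yW.
have [g gB gG] := meet BW GW cB cG; case: (hB g gB) => [gS|gy|gi'].
- by rewrite (negbTE (GS g gG)) in gS.
- by rewrite -gy gG in yG.
- subst g; by have := tf _ _ _ (Gt' _ gG) ty; rewrite (gii yi).
Qed.

(** From the predecessor [p] of [i] on [C], follow [gi] to the earlier of two exits and go on to
    [j]: with the rest of [C] this avoids [i], while a second cycle runs through [i], [x], [S] and
    the later exit. *)
Lemma guards_absurd : False.
Proof.
have ci := cyc_set ui gi0.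
have [p pC] := meet CW (setW giW) (minsetp mC) ci; rewrite inE => pgi.
have [r s' rotE] := rot_to pgi.
have ep : path e p (rcons s' p) by have /andP[] := ui; rewrite -(rot_cycle r) rotE.
have us : uniq (p :: s') by rewrite -rotE rot_uniq; case/andP: ui.
have main s2 z1 z2 : s2 \in S -> e s2 z2 -> z2 \in W -> z1 \in gi -> z1 \in gj -> z2 \in gi ->
    z1 \notin C -> z2 \notin C -> z1 != z2 -> index z1 s' < index z2 s' -> False.
  move=> s2S sz2 z2W z1i z1j z2i z1C z2C z12 lt.
  have memg v : (v \in gi) = (v == p) || (v \in s') by rewrite -(mem_rot r) rotE inE.
  have z1s : z1 \in s' by move: z1i; rewrite memg; case: eqP => // zp; rewrite zp pC in z1C.
  set q := take (index z1 s').+1 s'.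
  have qE : q = rcons (take (index z1 s') s') z1.
    by rewrite /q (take_nth z1) ?index_mem // nth_index.
  have eq : path e p q.
    by move: ep; rewrite rcons_path -{1}(cat_take_drop (index z1 s').+1 s') cat_path => /andP[/andP[]].
  have z2q : z2 \notin q.
    by apply/negP => /index_ltn; rewrite ltnS leqNgt lt.
  have qi v : v \in q -> v \in gi by move=> /mem_take; rewrite memg => ->; rewrite orbT.
  have [B [BW cB hB]] := S_cycle s2S sz2 (gii z2i) iC z2W.
  (* Only [p] loses its successor [i], and it continues along [q]; the end [z1] of [q] goes to [j].
     That [q] may return to [C] does not matter for a cycle set. *)
  have cA : cycset e ((C :\ i) :|: [set v in q]).
    apply/cycsetP; split; first by apply/set0Pn; exists j; rewrite !inE jC eq_sym nij.
    move=> v; rewrite !inE => /orP[/andP[vi vC]|vq].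
      have /cycsetP[_ h] := minsetp mC; have [w wC vw] := h v vC.
      case: (eqVneq w i) => [wi|wi]; last by exists w; rewrite // !inE wi wC.
      have -> : v = p by apply: (pred_unique iC) => //; [rewrite -wi|apply: gii].
      have q0 : q != [::] by rewrite -size_eq0 qE size_rcons.
      case: (q) q0 eq => // w' q' _ /andP[pw' _].
      by exists w'; rewrite // !inE eqxx !orbT.
    have [vE|[w wq vw]] := path_succ eq vq; last by exists w; rewrite // !inE wq orbT.
    exists j; first by rewrite !inE jC eq_sym nij.
    by rewrite vE qE last_rcons; apply: gjj.
  have AW : (C :\ i) :|: [set v in q] \subset W.
    rewrite subUset (subset_trans (subD1set _ _) CW) /=; apply/subsetP => v.
    by rewrite inE => /qi/giW.
  have [v] := meet AW BW cA cB; rewrite !inE => vA /hB vB.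
  case: vB => [/S_out[_ vC vgi _]|vz|vi].
  - by case/orP: vA => [/andP[_]|/qi]; rewrite ?(negbTE vC) ?(negbTE vgi).
  - by move: vA; rewrite vz (negbTE z2C) andbF (negbTE z2q).
  - move: vA; rewrite vi eqxx /= => /qi/gii; exact/negP.
have [s1 [z1 [s2 [z2 [[s1S s2S sz1 sz2] [/setDP[z1W z1S] /setDP[z2W z2S] z12]]]]]] := two_hits.
have [z1i z1j] := hit s1S sz1 z1W z1S.
have [z2i z2j] := hit s2S sz2 z2W z2S.
have z1C : z1 \notin C by apply: contraL sz1 => /(no_exit s1S).
have z2C : z2 \notin C by apply: contraL sz2 => /(no_exit s2S).
case: (ltngtP (index z1 s') (index z2 s')) => [|gt|eqi].
- exact: main s2S sz2 z2W z1i z1j z2i z1C z2C z12.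
- by apply: main s1S sz1 z1W z2i z2j z1i z2C z1C _ gt; rewrite eq_sym.
- have ins z : z \in gi -> z \notin C -> z \in s'.
    rewrite -(mem_rot r) rotE inE => /orP[/eqP->|//]; by rewrite pC.
  have := nth_index p (ins _ z1i z1C); rewrite eqi nth_index ?ins // => z21.
  by rewrite z21 eqxx in z12.
Qed.

End Guards.

Lemma guarded_consecutive : ~ (guarded W i /\ guarded W j).
Proof.
have unpack v : guarded W v -> exists g : seq V, [/\ g != [::], ucycle e g, {subset g <= W}
    & forall u, u \in g -> e u v].
  case/existsP=> A /and3P[AW Av /cycset_ucycle[g [g0 ug gA]]]; exists g; split=> //.
    by move=> u /gA; apply: (subsetP AW).
  by move=> u /gA/(subsetP Av); rewrite inE.
case=> /unpack[gi [? ? ? ?]] /unpack[gj [? ? ? ?]]; exact: (@guards_absurd gi gj).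
Qed.

End Intercyclic.

(** * The certificate checker *)

Definition bmem (m : bitseq) i := nth false m i.

Fixpoint bits_from k (m : bitseq) : seq nat :=
  if m is b :: m' then if b then k :: bits_from k.+1 m' else bits_from k.+1 m' else [::].
Definition bits := bits_from 0.

Fixpoint bor (a b : bitseq) : bitseq :=
  match a, b with
  | [::], _ => b
  | _, [::] => a
  | x :: a', y :: b' => (x || y) :: bor a' b'
  end.

Fixpoint bdiff (a b : bitseq) : bitseq :=
  match a, b with
  | [::], _ => [::]
  | _, [::] => a
  | x :: a', y :: b' => (x && ~~ y) :: bdiff a' b'
  end.

Fixpoint bmeet (a b : bitseq) : bool :=
  match a, b with
  | x :: a', y :: b' => x && y || bmeet a' b'
  | _, _ => false
  end.

Fixpoint bsub (a b : bitseq) : bool :=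
  match a, b with
  | [::], _ => true
  | x :: a', [::] => ~~ x && bsub a' [::]
  | x :: a', y :: b' => (x ==> y) && bsub a' b'
  end.

Definition bset (m : bitseq) i := set_nth false m i true.
Definition bof (s : seq nat) : bitseq := foldr (fun i m => bset m i) [::] s.

Definition graph := seq bitseq.
Definition out (Y : graph) u : bitseq := nth [::] Y u.
Definition arc (Y : graph) u v := bmem (out Y u) v.
Definition addarc (Y : graph) u v : graph := set_nth [::] Y u (bset (out Y u) v).

Definition iscyc (Y : graph) (m : bitseq) := has id m && all (fun u => bmeet (out Y u) m) (bits m).

Fixpoint peel_from (Y : graph) (R : bitseq) (k : nat) (m : bitseq) : bitseq :=
  if m is b :: m' then (b && bmeet (out Y k) R) :: peel_from Y R k.+1 m' else [::].
Fixpoint core (fuel : nat) (Y : graph) (R : bitseq) : bitseq :=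
  if fuel is n.+1 then let R' := peel_from Y R 0 R in if R' == R then R else core n Y R' else R.
(** [core] strips vertices without out-neighbours in the remaining set. Its result is tested again,
    so soundness needs no fact about [core] or its fuel. *)
Definition has_cyc n (Y : graph) (R : bitseq) :=
  let c := core n Y R in iscyc Y c && bsub c R.

(** Breadth-first search inside [R]; the nested [bdiff] intersects [next] with the unseen part of
    [R]. Running out of fuel can only miss a path, hence a contradiction. *)
Fixpoint reach (fuel : nat) (Y : graph) (R seen front : bitseq) (u : nat) : bool :=
  bmem seen u ||
  (if fuel is n.+1 then
     let next := foldr (fun w => bor (out Y w)) [::] (bits front) in
     let front' := bdiff next (bdiff next (bdiff R seen)) in
     if has id front' then reach n Y R (bor seen front') front' u else false
   else false).

(* Vertices are 0, .., nv - 1; gr and neg are the arcs known to be present and absent; cyc lists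
   vertex sets of known cycles, and prs lists unions of two disjoint ones, so that every cycle
   of a counterexample meets each member of prs. *)
Record state := State { nv : nat; gr : graph; neg : graph; cyc : seq bitseq; prs : seq bitseq }.

(* [Hub]: every triangle passes through vertex 0. *)
Inductive mode := Free | Hub | TriangleFree.

Definition rest n (P : bitseq) := bdiff (nseq n true) P.

Definition tri_bad (md : mode) u v (tr : seq nat) :=
  match md with
  | Free => false
  | Hub => [&& u != 0, v != 0 & has (fun w => w != 0) tr]
  | TriangleFree => tr != [::]
  end.

(** [None] signals a third disjoint cycle. A set that meets every cycle makes its supersets
    redundant, so only minimal pairs are kept. *)
Fixpoint new_pairs n (Y : graph) (c : bitseq) (cy pr : seq bitseq) : option (seq bitseq) :=
  if cy is d :: cy' then
    if bmeet c d then new_pairs n Y c cy' pr else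
    let P := bor c d in
    if has (fun Q => bsub Q P) pr then new_pairs n Y c cy' pr else
    if has_cyc n Y (rest n P) then None else
    new_pairs n Y c cy' (P :: [seq Q <- pr | ~~ bsub P Q])
  else Some pr.

Fixpoint new_cycles n (Y : graph) (cand cy pr : seq bitseq) : option (seq bitseq * seq bitseq) :=
  if cand is c :: cand' then
    if has (fun d => bsub d c) cy || ~~ iscyc Y c then new_cycles n Y cand' cy pr else
    if new_pairs n Y c cy pr is Some pr' then
      new_cycles n Y cand' (c :: [seq d <- cy | ~~ bsub c d]) pr'
    else None
  else Some (cy, pr).

Definition add (md : mode) (st : state) (u v : nat) : option state :=
  let: State n Y F cy pr := st in
  if arc Y u v then Some st else
  if [|| u == v, arc F u v, arc Y v u | 5 <= size (bits (out Y u))] then None else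
  let tr := [seq w <- bits (out Y v) | arc Y w u] in
  if tri_bad md u v tr then None else
  let Y' := addarc Y u v in
  (* The arc would close a path from [v] to [u] to a cycle that avoids a known pair. *)
  if has (fun P => [&& ~~ bmem P u, ~~ bmem P v & reach n Y (rest n P) (bof [:: v]) (bof [:: v]) u]) pr
  then None else
  let uv := bof [:: u; v] in
  (* Only triangles and squares through the new arc are recorded; longer cycles enter through
     [add_cycle]. *)
  let cand := [seq bset uv w | w <- tr] ++
    flatten [seq [seq bset (bset uv w) x | x <- bits (out Y' w) & (x != v) && arc Y' x u]
            | w <- bits (out Y' v) & w != u] in
  if new_cycles n Y' cand cy pr is Some (cy', pr') then Some (State n Y' F cy' pr') else None.

Definition arcs := seq (nat * nat).

Fixpoint addl md st (l : arcs) : option state :=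
  if l is (u, v) :: l' then if add md st u v is Some st' then addl md st' l' else None
  else Some st.

Definition freshen st := let: State n Y F cy pr := st in
  State n.+1 (rcons Y [::]) (rcons F [::]) cy pr.

(* Once a choice is settled, its only missing arc may be assumed absent. *)
Definition exclude st (l : arcs) :=
  let: State n Y F cy pr := st in
  if [seq a <- l | ~~ arc Y a.1 a.2] is [:: (u, v)]
  then if (u < n) && (v < n) then State n Y (addarc F u v) cy pr else st else st.

Definition choice := (bool * arcs)%type.

(** Alternatives refuted on the spot are skipped, so a certificate has subtrees only for the others.
    The last state returned carries the exclusions made so far. *)
Fixpoint next md (st : state) (l : seq choice) : option (state * seq choice * state) :=
  if l is (fr, a) :: l' then
    let st1 := if fr then st else exclude st a in
    if addl md (if fr then freshen st else st) a is Some t then Some (t, l', st1)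
    else next md st1 l'
  else None.

(* Each rule is a fact about the digraph, turned into a finite list of alternatives:
   Hit p v: some u in the pair p has u -> v;  Pass p v: moreover u -> w -> v for some w;
   Dom a b c: at least 3 vertices dominate the triangle abc;
   Dom4 a b c d: at least 3 vertices send 3 arcs to the square abcd;
   HubTwo a b c x: if x dominates abc with a the hub, then a -> w -> x for at least 2 vertices w;
   MissTwo a b c d x: if x -> b, c, d then a -> w -> x for at least 2 vertices w;
   MissPath a b c d x: moreover a -> g, q, r for a path g -> q -> r with q, r -> x and g, q, r <> b;
   All4 a b c d x: no vertex dominates a square;
   Sink p: some vertex outside the pair p has all its out-neighbours in it. *)
Inductive rule :=
  | Hit of nat & nat
  | Pass of nat & nat
  | Dom of nat & nat & nat
  | Dom4 of nat & nat & nat & nat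
  | HubTwo of nat & nat & nat & nat
  | MissTwo of nat & nat & nat & nat & nat
  | MissPath of nat & nat & nat & nat & nat
  | All4 of nat & nat & nat & nat & nat
  | Sink of nat.

Fixpoint combs k (l : seq nat) : seq (seq nat) :=
  if k is k'.+1 then
    if l is x :: l' then [seq x :: c | c <- combs k' l'] ++ combs k l' else [::]
  else [:: [::]].

(** The index [n] stands for a vertex that has no name yet. *)
Definition cand_vertices n (known : pred nat) := [seq w <- iota 0 n.+1 | (w == n) || ~~ known w].

Definition path_arcs Y (l : seq nat) := all (fun p => arc Y p.1 p.2) (zip l (behead l)).

Definition choices md st (r : rule) : option (seq choice) :=
  let: State n Y F cy pr := st in
  match r with
  | Hit p v => if (p < size pr) && (v < n) then
      Some [seq (false, [:: (u, v)]) | u <- bits (nth [::] pr p)] else None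
  | Pass p v => if (p < size pr) && (v < n) then
      Some (flatten [seq [seq (w == n, [:: (u, v); (u, w); (w, v)]) | w <- cand_vertices n pred0]
                    | u <- bits (nth [::] pr p)]) else None
  | Dom a b c =>
      let known w := all (arc Y w) [:: a; b; c] in
      if path_arcs Y [:: a; b; c; a] && (size [seq w <- iota 0 n | known w] < 3) then
        Some [seq (w == n, [seq (w, t) | t <- [:: a; b; c]]) | w <- cand_vertices n known]
      else None
  | Dom4 a b c d =>
      let z := [:: a; b; c; d] in
      let known w := 3 <= count (arc Y w) z in
      if (if md is TriangleFree then true else false) &&
         path_arcs Y [:: a; b; c; d; a] && (size [seq w <- iota 0 n | known w] < 3) then
        Some (flatten [seq [seq (w == n, [seq (w, t) | t <- z & t != o]) | o <- z]
                      | w <- cand_vertices n known])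
      else None
  | HubTwo a b c x =>
      let known w := arc Y a w && arc Y w x in
      if (if md is Hub then true else false) && (a == 0) && path_arcs Y [:: a; b; c; a] &&
         all (arc Y x) [:: a; b; c] && (size [seq w <- iota 0 n | known w] < 2) then
        Some [seq (w == n, [:: (a, w); (w, x)]) | w <- cand_vertices n known]
      else None
  | MissTwo a b c d x =>
      let known w := arc Y a w && arc Y w x in
      if (if md is TriangleFree then true else false) && path_arcs Y [:: a; b; c; d; a] &&
         all (arc Y x) [:: b; c; d] && (size [seq w <- iota 0 n | known w] < 2) then
        Some [seq (w == n, [:: (a, w); (w, x)]) | w <- cand_vertices n known]
      else None
  (* Once all five out-neighbours of [a] are named, the path lies among them and no fresh vertex is
     involved. *)
  | MissPath a b c d x =>
      let G := [seq w <- bits (out Y a) | w != b] in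
      if (if md is TriangleFree then true else false) && path_arcs Y [:: a; b; c; d; a] &&
         all (arc Y x) [:: b; c; d] && (5 <= size (bits (out Y a))) then
        Some (flatten [seq flatten [seq [seq (false, [:: (q, x); (r, x); (q, r); (g, q)])
                | g <- G & (g != q) && (g != r)] | r <- G & r != q] | q <- G])
      else None
  | All4 a b c d x =>
      if (if md is TriangleFree then true else false) && path_arcs Y [:: a; b; c; d; a] &&
         all (arc Y x) [:: a; b; c; d] then Some [::] else None
  | Sink p =>
      let P := nth [::] pr p in
      (* A named vertex outside the pair ensures that the acyclic complement is nonempty and so has
         a sink. *)
      if (p < size pr) && has (fun w => ~~ bmem P w) (iota 0 n) then
      Some (flatten [seq [seq (w == n, [seq (w, t) | t <- s]) | s <- combs 5 (bits P)]
                    | w <- cand_vertices n (bmem P)]) else None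
  end.

Inductive tree := Node of rule & seq tree.

Fixpoint check md st (t : tree) : bool :=
  let: Node r kids := t in
  if choices md st r is Some l then
    (fix go (st : state) (l : seq choice) (kids : seq tree) : bool :=
       match next md st l, kids with
       | None, [::] => true
       | Some (st', l', st1), k :: ks => check md st' k && go st1 l' ks
       | _, _ => false
       end) st l kids
  else false.

Definition start n := State n (nseq n [::]) (nseq n [::]) [::] [::].

Definition add_cycle st (c : bitseq) : option state :=
  let: State n Y F cy pr := st in
  if iscyc Y c then
    Some (State n Y F (c :: cy) ([seq bor c d | d <- cy & ~~ bmeet c d] ++ pr)) else None.

Definition certified md n (l : arcs) (extra : seq (seq nat)) (t : tree) :=
  if addl md (start n) l is Some st then
    if foldl (fun o s => obind (add_cycle^~ (bof s)) o) (Some st) extra is Some st' then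
      check md st' t
    else false
  (* The listed arcs alone are already contradictory. *)
  else true.

(** * Bit sequences as finite sets of indices *)

Lemma mem_bits_from k m i : (i \in bits_from k m) = (k <= i) && nth false m (i - k).
Proof.
elim: m k => [|b m IH] k /=; first by rewrite nth_nil andbF.
have aux : (i \in bits_from k.+1 m) = (k < i) && nth false (b :: m) (i - k).
  by rewrite IH; case: (ltnP k i) => //= ki; rewrite -(subnSK ki).
case: b aux => aux; rewrite ?inE aux; case: ltngtP => //= ->; by rewrite subnn.
Qed.

Lemma mem_bits m i : (i \in bits m) = bmem m i.
Proof. by rewrite mem_bits_from subn0. Qed.

Lemma uniq_bits m : uniq (bits m).
Proof.
rewrite /bits; elim: m 0 => //= b m IH k; case: b => //=.
by rewrite IH andbT mem_bits_from ltnn.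
Qed.

Lemma bmem_bor a b i : bmem (bor a b) i = bmem a i || bmem b i.
Proof.
rewrite /bmem; elim: a b i => [|x a IH] [|y b] [|i] //=; by rewrite ?orbF.
Qed.

Lemma bmem_bdiff a b i : bmem (bdiff a b) i = bmem a i && ~~ bmem b i.
Proof.
rewrite /bmem; elim: a b i => [|x a IH] [|y b] [|i] //=; by rewrite ?andbT.
Qed.

Lemma bmeetP a b : reflect (exists i, bmem a i && bmem b i) (bmeet a b).
Proof.
rewrite /bmem; elim: a b => [|x a IH] b.
  by right => -[i]; rewrite nth_nil.
case: b => [|y b]; first by right => -[i]; rewrite nth_nil andbF.
apply: (iffP orP) => [[xy|/IH[i h]]|[[|i] h]]; first by exists 0.
- by exists i.+1.
- by left.
- by right; apply/IH; exists i.
Qed.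

Lemma bsubP a b i : bsub a b -> bmem a i -> bmem b i.
Proof.
rewrite /bmem; elim: a b i => [|x a IH] [|y b] [|i] //=; rewrite ?nth_nil //.
- by case/andP=> /negbTE ->.
- by case/andP=> _ /IH h /h; rewrite nth_nil.
- by case/andP=> /implyP.
- by case/andP=> _ /IH h /h.
Qed.

Lemma bmem_bset m i j : bmem (bset m i) j = (j == i) || bmem m j.
Proof. by rewrite /bmem nth_set_nth /=; case: eqP. Qed.

Lemma bmem_bof s i : bmem (bof s) i = (i \in s).
Proof. by elim: s => [|x s IH] /=; rewrite ?bmem_bset ?inE ?IH // /bmem nth_nil. Qed.

Lemma bmem_rest n P i : bmem (rest n P) i = (i < n) && ~~ bmem P i.
Proof. by rewrite bmem_bdiff /bmem nth_nseq; case: ltnP. Qed.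

Lemma arc_addarc Y u v (a b : nat) : arc (addarc Y u v) a b = (a == u) && (b == v) || arc Y a b.
Proof.
rewrite /arc /addarc {1}/out nth_set_nth /=; case: (eqVneq a u) => [->|//].
by rewrite bmem_bset.
Qed.

Lemma has_id_bmem m : has id m -> exists i, bmem m i.
Proof. by move/(has_nthP false) => [i _ h]; exists i. Qed.

Lemma combsP k s l : subseq s l -> size s = k -> s \in combs k l.
Proof.
elim: l k s => [|x l IH] k s; first by rewrite subseq0 => /eqP-> <-.
case: s => [_ <-|y s]; first by rewrite inE.
case: k => // k /= sub [sk]; rewrite mem_cat.
move: sub; case: eqP => [->|_] sub; last by rewrite (IH k.+1 _ sub) ?orbT //= sk.
by rewrite map_f // IH.
Qed.

(** * Soundness of the checker *)

Section Soundness.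
Variables (V : finType) (e : rel V).
Hypothesis cr : critical e.
Variables (md : mode) (h : V).

Let irr := crit_irr cr.
Hypothesis asym : forall u v, e u v -> ~~ e v u.

Definition triangle x y z := [&& e x y, e y z & e z x].
Definition square a b c d := [&& e a b, e b c, e c d & e d a].

Definition mode_ok : Prop :=
  match md with
  | Free => True
  | Hub =>
    (forall x y z, triangle x y z -> [|| x == h, y == h | z == h]) /\
    (forall b c x, triangle h b c -> [&& e x h, e x b & e x c] ->
       2 <= #|[set w | e h w && e w x]|)
  | TriangleFree =>
    [/\ forall x y z, ~~ triangle x y z,
        forall a b c d, square a b c d -> 3 <= #|[set w | 3 <= count (e w) [:: a; b; c; d]]|,
        forall a b c d x, square a b c d -> [&& e x b, e x c & e x d] ->
          ~~ e x a /\ 2 <= #|[set w | e a w && e w x]|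
      & forall a b c d x, square a b c d -> [&& e x b, e x c & e x d] ->
          exists g q r, [/\ [/\ e a g, e a q & e a r], [/\ g != b, q != b & r != b]
                          & [/\ e q x, e r x, e q r & e g q]]]
  end.
Hypothesis md_ok : mode_ok.

Implicit Types (f : nat -> V) (st : state).

Definition img f (m : bitseq) : {set V} := [set x in map f (bits m)].

Lemma in_img f m x : reflect (exists2 i, bmem m i & x = f i) (x \in img f m).
Proof.
rewrite inE; apply: (iffP mapP) => -[i im ->]; exists i; rewrite // ?mem_bits //.
by rewrite -mem_bits.
Qed.

Definition bounded n (m : bitseq) := forall i, bmem m i -> i < n.

Definition good_pair f n P := bounded n P /\ exists A B : {set V},
  [/\ cycset e A, cycset e B, [disjoint A & B] & img f P = A :|: B].

Definition arcs_ok f n (Y : graph) := forall u v, arc Y u v -> [&& u < n, v < n & e (f u) (f v)].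
Definition inj_to f n := forall i j, i < n -> j < n -> f i = f j -> i = j.

(** [f] reads the indices as distinct vertices of the critical digraph; a state that admits such a
    reading must never be refuted. *)
Record ok f st : Prop := Ok {
  ok_hub : f 0 = h;
  ok_pos : 0 < nv st;
  ok_inj : inj_to f (nv st);
  ok_arc : arcs_ok f (nv st) (gr st);
  ok_neg : forall u v, arc (neg st) u v -> [&& u < nv st, v < nv st & ~~ e (f u) (f v)];
  ok_cyc : forall c, c \in cyc st -> bounded (nv st) c /\ cycset e (img f c);
  ok_prs : forall P, P \in prs st -> good_pair f (nv st) P }.

Lemma iscyc_cycset f n Y c : arcs_ok f n Y -> iscyc Y c -> cycset e (img f c).
Proof.
move=> aY /andP[/has_id_bmem[i ic] /allP cc]; apply/cycsetP; split.
  by apply/set0Pn; exists (f i); apply/in_img; exists i.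
move=> x /in_img[j jc ->]; have := cc j; rewrite mem_bits => /(_ jc) /bmeetP[k /andP[jk kc]].
by exists (f k); [apply/in_img; exists k | case/and3P: (aY j k jk)].
Qed.

Lemma iscyc_bounded f n Y c : arcs_ok f n Y -> iscyc Y c -> bounded n c.
Proof.
move=> aY /andP[_ /allP cc] i; rewrite -mem_bits => /cc /bmeetP[k /andP[ik _]].
by case/and3P: (aY i k ik).
Qed.

Lemma good_pair_meets f n P A : good_pair f n P -> cycset e A -> exists2 x, x \in A & x \in img f P.
Proof.
case=> _ [B [C [cB cC BC ->]]] cA; apply/exists_inP; apply: contraNT (crit_no3 cr).
move=> /exists_inPn hA; apply/three_cyclesP; exists A, B, C; split; split; rewrite ?subsetT //.
  by rewrite disjoints_subset; apply/subsetP => x xA; have := hA x xA; rewrite !inE negb_or => /andP[].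
by rewrite disjoints_subset; apply/subsetP => x xA; have := hA x xA; rewrite !inE negb_or => /andP[].
Qed.

Lemma img_disjoint f n a b : inj_to f n -> bounded n a -> bounded n b -> ~~ bmeet a b ->
  [disjoint img f a & img f b].
Proof.
move=> finj ba bb /bmeetP ab; rewrite disjoints_subset; apply/subsetP => x /in_img[i ia ->].
rewrite in_setC; apply/in_img => -[j jb ij]; case: ab; exists i.
by rewrite ia (finj i j (ba i ia) (bb j jb) ij) jb.
Qed.

Lemma good_pair_bor f n c d : inj_to f n -> bounded n c -> bounded n d -> ~~ bmeet c d ->
  cycset e (img f c) -> cycset e (img f d) -> good_pair f n (bor c d).
Proof.
move=> finj bc bd cd cc cd'; split.
  by move=> i; rewrite bmem_bor => /orP[/bc|/bd].
exists (img f c), (img f d); split=> //; first exact: (img_disjoint finj bc bd cd).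
apply/setP => x; apply/in_img/setUP => [[i]|].
  by rewrite bmem_bor => /orP[ic|id] ->; [left|right]; apply/in_img; exists i.
by case=> /in_img[i im ->]; exists i; rewrite // bmem_bor im ?orbT.
Qed.

Lemma has_cyc_absurd f n Y P : arcs_ok f n Y -> inj_to f n -> good_pair f n P ->
  ~~ has_cyc n Y (rest n P).
Proof.
move=> aY finj gP; apply/negP => /andP[ic sub].
have [x /in_img[i ic' ->] /in_img[j jP ij]] := good_pair_meets gP (iscyc_cycset aY ic).
have := bsubP sub ic'; rewrite bmem_rest => /andP[iN /negP]; apply.
by rewrite (finj i j iN (gP.1 j jP) ij).
Qed.

Lemma reach_path f n Y Rm k seen front u v :
  arcs_ok f n Y ->
  (forall w, bmem seen w -> exists p, [/\ path e (f v) p, last (f v) p = f w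
      & {subset f v :: p <= img f Rm}]) ->
  (forall w, bmem front w -> bmem seen w) ->
  reach k Y Rm seen front u ->
  exists p, [/\ path e (f v) p, last (f v) p = f u & {subset f v :: p <= img f Rm}].
Proof.
move=> aY; elim: k seen front => [|k IH] seen front hs fs /=.
  by rewrite orbF => /hs.
case/orP=> [/hs //|]; set nx := foldr _ _ _; set fr := bdiff _ _; case: ifP => // _.
have nxP w : bmem nx w -> exists2 y, bmem front y & arc Y y w.
  rewrite /nx; have sub : {subset bits front <= bits front} by [].
  elim: {1 3}(bits front) sub => [|y s IHs] sub /=; first by rewrite /bmem nth_nil.
  rewrite bmem_bor => /orP[yw|]; last by apply: IHs => z zs; apply: sub; rewrite inE zs orbT.
  by exists y; rewrite // -mem_bits sub // mem_head.
have frP w : bmem fr w -> bmem nx w && bmem Rm w.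
  rewrite /fr !bmem_bdiff !negb_and !negbK; by case: (bmem nx w) => //=; case: (bmem Rm w).
apply: IH => [w|w]; rewrite bmem_bor; last by move=> ->; rewrite orbT.
case/orP=> [/hs //|/frP/andP[/nxP[y /fs/hs[p [ep lp sp]] yw] wR]].
exists (rcons p (f w)); split.
- by rewrite rcons_path ep lp; case/and3P: (aY _ _ yw).
- by rewrite last_rcons.
- move=> z; rewrite -rcons_cons mem_rcons inE => /orP[/eqP->|/sp //].
  by apply/in_img; exists w.
Qed.

Lemma new_pairs_ok f n Y c cy pr : arcs_ok f n Y -> inj_to f n ->
  bounded n c -> cycset e (img f c) ->
  (forall d, d \in cy -> bounded n d /\ cycset e (img f d)) ->
  (forall P, P \in pr -> good_pair f n P) ->
  exists2 pr', new_pairs n Y c cy pr = Some pr' & forall P, P \in pr' -> good_pair f n P.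
Proof.
move=> aY finj bc cc; elim: cy pr => [|d cy IH] pr hcy hpr /=; first by exists pr.
have [bd cd] := hcy d (mem_head _ _).
have hcy' d' : d' \in cy -> bounded n d' /\ cycset e (img f d').
  by move=> d'c; apply: hcy; rewrite inE d'c orbT.
case: ifP => [_|/negbT dis]; first exact: IH.
have gP := good_pair_bor finj bc bd dis cc cd.
case: ifP => [_|_]; first exact: IH.
rewrite (negbTE (has_cyc_absurd aY finj gP)); apply: IH => // P.
by rewrite inE mem_filter => /orP[/eqP->|/andP[_ /hpr]].
Qed.

Lemma new_cycles_ok f n Y cand cy pr : arcs_ok f n Y -> inj_to f n ->
  (forall d, d \in cy -> bounded n d /\ cycset e (img f d)) ->
  (forall P, P \in pr -> good_pair f n P) ->
  exists cy' pr', [/\ new_cycles n Y cand cy pr = Some (cy', pr'),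
    forall d, d \in cy' -> bounded n d /\ cycset e (img f d)
    & forall P, P \in pr' -> good_pair f n P].
Proof.
move=> aY finj; elim: cand cy pr => [|c cand IH] cy pr hcy hpr /=; first by exists cy, pr.
case: ifP => [_|/negbT]; first exact: IH.
rewrite negb_or negbK => /andP[_ ic].
have bc := iscyc_bounded aY ic; have cc := iscyc_cycset aY ic.
have [pr' -> hpr'] := new_pairs_ok aY finj bc cc hcy hpr.
apply: IH => // d; by rewrite inE mem_filter => /orP[/eqP->|/andP[_ /hcy]].
Qed.

(** Each way in which [add] can fail contradicts the critical digraph: a loop or digon, an arc known
    absent, a sixth out-neighbour, a triangle barred by the mode, or a third disjoint cycle. *)
Lemma add_ok f st u v : ok f st -> u < nv st -> v < nv st -> e (f u) (f v) ->
  exists st', [/\ add md st u v = Some st', ok f st' & nv st' = nv st].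
Proof.
case: st => n Y F cy pr [/= fh n0 finj aY nF cyc_ok prs_ok] un vn uv.
case: ifP => [_|/negbT auv]; first by exists (State n Y F cy pr); split.
have -> : [|| u == v, arc F u v, arc Y v u | 5 <= size (bits (out Y u))] = false.
  apply/negbTE; rewrite !negb_or; apply/and4P; split.
  - by apply: contraTneq uv => ->; apply: irr.
  - by apply/negP => /nF/and3P[_ _]; rewrite uv.
  - by apply/negP => /aY/and3P[_ _]; apply/negP/asym.
  - rewrite -ltnNge ltnS -ltnS -(crit_out cr (f u)).
    set s := v :: bits (out Y u).
    have sn i : i \in s -> i < n /\ e (f u) (f i).
      by rewrite inE => /orP[/eqP->|]; rewrite // mem_bits => /aY/and3P[].
    have us : uniq (map f s).
      rewrite map_inj_in_uniq; last by move=> i j /sn[il _] /sn[jl _]; apply: finj.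
      by rewrite /= uniq_bits andbT mem_bits.
    have -> : (size (bits (out Y u))).+1 = size (map f s) by rewrite size_map.
    rewrite -(card_uniqP us); apply/subset_leq_card/subsetP => _ /mapP[i /sn[_ ui] ->].
    by rewrite inE.
have -> : tri_bad md u v [seq w <- bits (out Y v) | arc Y w u] = false.
  have tri w : w \in [seq w <- bits (out Y v) | arc Y w u] ->
      w < n /\ triangle (f u) (f v) (f w).
    rewrite mem_filter mem_bits => /andP[/aY/and3P[_ _ wu] /aY/and3P[_ wn vw]].
    by rewrite /triangle uv vw wu.
  move: md_ok; rewrite /mode_ok /tri_bad; case: md => //.
  - case=> hub _; apply/negbTE/negP => /and3P[u0 v0 /hasP[w /tri[wn /hub]]].
    rewrite -fh => /or3P[]/eqP/finj E /negP; apply; apply/eqP; last exact: E.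
      by move: u0; rewrite (E un n0).
    by move: v0; rewrite (E vn n0).
  - case=> tf _ _ _; case: [seq _ <- _ | _] tri => //= w s /(_ w (mem_head _ _))[_].
    by rewrite (negbTE (tf _ _ _)).
have aY' : arcs_ok f n (addarc Y u v).
  by move=> a b; rewrite arc_addarc => /orP[/andP[/eqP-> /eqP->]|/aY //]; rewrite un vn.
have -> : has (fun P => [&& ~~ bmem P u, ~~ bmem P v
    & reach n Y (rest n P) (bof [:: v]) (bof [:: v]) u]) pr = false.
  apply/negbTE/hasPn => P Ppr; apply/negP => /and3P[Pu Pv rch].
  have gP := prs_ok P Ppr.
  have [||p [ep lp sp]] := reach_path (v := v) aY _ _ rch => //.
    move=> w; rewrite bmem_bof inE => /eqP->; exists [::]; split=> // z; rewrite inE => /eqP->.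
    by apply/in_img; exists v; rewrite // bmem_rest vn Pv.
  have ccyc : cycle e (f v :: p) by rewrite /= rcons_path ep lp.
  have [x] := good_pair_meets gP (cycle_cycset (isT : f v :: p != [::]) ccyc).
  rewrite inE => /sp/in_img[i] + ->; rewrite bmem_rest => /andP[iN /negP iP] /in_img[j jP ij].
  by apply: iP; rewrite (finj i j iN (gP.1 j jP) ij).
set cand := _ ++ _.
have [cy' [pr' [-> hcy hpr]]] := new_cycles_ok cand aY' finj cyc_ok prs_ok.
by exists (State n (addarc Y u v) F cy' pr').
Qed.

Definition holds f n (l : arcs) := all (fun a => [&& a.1 < n, a.2 < n & e (f a.1) (f a.2)]) l.

Lemma addl_ok f st l : ok f st -> holds f (nv st) l ->
  exists st', [/\ addl md st l = Some st', ok f st' & nv st' = nv st].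
Proof.
elim: l st => [|[u v] l IH] st okst /=; first by exists st.
case/andP=> /and3P[un vn uv] hl.
have [st1 [-> ok1 n1]] := add_ok okst un vn uv.
have [|st2 [-> ok2 n2]] := IH st1 ok1; first by rewrite n1.
by exists st2; rewrite n2 n1.
Qed.

Definition extend f n x i := if i == n then x else f i.

Definition choice_holds f n (o : choice) :=
  if o.1 then exists2 x, (forall i, i < n -> f i != x) & holds (extend f n x) n.+1 o.2
  else holds f n o.2.

Definition covers f n (l : seq choice) := exists2 o, o \in l & choice_holds f n o.

Lemma freshen_ok f st x : ok f st -> (forall i, i < nv st -> f i != x) ->
  ok (extend f (nv st) x) (freshen st).
Proof.
case: st => n Y F cy pr [/= fh n0 finj aY nF cyc_ok prs_ok] fx.
have ext i : i < n -> extend f n x i = f i by rewrite /extend; case: eqP => // ->; rewrite ltnn.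
have arcE (Z : graph) a b : arc (rcons Z [::]) a b = arc Z a b.
  rewrite /arc /out nth_rcons; case: ltnP => // sa; rewrite if_same.
  by rewrite [nth _ Z a]nth_default.
have imgE m : bounded n m -> img (extend f n x) m = img f m.
  by move=> bm; apply/setP => y; apply/in_img/in_img => -[i im ->]; exists i; rewrite // ext ?bm.
have bS m : bounded n m -> bounded n.+1 m by move=> bm i /bm; lia.
split=> //=.
- by rewrite ext.
- move=> i j; rewrite /extend !ltnS; case: (eqVneq i n) => [->|i1]; case: (eqVneq j n) => [->|j1] //.
  + move=> _ jn xj; have := fx j; rewrite -xj eqxx => /(_ ltac:(lia)) //.
  + move=> jn _ xj; have := fx i; rewrite xj eqxx => /(_ ltac:(lia)) //.
  + by move=> iN jN; apply: finj; lia.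
- move=> u v; rewrite arcE => /aY/and3P[un vn uv]; rewrite !ext //; apply/and3P; split=> //; lia.
- move=> u v; rewrite arcE => /nF/and3P[un vn uv]; rewrite !ext //; apply/and3P; split=> //; lia.
- move=> c /cyc_ok[bc cc]; split; [exact: bS | by rewrite imgE].
- move=> P /prs_ok[bP [A [B hAB]]]; split; [exact: bS | by exists A, B; rewrite imgE].
Qed.

Lemma exclude_ok f st l : ok f st -> ~~ holds f (nv st) l ->
  ok f (exclude st l) /\ nv (exclude st l) = nv st.
Proof.
move=> okst nh; case: st okst nh => n Y F cy pr okst /= nh.
case lE : [seq a <- l | ~~ arc Y a.1 a.2] => [|[u v] [|]] //.
case: ifP => // /andP[un vn]; split=> //; case: okst => /= fh n0 finj aY nF cyc_ok prs_ok.
split=> //= a b; rewrite arc_addarc => /orP[/andP[/eqP-> /eqP->]|/nF //]; rewrite un vn /=.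
apply: contra nh => uv; apply/allP => -[c d] cd /=.
case: (boolP (arc Y c d)) => [/aY //|ncd].
have : (c, d) \in [seq a <- l | ~~ arc Y a.1 a.2] by rewrite mem_filter ncd.
by rewrite lE inE => /eqP[-> ->]; rewrite un vn.
Qed.

Lemma next_ok f st l : ok f st -> covers f (nv st) l ->
  exists t l' st1, next md st l = Some (t, l', st1) /\
    ((exists f', ok f' t) \/ [/\ ok f st1, nv st1 = nv st & covers f (nv st) l']).
Proof.
elim: l st => [|[fr a] l IH] st okst [o]; first by rewrite in_nil.
rewrite inE => oin oh /=.
case: fr oin => oin /=.
  case: (boolP (o == (true, a))) oin => [/eqP oE _|_ /= ol].
    move: oh; rewrite oE /choice_holds /= => -[x fx hx].
    have okf := freshen_ok okst fx.
    have [|t [tE okt _]] := addl_ok (l := a) okf; first by case: (st) hx.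
    by rewrite tE; exists t, l, st; split=> //; left; eexists; exact: okt.
  have cl : covers f (nv st) l by exists o.
  case: (addl _ _ _) => [t|]; last exact: IH.
  by exists t, l, st; split=> //; right.
case: (boolP (holds f (nv st) a)) => [ha|nha].
  have [t [-> okt _]] := addl_ok okst ha.
  by exists t, l, (exclude st a); split=> //; left; exists f.
have [okx nx] := exclude_ok okst nha.
have cl : covers f (nv st) l.
  move: oin => /orP[/eqP oE|ol]; last by exists o.
  by move: oh; rewrite oE /choice_holds /= (negbTE nha).
case: (addl _ _ _) => [t|]; last by rewrite -nx; apply: IH; rewrite ?nx.
by exists t, l, (exclude st a); split=> //; right.
Qed.

(** Pigeonhole: the known vertices are too few to fill [X]. *)
Lemma fresh_vertex f n (known : pred nat) (X : {set V}) :
  size [seq w <- iota 0 n | known w] < #|X| ->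
  exists2 x, x \in X & (exists w, [/\ w < n, ~~ known w & x = f w]) \/ (forall i, i < n -> f i != x).
Proof.
move=> lt; set Ks := [set x in map f [seq w <- iota 0 n | known w]].
have /subsetPn[x xX xK] : ~~ (X \subset Ks).
  apply: contraL lt => /subset_leq_card XK; rewrite -leqNgt; apply: leq_trans XK _.
  by rewrite cardsE; apply: leq_trans (card_size _) _; rewrite size_map.
exists x => //; case: (boolP (x \in map f (iota 0 n))) => [/mapP[w]|xn].
  rewrite mem_iota /= add0n => wn xE; left; exists w; split=> //.
  by apply: contra xK => kw; rewrite inE xE map_f // mem_filter kw mem_iota.
by right => i iN; apply: contra xn => /eqP <-; rewrite map_f // mem_iota.
Qed.

Lemma mem_cand n (known : pred nat) w : w < n -> ~~ known w -> w \in cand_vertices n known.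
Proof. by move=> wn kw; rewrite mem_filter kw orbT mem_iota /=; lia. Qed.

Lemma mem_cand_fresh n known : n \in cand_vertices n known.
Proof. by rewrite mem_filter eqxx mem_iota /=; lia. Qed.

Lemma extendE f n x i : i < n -> extend f n x i = f i.
Proof. by rewrite /extend; case: eqP => // ->; rewrite ltnn. Qed.

Lemma extend_last f n x : extend f n x n = x.
Proof. by rewrite /extend eqxx. Qed.

(* Options are listed as (w == n, g w): either an old vertex f w or a new one plays the role of w. *)
Lemma vertex_choice f n x (g : nat -> arcs) (l : seq choice) :
  (exists w, [/\ w < n, x = f w & (false, g w) \in l]) \/
    (forall i, i < n -> f i != x) /\ (true, g n) \in l ->
  (forall f' m w, (forall i, i < n -> f' i = f i) -> n <= m -> w < m -> f' w = x -> holds f' m (g w)) ->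
  covers f n l.
Proof.
move=> [[w [wn xE wl]]|[fx nl]] hg.
  by exists (false, g w) => //; apply: (hg f n w).
exists (true, g n) => //=; exists x => //.
by apply: hg; rewrite ?extend_last // => i iN; rewrite extendE.
Qed.

(** A cycle outside [A :|: B] would be a third one, so the complement is acyclic. *)
Lemma pair_sink A B : cycset e A -> cycset e B -> [disjoint A & B] -> A :|: B != setT ->
  exists2 s, s \notin A :|: B & [set w | e s w] \subset A :|: B.
Proof.
move=> cA cB AB ABT; have C0 : ~: (A :|: B) != set0 by apply: contraNneq ABT => AB0;
  rewrite -[_ :|: _]setCK AB0 setC0.
have ac (C : {set V}) : C \subset ~: (A :|: B) -> ~~ cycset e C.
  move=> CAB; apply: contra (crit_no3 cr) => cC; apply/three_cyclesP; exists A, B, C.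
  move: CAB; rewrite setCU subsetI -!disjoints_subset ![[disjoint C & _]]disjoint_sym.
  by case/andP=> AC BC; split; split; rewrite ?subsetT.
have [s sC sout] := acyclic_sink C0 ac; exists s; first by rewrite inE in sC.
by apply/subsetP => w; rewrite inE; apply: contraLR => wAB; apply: sout; rewrite inE.
Qed.

Lemma in_guard v : exists2 A : {set V}, A \subset [set x | e x v] & cycset e A.
Proof.
have [u uv] := crit_in cr v.
have [|A Asub cA] := common_in_cycset (W := setT) (in_setT u) uv.
  by move=> x _ xv; have [w wxv] := crit_common cr xv; exists w.
by exists A => //; apply: subset_trans Asub _; apply/subsetP => x; rewrite !inE.
Qed.

(** The cycle in the in-neighbourhood of [v] meets the pair in [f i], and [w] follows [f i] in
    it. *)
Lemma pass_pair f n P v : good_pair f n P ->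
  exists i w, [/\ bmem P i, e (f i) v, e (f i) w & e w v].
Proof.
move=> gP; have [G Gv cG] := in_guard v; have Gv' g : g \in G -> e g v by move=> /(subsetP Gv); rewrite inE.
have [u uG /in_img[i iP uE]] := good_pair_meets gP cG; subst u.
have /cycsetP[_ hG] := cG; have [w wG iw] := hG _ uG.
by exists i, w; rewrite iP iw !Gv'.
Qed.

Hypothesis dom3 : forall a b c, triangle a b c -> 3 <= #|[set w | [&& e w a, e w b & e w c]]|.

Lemma cand_choice f n known (X : {set V}) (g : nat -> arcs) :
  size [seq w <- iota 0 n | known w] < #|X| ->
  (forall f' m w, (forall i, i < n -> f' i = f i) -> n <= m -> w < m -> f' w \in X ->
     holds f' m (g w)) ->
  covers f n [seq (w == n, g w) | w <- cand_vertices n known].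
Proof.
move=> /fresh_vertex-/(_ f)[x xX hx] hg; apply: (@vertex_choice f n x g).
  case: hx => [[w [wn kw xE]]|fx]; [left; exists w; split=> //|right; split=> //]; apply/mapP.
    by exists w; [apply: mem_cand | rewrite ltn_eqF].
  by exists n; [apply: mem_cand_fresh | rewrite eqxx].
by move=> f' m w ff nm wm fw; apply: hg; rewrite ?fw.
Qed.

Lemma full_out f n Y a y : arcs_ok f n Y -> inj_to f n -> 5 <= size (bits (out Y a)) ->
  e (f a) y -> exists2 i, i \in bits (out Y a) & y = f i.
Proof.
move=> aY finj s5 ay; have sn i : i \in bits (out Y a) -> i < n /\ e (f a) (f i).
  by rewrite mem_bits => /aY/and3P[].
have us : uniq (map f (bits (out Y a))).
  by rewrite map_inj_in_uniq ?uniq_bits // => i j /sn[il _] /sn[jl _]; apply: finj.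
have /eqP E : [set x in map f (bits (out Y a))] == [set w | e (f a) w].
  rewrite eqEcard (crit_out cr) cardsE (card_uniqP us) size_map s5 andbT.
  by apply/subsetP => x; rewrite !inE => /mapP[i /sn[_ ai] ->].
by have : y \in [set w | e (f a) w]; [rewrite inE|rewrite -E inE => /mapP].
Qed.

Lemma choices_ok f st r l : ok f st -> choices md st r = Some l -> covers f (nv st) l.
Proof.
case: st => n Y F cy pr [/= fh n0 finj aY nF cyc_ok prs_ok].
have arcE u v : arc Y u v -> e (f u) (f v) by case/aY/and3P.
have arcL u v : arc Y u v -> u < n by case/aY/and3P.
have arcR u v : arc Y u v -> v < n by case/aY/and3P.
case: r => [p v|p v|a b c|a b c d|a b c x|a b c d x|a b c d x|a b c d x|p] /=.
- case: ifP => // /andP[pP vn] [<-]; have gP := prs_ok _ (mem_nth [::] pP).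
  have [i [w [iP iv _ _]]] := pass_pair (f v) gP.
  exists (false, [:: (i, v)]); first by apply: map_f; rewrite mem_bits.
  by rewrite /choice_holds /= vn iv (gP.1 i iP).
- case: ifP => // /andP[pP vn] [<-]; have gP := prs_ok _ (mem_nth [::] pP).
  have [i [y [iP iv iy yv]]] := pass_pair (f v) gP; have iN := gP.1 i iP.
  apply: (@vertex_choice f n y (fun w => [:: (i, v); (i, w); (w, v)])).
    case: (boolP (y \in map f (iota 0 n))) => [/mapP[w]|yn].
      rewrite mem_iota /= add0n => wn yE; left; exists w; split=> //.
      apply/flatten_mapP; exists i; first by rewrite mem_bits.
      by apply/mapP; exists w; [apply: mem_cand | rewrite ltn_eqF].
    right; split; first by move=> j jn; apply: contra yn => /eqP <-; rewrite map_f // mem_iota.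
    apply/flatten_mapP; exists i; first by rewrite mem_bits.
    by apply/mapP; exists n; [apply: mem_cand_fresh | rewrite eqxx].
  move=> f' m w ff nm wm fw; rewrite /holds /= fw (ff i iN) (ff v vn) iv iy yv wm.
  by rewrite !(leq_trans _ nm).
- case: ifP => // /andP[/= /and4P[ab bc ca _] ks] [<-].
  pose X := [set w | [&& e w (f a), e w (f b) & e w (f c)]].
  apply: (cand_choice (X := X)) => [|f' m w ff nm wm].
    apply: leq_trans ks _; apply: dom3; by rewrite /triangle !arcE.
  rewrite inE => /and3P[wa wb wc]; rewrite /holds /= wm (ff a) ?(ff b) ?(ff c) ?wa ?wb ?wc
    ?(arcL _ _ ab) ?(arcL _ _ bc) ?(arcL _ _ ca) //.
  by rewrite !(leq_trans _ nm) ?(arcL _ _ ab) ?(arcL _ _ bc) ?(arcL _ _ ca).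
- case mdE : md => //=; case: ifP => // /andP[/and5P[ab bc cd da _] ks] [<-].
  move: md_ok; rewrite /mode_ok mdE => -[_ dom4 _ _].
  have := leq_trans ks (dom4 (f a) (f b) (f c) (f d) _); rewrite /square !arcE // => /(_ isT).
  move=> /fresh_vertex-/(_ f)[x + hx]; rewrite inE => xX.
  (* A vertex of the square that [x] may miss; [x] sends arcs to the other three. *)
  pose o := if ~~ e x (f a) then a else if ~~ e x (f b) then b else if ~~ e x (f c) then c else d.
  have oz : o \in [:: a; b; c; d] by rewrite /o !inE; do !case: ifP => _; rewrite eqxx ?orbT.
  have ox t : t \in [:: a; b; c; d] -> t != o -> t < n /\ e x (f t).
    move=> tz tno; split.
      by move: tz; rewrite !inE => /or4P[]/eqP->;
        [exact: arcL ab|exact: arcL bc|exact: arcL cd|exact: arcL da].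
    move: xX tz tno; rewrite /o /= !inE.
    case xa: (e x (f a)); case xb: (e x (f b)); case xc: (e x (f c)); case xd: (e x (f d)) => //= _;
      by move=> /or4P[]/eqP->; rewrite ?eqxx.
  apply: (@vertex_choice f n x (fun w => [seq (w, t) | t <- [:: a; b; c; d] & t != o])).
    case: hx => [[w [wn kw xE]]|fx]; [left; exists w; split=> //|right; split=> //]; apply/flatten_mapP.
      exists w; first exact: mem_cand.
      by have := map_f (fun o => (w == n, [seq (w, t) | t <- [:: a; b; c; d] & t != o])) oz;
        rewrite {1}(ltn_eqF wn).
    exists n; first exact: mem_cand_fresh.
    by have := map_f (fun o => (n == n, [seq (n, t) | t <- [:: a; b; c; d] & t != o])) oz; rewrite {1}eqxx.
  move=> f' m w ff nm wm fw; apply/allP => _ /mapP[t + ->]; rewrite mem_filter => /andP[tno tz] /=.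
  by have [tn xt] := ox t tz tno; rewrite wm (leq_trans tn nm) fw ff.
- case mdE : md => //=; case: ifP => //.
  case/andP=> /andP[/andP[/eqP a0 /and4P[ab bc ca _]] /and4P[xa xb xc _]] ks [<-]; subst a.
  move: md_ok; rewrite /mode_ok mdE => -[_ hub2].
  apply: (cand_choice (X := [set w | e h w && e w (f x)])) => [|f' m w ff nm wm].
    apply: leq_trans ks _; apply: (hub2 (f b) (f c)); rewrite -fh; first by rewrite /triangle !arcE.
    by rewrite !arcE.
  rewrite inE -fh => /andP[hw wx]; rewrite /holds /= wm (ff 0) ?(ff x) ?(arcL _ _ xa) // hw wx.
  by rewrite !(leq_trans _ nm) ?(arcL _ _ xa).
- case mdE : md => //=; case: ifP => //.
  case/andP=> /andP[/and5P[ab bc cd da _] /and4P[xb xc xd _]] ks [<-].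
  move: md_ok; rewrite /mode_ok mdE => -[_ _ miss2 _].
  have [||_ two] := miss2 (f a) (f b) (f c) (f d) (f x); rewrite /square ?arcE //.
  apply: (cand_choice (X := [set w | e (f a) w && e w (f x)])) => [|f' m w ff nm wm].
    exact: leq_trans ks two.
  rewrite inE => /andP[aw wx]; rewrite /holds /= wm (ff a) ?(ff x) ?(arcL _ _ xb) ?(arcL _ _ ab) // aw wx.
  by rewrite !(leq_trans _ nm) ?(arcL _ _ xb) ?(arcL _ _ ab).
- case mdE : md => //=; case: ifP => //.
  case/andP=> /andP[/and5P[ab bc cd da _] /and4P[xb xc xd _]] s5 [<-].
  move: md_ok; rewrite /mode_ok mdE => -[_ _ _ path3].
  have [||g [q [r [[ag aq ar] [gb qb rb] [qx rx qr gq]]]]] := path3 (f a) (f b) (f c) (f d) (f x);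
    rewrite /square ?arcE //.
  have idx y : e (f a) y -> y != f b -> exists i, [/\ i < n, y = f i &
      i \in [seq w <- bits (out Y a) | w != b]].
    move=> /(full_out aY finj s5)[i ia ->] yb; exists i; split=> //; first by move: ia;
      rewrite mem_bits => /arcR.
    by rewrite mem_filter ia andbT; apply: contraNneq yb => ->.
  have neq i k : e (f i) (f k) -> i != k by apply: contraTneq => ->; apply: irr.
  have [gi [gn gE gG]] := idx g ag gb; have [qi [qn qE qG]] := idx q aq qb.
  have [ri [rn rE rG]] := idx r ar rb; subst g q r.
  exists (false, [:: (qi, x); (ri, x); (qi, ri); (gi, qi)]).
    apply/flatten_mapP; exists qi => //; apply/flatten_mapP; exists ri.
      by rewrite mem_filter rG eq_sym (neq _ _ qr).
    apply/mapP; exists gi => //; rewrite mem_filter gG (neq _ _ gq) /= andbT.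
    by apply: contraTneq gq => ->; apply: asym.
  by rewrite /choice_holds /= qx rx qr gq qn rn gn (arcL _ _ xb).
- case mdE : md => //=; case: ifP => // /andP[/and5P[ab bc cd da _] /and5P[xa xb xc xd _]] _.
  move: md_ok; rewrite /mode_ok mdE => -[_ _ miss2 _].
  by have [||] := miss2 (f a) (f b) (f c) (f d) (f x); rewrite /square ?arcE // (arcE _ _ xa).
- case: ifP => // /andP[pP /hasP[w0 + w0P]] [<-]; rewrite mem_iota /= add0n => w0n.
  set P := nth [::] pr p in w0P *; have gP : good_pair f n P := prs_ok _ (mem_nth [::] pP).
  have [bP [A [B [cA cB AB PE]]]] := gP.
  have [|s sP sout] := pair_sink cA cB AB.
    rewrite -PE; apply: contraNneq w0P => PT; have : f w0 \in img f P by rewrite PT.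
    by case/in_img=> i iP /(finj _ _ w0n (bP i iP)) ->.
  rewrite -PE in sP sout; pose sub := [seq t <- bits P | e s (f t)].
  have s5 : size sub = 5.
    rewrite -(crit_out cr s) -(size_map f) -(card_uniqP _).
      apply: eq_card => y; rewrite [in RHS]inE; apply/mapP/idP => [[t]|sy].
        by rewrite mem_filter => /andP[st _] ->.
      have /(subsetP sout)/in_img[i iP yE] : y \in [set w | e s w] by rewrite inE.
      by exists i; rewrite // mem_filter mem_bits iP -yE sy.
    rewrite map_inj_in_uniq ?filter_uniq ?uniq_bits // => i k.
    by rewrite !mem_filter !mem_bits => /andP[_ /bP iN] /andP[_ /bP kN]; apply: finj.
  have subC : sub \in combs 5 (bits P) by apply: combsP => //; apply: filter_subseq.
  apply: (@vertex_choice f n s (fun w => [seq (w, t) | t <- sub])).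
    case: (boolP (s \in map f (iota 0 n))) => [/mapP[w]|sn].
      rewrite mem_iota /= add0n => wn sE; left; exists w; split=> //.
      apply/flatten_mapP; exists w; last by apply/mapP; exists sub; rewrite // ltn_eqF.
      by apply: mem_cand => //; apply: contra sP => wP; apply/in_img; exists w.
    right; split; first by move=> j jn; apply: contra sn => /eqP <-; rewrite map_f // mem_iota.
    apply/flatten_mapP; exists n; first exact: mem_cand_fresh.
    by apply/mapP; exists sub; rewrite // eqxx.
  move=> f' m w ff nm wm fw; apply/allP => _ /mapP[t + ->];
    rewrite mem_filter mem_bits => /andP[st /bP tn] /=.
  by rewrite wm (leq_trans tn nm) fw ff.
Qed.

(** Induction reaching into the nested list of subtrees. *)
Fixpoint tree_rect' (P : tree -> Prop)
    (H : forall r kids, foldr (fun k => and (P k)) True kids -> P (Node r kids)) t : P t :=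
  let: Node r kids := t in
  H r kids ((fix go ks : foldr (fun k => and (P k)) True ks :=
    if ks is k :: ks' then conj (tree_rect' H k) (go ks') else I) kids).

Lemma check_sound t f st : ok f st -> ~~ check md st t.
Proof.
elim/tree_rect': t f st => r kids IH f st okst /=.
case E: (choices md st r) => [l|//]; have cov := choices_ok okst E.
elim: kids st l IH okst cov {E} => [|k ks IHk] st l.
  by move=> _ okst /(next_ok okst)[t [l' [st1 [-> _]]]].
move=> [Hk Hks] okst /(next_ok okst)[t [l' [st1 [-> [[f' /Hk kF]|[ok1 n1 cov1]]]]]].
  by rewrite negb_and kF.
by rewrite negb_and (IHk _ _ Hks ok1) ?orbT // n1.
Qed.

Lemma start_ok f n : f 0 = h -> 0 < n -> inj_to f n -> ok f (start n).
Proof.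
move=> fh n0 finj; have noarc u v : arc (nseq n [::]) u v = false.
  by rewrite /arc /out nth_nseq if_same /bmem nth_nil.
by split=> //= u v; rewrite noarc.
Qed.

Lemma add_cycle_ok f st c st' : ok f st -> add_cycle st c = Some st' -> ok f st'.
Proof.
case: st => n Y F cy pr [/= fh n0 finj aY nF cyc_ok prs_ok]; case: ifP => // ic [<-].
have bc := iscyc_bounded aY ic; have cc := iscyc_cycset aY ic.
split=> //= P; first by rewrite inE => /orP[/eqP->|/cyc_ok].
rewrite mem_cat => /orP[/mapP[d + ->]|/prs_ok //]; rewrite mem_filter => /andP[cd /cyc_ok[bd dd]].
exact: good_pair_bor cd cc dd.
Qed.

Lemma certified_sound f n l extra t : certified md n l extra t ->
  f 0 = h -> 0 < n -> inj_to f n -> ~~ holds f n l.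
Proof.
move=> + fh n0 finj; apply: contraL => hl; rewrite /certified.
have [st [-> okst _]] := addl_ok (st := start n) (start_ok fh n0 finj) hl.
elim: extra st okst => [|s extra IH] st okst /=; first exact: check_sound okst.
case cE : (add_cycle st (bof s)) => [st1|]; first by apply: IH; apply: add_cycle_ok cE.
by rewrite (_ : foldl _ None extra = None) //; elim: (extra).
Qed.

End Soundness.

(** * Certificates for the four local configurations *)

Local Notation leaf r := (Node r [::]).
(** Two disjoint triangles 0 1 2 and 3 4 5, and a vertex 6 with arcs to all of them but 5. A cycle
    in the in-neighbourhood of 6 must meet the triangles, so the root leaves only the arc from 5 to
    6. *)
Definition cert_33 : tree :=
Node(Hit 0 6)[::Node(Dom 4 5 6)[::Node(Hit 0 7)[::Node(Dom 0 7 6)[::Node(Dom 0 7 6)[::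
Node(Dom 0 7 6)[::Node(Hit 0 8)[::Node(Hit 2 9)[::Node(Hit 4 10)[::Node(Dom 3 10 6)[::
Node(Hit 6 11)[::leaf(Hit 17 8)]]]];Node(Hit 2 9)[::Node(Hit 4 10)[::Node(Dom 4 10 6)[::
Node(Hit 6 11)[::Node(Pass 17 6)[::Node(Dom 4 10 6)[::Node(Hit 10 13)[::Node(Dom 4 10 6)[::
Node(Hit 20 14)[::Node(Pass 0 14)[::Node(Pass 0 11)[::leaf(Pass 0 13)];Node(Pass 0 13)[::leaf(Pass 0 11)
]]]]]]]]]]];Node(Hit 1 9)[::Node(Pass 2 10)[::Node(Pass 3 8)[::leaf(Pass 3 9)];Node(Pass 3 9)[::
leaf(Pass 3 8)]]]]]]];Node(Dom 1 7 6)[::Node(Dom 1 7 6)[::Node(Dom 1 7 6)[::Node(Hit 0 8)[::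
Node(Hit 2 9)[::Node(Hit 4 10)[::Node(Dom 3 10 6)[::Node(Hit 6 11)[::leaf(Hit 17 8)]]]];
Node(Hit 2 9)[::Node(Hit 4 10)[::Node(Dom 4 10 6)[::Node(Hit 6 11)[::Node(Pass 17 6)[::
Node(Dom 4 10 6)[::Node(Hit 10 13)[::Node(Dom 4 10 6)[::Node(Hit 20 14)[::Node(Pass 0 14)[::
Node(Pass 0 11)[::leaf(Pass 0 13)];Node(Pass 0 13)[::leaf(Pass 0 11)]]]]]]]]]]];Node(Hit 1 9)[::
Node(Pass 2 10)[::Node(Pass 3 8)[::leaf(Pass 3 9)];Node(Pass 3 9)[::leaf(Pass 3 8)]]]]]]];
Node(Dom 2 7 6)[::Node(Dom 2 7 6)[::Node(Hit 0 8)[::Node(Hit 2 9)[::Node(Dom 3 9 6)[::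
Node(Hit 4 10)[::leaf(Hit 12 8)]]];Node(Hit 2 9)[::Node(Dom 4 9 7)[::Node(Hit 4 10)[::
Node(Pass 9 6)[::Node(Dom 4 9 7)[::Node(Hit 4 12)[::Node(Dom 2 12 9)[::Node(Dom 2 10 9)[::
Node(Hit 7 13)[::Node(Pass 0 13)[::Node(Hit 17 11)[::leaf(Pass 0 14)]]]];Node(Hit 0 13)[::
Node(Dom 4 13 12)[::Node(Pass 0 10)[::Node(Pass 0 14)[::leaf(Pass 0 8)]];Node(Pass 0 14)[::
leaf(Pass 0 10)]]]]]]]]]];Node(Hit 1 9)[::Node(Dom 5 9 7)[::Node(Hit 2 10)[::Node(Dom 5 9 7)[::
Node(Hit 3 11)[::Node(Dom 2 11 9)[::Node(Dom 2 10 9)[::leaf(Pass 6 12)];Node(Pass 0 12)[::leaf(Pass 0 8)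
]]]]]]]]]]]]].

(** The triangle 0 1 2 with hub 0, dominated by 3, and two paths from 0 to 3, through 4 and through
    5. *)
Definition cert_hub : tree :=
Node(Dom 0 5 3)[::Node(Dom 0 5 3)[::Node(Dom 0 5 3)[::Node(HubTwo 0 5 3 6)[::
Node(HubTwo 0 5 3 6)[::Node(Dom 0 9 6)[::Node(HubTwo 0 9 6 7)[::Node(HubTwo 0 9 6 7)[::
Node(Dom 0 10 7)[::Node(HubTwo 0 10 7 8)[::leaf(HubTwo 0 10 7 8)];Node(HubTwo 0 10 7 11)[::
Node(HubTwo 0 10 7 11)[::leaf(Pass 0 4)];leaf(HubTwo 0 10 7 11)]]];leaf(HubTwo 0 9 6 7)];
Node(HubTwo 0 9 6 8)[::Node(HubTwo 0 9 6 8)[::Node(Dom 0 10 8)[::Node(HubTwo 0 10 8 7)[::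
leaf(HubTwo 0 10 8 7)];Node(HubTwo 0 10 8 11)[::Node(HubTwo 0 10 8 11)[::leaf(Pass 0 4)];
leaf(HubTwo 0 10 8 11)]]];leaf(HubTwo 0 9 6 8)];Node(Dom 0 9 6)[::Node(HubTwo 0 9 6 7)[::
Node(HubTwo 0 9 6 7)[::Node(Dom 0 11 7)[::Node(HubTwo 0 11 7 8)[::leaf(HubTwo 0 11 7 8)];
Node(HubTwo 0 11 7 10)[::Node(Pass 0 4)[::leaf(HubTwo 0 11 7 10)];leaf(HubTwo 0 11 7 10)];
Node(HubTwo 0 11 7 12)[::Node(HubTwo 0 11 7 12)[::leaf(Pass 0 4)];leaf(HubTwo 0 11 7 12)]]];
leaf(HubTwo 0 9 6 7)];Node(HubTwo 0 9 6 8)[::Node(HubTwo 0 9 6 8)[::Node(Dom 0 11 8)[::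
Node(HubTwo 0 11 8 7)[::leaf(HubTwo 0 11 8 7)];Node(HubTwo 0 11 8 10)[::Node(Pass 0 4)[::
leaf(HubTwo 0 11 8 10)];leaf(HubTwo 0 11 8 10)];Node(HubTwo 0 11 8 12)[::Node(HubTwo 0 11 8 12)[::
leaf(Pass 0 4)];leaf(HubTwo 0 11 8 12)]]];leaf(HubTwo 0 9 6 8)];Node(HubTwo 0 9 6 10)[::
Node(HubTwo 0 9 6 10)[::Node(HubTwo 0 9 6 11)[::Node(HubTwo 0 5 3 7)[::Node(Dom 0 4 3)[::
leaf(Hit 0 8);leaf(Hit 0 12)];Node(HubTwo 0 5 3 7)[::Node(Dom 0 1 11)[::Node(Dom 0 1 10)[::
Node(Hit 2 8)[::leaf(Hit 11 13)]];Node(Hit 2 13)[::Node(Dom 0 4 3)[::leaf(Hit 7 8);leaf(Hit 7 14)];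
Node(HubTwo 0 5 3 8)[::leaf(Hit 0 13)]]]];leaf(HubTwo 0 5 3 7)];Node(Dom 0 4 3)[::leaf(Hit 0 7);leaf(Hit 0 8);
leaf(Hit 0 12)];leaf(HubTwo 0 9 6 11)];Node(HubTwo 0 9 6 11)[::Node(HubTwo 0 9 6 11)[::
Node(Dom 0 1 11)[::Node(Hit 0 7)[::Node(Hit 3 7)[::Node(Pass 0 12)[::leaf(Pass 0 4)]]];
Node(Hit 0 8)[::Node(Hit 3 8)[::Node(Pass 0 12)[::leaf(Pass 0 4)]]];Node(Hit 0 13)[::
Node(Pass 0 4)[::Node(Pass 0 13)[::Node(Dom 0 4 3)[::leaf(Hit 0 7);leaf(Hit 0 8);leaf(Hit 0 15)]]];
Node(Dom 0 4 13)[::leaf(Hit 1 7);leaf(Hit 1 8);leaf(Hit 1 14)]]];Node(Dom 0 1 11)[::Node(Hit 0 7)[::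
Node(Pass 0 12)[::Node(Pass 0 4)[::Node(Dom 0 12 7)[::leaf(Hit 6 8);leaf(Hit 6 13)]]]];Node(Hit 0 8)[::
Node(Pass 0 12)[::Node(Pass 0 4)[::Node(Dom 0 12 8)[::leaf(Hit 6 7);leaf(Hit 6 13)]]]];Node(Hit 0 13)[::
Node(Hit 0 7)[::Node(Dom 0 4 3)[::Node(Hit 0 8)[::Node(Dom 0 1 11)[::Node(Pass 6 14)[::
leaf(Pass 0 13)]]];Node(Hit 0 14)[::Node(Dom 0 4 3)[::Node(Hit 8 15)[::Node(Pass 16 8)[::leaf(Pass 16 7)
]]]]];Node(Dom 0 1 11)[::leaf(Hit 0 8);Node(Pass 6 14)[::leaf(Pass 0 13)]]];Node(HubTwo 0 5 3 8)[::
Node(HubTwo 0 1 11 13)[::Node(Dom 0 4 13)[::leaf(Hit 1 7);leaf(Hit 1 14)];Node(Hit 0 7)[::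
Node(Dom 0 4 3)[::leaf(Hit 5 14)]]];Node(Hit 0 13)[::Node(Hit 5 12)[::leaf(HubTwo 0 12 13 8)]];
leaf(HubTwo 0 5 3 8)]]]];Node(HubTwo 0 9 6 11)[::Node(Dom 0 4 3)[::Node(HubTwo 0 5 3 7)[::
Node(Hit 1 10)[::leaf(Hit 5 11)];leaf(HubTwo 0 5 3 7)];Node(HubTwo 0 5 3 8)[::Node(Hit 1 10)[::
leaf(Hit 5 11)];leaf(HubTwo 0 5 3 8)];Node(Hit 1 13)[::Node(Dom 0 4 3)[::Node(Hit 5 14)[::
Node(Dom 0 4 3)[::leaf(Hit 9 15)]]]]]];leaf(HubTwo 0 9 6 11)]];Node(HubTwo 0 9 6 10)[::
Node(HubTwo 0 9 6 11)[::Node(HubTwo 0 9 6 11)[::Node(Dom 0 4 3)[::leaf(Hit 0 7);leaf(Hit 0 8);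
leaf(Hit 0 13)];Node(Dom 0 4 3)[::Node(HubTwo 0 5 3 7)[::Node(Hit 1 11)[::leaf(Hit 5 10)];
leaf(HubTwo 0 5 3 7)];Node(HubTwo 0 5 3 8)[::Node(Hit 1 11)[::leaf(Hit 5 10)];leaf(HubTwo 0 5 3 8)];
Node(Hit 0 13)[::Node(Dom 0 4 3)[::Node(Hit 4 14)[::Node(Dom 0 4 3)[::leaf(Hit 8 15)]]]]]];
Node(HubTwo 0 9 6 11)[::Node(Dom 0 4 11)[::Node(HubTwo 0 4 11 7)[::leaf(HubTwo 0 4 11 7)];
Node(HubTwo 0 4 11 8)[::leaf(HubTwo 0 4 11 8)];Node(Dom 0 4 11)[::Node(HubTwo 0 4 11 7)[::
leaf(HubTwo 0 4 11 7)];Node(HubTwo 0 4 11 8)[::leaf(HubTwo 0 4 11 8)];Node(HubTwo 0 4 11 13)[::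
Node(Hit 0 14)[::Node(Dom 0 1 14)[::leaf(Hit 0 7);leaf(Hit 0 8);Node(HubTwo 0 1 14 15)[::
leaf(HubTwo 0 1 14 15)]];Node(HubTwo 0 4 11 14)[::leaf(HubTwo 0 4 11 14)]];Node(HubTwo 0 4 11 13)[::
Node(HubTwo 0 4 11 14)[::Node(HubTwo 0 4 11 14)[::Node(Hit 0 7)[::Node(Dom 0 4 6)[::leaf(Hit 0 8);
Node(HubTwo 0 4 6 15)[::leaf(HubTwo 0 4 6 15)]];Node(Hit 18 7)[::Node(Hit 0 8)[::Node(Dom 0 5 14)[::
leaf(Hit 0 15)]]]]];leaf(HubTwo 0 4 11 14)]];leaf(HubTwo 0 4 11 13)]]]];leaf(HubTwo 0 9 6 11)]];
leaf(HubTwo 0 9 6 10)]]]];Node(HubTwo 0 5 3 6)[::Node(Dom 0 10 6)[::Node(HubTwo 0 10 6 7)[::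
Node(HubTwo 0 10 6 7)[::Node(Dom 0 9 7)[::Node(HubTwo 0 9 7 8)[::leaf(HubTwo 0 9 7 8)];
Node(HubTwo 0 9 7 11)[::Node(HubTwo 0 9 7 11)[::leaf(Pass 0 4)];leaf(HubTwo 0 9 7 11)]]];
leaf(HubTwo 0 10 6 7)];Node(HubTwo 0 10 6 8)[::Node(HubTwo 0 10 6 8)[::Node(Dom 0 9 8)[::
Node(HubTwo 0 9 8 7)[::leaf(HubTwo 0 9 8 7)];Node(HubTwo 0 9 8 11)[::Node(HubTwo 0 9 8 11)[::
leaf(Pass 0 4)];leaf(HubTwo 0 9 8 11)]]];leaf(HubTwo 0 10 6 8)];Node(Dom 0 10 6)[::Node(HubTwo 0 10 6 7)[::
Node(HubTwo 0 10 6 7)[::Node(Dom 0 9 7)[::Node(HubTwo 0 9 7 8)[::leaf(HubTwo 0 9 7 8)];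
Node(HubTwo 0 9 7 11)[::Node(Pass 0 4)[::leaf(HubTwo 0 9 7 11)];leaf(HubTwo 0 9 7 11)];
Node(HubTwo 0 9 7 12)[::Node(HubTwo 0 9 7 12)[::leaf(Pass 0 4)];leaf(HubTwo 0 9 7 12)]]];
leaf(HubTwo 0 10 6 7)];Node(HubTwo 0 10 6 8)[::Node(HubTwo 0 10 6 8)[::Node(Dom 0 9 8)[::
Node(HubTwo 0 9 8 7)[::leaf(HubTwo 0 9 8 7)];Node(HubTwo 0 9 8 11)[::Node(Pass 0 4)[::
leaf(HubTwo 0 9 8 11)];leaf(HubTwo 0 9 8 11)];Node(HubTwo 0 9 8 12)[::Node(HubTwo 0 9 8 12)[::
leaf(Pass 0 4)];leaf(HubTwo 0 9 8 12)]]];leaf(HubTwo 0 10 6 8)];Node(HubTwo 0 10 6 11)[::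
Node(HubTwo 0 10 6 11)[::Node(HubTwo 0 10 6 12)[::Node(HubTwo 0 5 3 7)[::Node(Pass 0 4)[::
Node(Dom 0 4 3)[::Node(Hit 0 8)[::Node(Pass 0 8)[::Node(HubTwo 0 5 3 7)[::leaf(Pass 4 13);
leaf(Pass 4 13)]]];Node(Hit 0 13)[::Node(Dom 0 4 3)[::Node(Hit 3 14)[::Node(Dom 0 4 3)[::leaf(Hit 6 15)]
]]]]];Node(HubTwo 0 5 3 7)[::Node(Dom 0 1 12)[::Node(Dom 0 1 11)[::Node(Hit 0 8)[::leaf(Hit 11 13)]];
Node(Hit 0 13)[::Node(Dom 0 4 3)[::leaf(Hit 5 8);leaf(Hit 5 14)];Node(HubTwo 0 5 3 8)[::leaf(Hit 0 13)]]]];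
leaf(HubTwo 0 5 3 7)];Node(HubTwo 0 10 6 12)[::Node(Pass 1 4)[::Node(HubTwo 0 5 3 8)[::
Node(HubTwo 0 5 3 7)[::leaf(HubTwo 0 5 3 7)];leaf(HubTwo 0 5 3 8)];Node(Dom 0 4 12)[::leaf(Hit 1 7);
leaf(Hit 1 8);Node(Hit 1 13)[::Node(HubTwo 0 4 12 13)[::Node(Hit 7 7)[::leaf(Pass 0 9);leaf(Pass 15 9)];
Node(Dom 0 9 6)[::leaf(Hit 1 7);leaf(Hit 1 8);Node(Hit 1 14)[::Node(HubTwo 0 9 6 14)[::leaf(Pass 0 1)]]]]]]
]];leaf(HubTwo 0 10 6 12)];Node(HubTwo 0 10 6 12)[::Node(HubTwo 0 10 6 12)[::Node(Dom 0 1 12)[::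
Node(Hit 0 7)[::Node(Hit 3 7)[::Node(Pass 0 9)[::leaf(Pass 0 4)]]];Node(Hit 0 8)[::Node(Hit 3 8)[::
Node(Pass 0 9)[::leaf(Pass 0 4)]]];Node(Hit 0 13)[::Node(Pass 0 13)[::Node(Hit 0 7)[::
Node(Pass 0 4)[::Node(Hit 0 8)[::leaf(Pass 3 14);leaf(HubTwo 0 5 3 7)];Node(Dom 0 9 6)[::
leaf(HubTwo 0 9 6 8);Node(HubTwo 0 9 6 15)[::leaf(HubTwo 0 9 6 15)]]];Node(Dom 0 4 3)[::Node(Hit 0 8)[::
leaf(Pass 15 14)];Node(Hit 0 15)[::leaf(Pass 15 14)]]]];Node(Hit 3 13)[::Node(Pass 0 9)[::
Node(Pass 0 4)[::Node(HubTwo 0 5 3 7)[::leaf(HubTwo 0 5 3 7)]]]]]];Node(Dom 0 1 12)[::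
Node(Hit 0 7)[::Node(Dom 0 9 7)[::leaf(Hit 0 8);leaf(Hit 0 13)]];Node(Hit 0 8)[::Node(Dom 0 9 8)[::
leaf(Hit 0 7);leaf(Hit 0 13)]];Node(Hit 0 13)[::Node(Pass 0 13)[::Node(Dom 0 9 6)[::leaf(Hit 0 7);
leaf(Hit 0 8);Node(Hit 2 15)[::Node(Hit 8 15)[::Node(HubTwo 0 9 6 15)[::Node(Pass 0 4)[::
leaf(HubTwo 0 5 3 7)]]]]]];Node(Pass 0 9)[::Node(Dom 0 9 13)[::leaf(Hit 0 7);leaf(Hit 0 8);
Node(Hit 0 14)[::Node(Pass 0 4)[::leaf(HubTwo 0 5 3 7)]]]]]]];Node(HubTwo 0 10 6 12)[::
Node(Dom 0 9 6)[::leaf(Hit 0 7);leaf(Hit 0 8);Node(Hit 0 13)[::Node(HubTwo 0 9 6 13)[::Node(Pass 2 4)[::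
Node(Hit 0 7)[::Node(Pass 0 8)[::leaf(Pass 0 7)]]];Node(Pass 5 1)[::Node(Hit 4 4)[::leaf(Pass 15 9)]]]]]
];leaf(HubTwo 0 10 6 12)]];Node(HubTwo 0 10 6 11)[::Node(HubTwo 0 10 6 12)[::
Node(HubTwo 0 10 6 12)[::Node(Pass 0 4)[::Node(HubTwo 0 5 3 8)[::Node(HubTwo 0 5 3 7)[::
leaf(HubTwo 0 5 3 7)];leaf(HubTwo 0 5 3 8)];Node(Dom 0 4 12)[::leaf(Hit 0 7);leaf(Hit 0 8);Node(Hit 0 13)[::
Node(Pass 3 9)[::Node(Dom 0 1 13)[::leaf(HubTwo 0 1 13 7);leaf(HubTwo 0 1 13 8);
Node(HubTwo 0 1 13 14)[::leaf(Hit 1 7)]]]]]];Node(Dom 0 9 6)[::leaf(Hit 1 7);leaf(Hit 1 8);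
Node(Hit 1 13)[::Node(HubTwo 0 9 6 13)[::Node(Pass 1 4)[::Node(Hit 0 7)[::Node(Pass 0 8)[::
leaf(Pass 0 7)]]];Node(Pass 0 1)[::Node(Hit 8 4)[::leaf(Pass 15 9)]]]]]];Node(HubTwo 0 10 6 12)[::
Node(Dom 0 4 12)[::Node(HubTwo 0 4 12 7)[::leaf(HubTwo 0 4 12 7)];Node(HubTwo 0 4 12 8)[::
leaf(HubTwo 0 4 12 8)];Node(Dom 0 4 12)[::Node(HubTwo 0 4 12 7)[::leaf(HubTwo 0 4 12 7)];
Node(HubTwo 0 4 12 8)[::leaf(HubTwo 0 4 12 8)];Node(HubTwo 0 4 12 13)[::Node(Hit 1 14)[::
Node(HubTwo 0 4 12 13)[::Node(HubTwo 0 4 12 14)[::Node(Pass 0 9)[::Node(Pass 0 4)[::leaf(Hit 13 7)]]]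
];Node(HubTwo 0 4 12 14)[::leaf(HubTwo 0 4 12 14)]];Node(HubTwo 0 4 12 13)[::Node(Pass 1 9)[::
Node(HubTwo 0 5 3 7)[::leaf(HubTwo 0 5 3 7)]]];leaf(HubTwo 0 4 12 13)]]]];leaf(HubTwo 0 10 6 12)]];
leaf(HubTwo 0 10 6 11)]]]]]]]].

(** A square 0 1 2 3 in the in-neighbourhood of 4, a vertex 5 with arcs to 1, 2, 3, and a square 6 7
    8 9 in the in-neighbourhood of 5 with arcs from 0 to 8 and 9. The root places the sink outside
    the two squares. *)
Definition cert_tf4 : tree :=
Node(Sink 0)[::leaf(All4 0 1 2 3 10);leaf(All4 0 1 2 3 10);leaf(All4 0 1 2 3 10);leaf(All4 0 1 2 3 10);
leaf(Hit 0 10);leaf(Hit 0 10);leaf(Hit 0 10);Node(Hit 0 10)[::Node(Pass 0 10)[::Node(Dom4 0 9 6 10)[::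
Node(Hit 0 12)[::Node(MissTwo 0 9 6 10 12)[::leaf(MissPath 10 0 4 12 3);leaf(MissTwo 0 9 6 10 12)]];
Node(Hit 0 12)[::Node(MissTwo 9 6 10 0 12)[::Node(MissTwo 9 6 10 0 12)[::Node(Pass 0 9)[::
Node(MissTwo 1 4 9 5 8)[::leaf(Pass 0 0)];Node(Dom4 0 9 6 10)[::Node(Hit 1 16)[::
Node(MissTwo 0 9 6 10 16)[::leaf(MissPath 10 0 4 16 3);leaf(MissTwo 0 9 6 10 16);leaf(MissTwo 0 9 6 10 16)]
];Node(Hit 1 16)[::Node(Dom4 0 9 6 10)[::Node(Hit 6 17)[::leaf(MissTwo 8 9 6 10 17)];
Node(Pass 6 17)[::Node(Pass 0 12)[::leaf(Pass 0 16)];Node(Pass 0 16)[::leaf(Pass 0 12)]];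
Node(Pass 6 17)[::Node(Pass 8 12)[::leaf(Pass 8 16)];Node(Pass 0 16)[::leaf(Pass 0 12)]];
leaf(MissPath 10 0 9 6 17)]];Node(Hit 1 16)[::Node(MissTwo 6 10 0 9 16)[::
Node(MissTwo 6 10 0 9 16)[::Node(MissPath 6 10 0 9 16)[::leaf(Pass 0 7);leaf(All4 7 17 11 10 6)]];
leaf(MissTwo 6 10 0 9 16)]];leaf(MissPath 10 0 9 6 16)]]]]];Node(Hit 0 12)[::Node(Pass 0 12)[::
Node(Dom4 2 3 12 10)[::leaf(Pass 0 13);Node(Hit 3 13)[::leaf(MissPath 6 10 0 9 12)];
Node(MissTwo 11 10 2 3 13)[::Node(Hit 3 13)[::leaf(MissPath 6 10 0 9 12);
Node(MissTwo 13 10 0 9 12)[::leaf(MissTwo 12 10 2 3 13)]]];Node(MissPath 10 2 3 12 13)[::leaf(Hit 1 6)]]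
;Node(Dom4 0 9 5 3)[::leaf(All4 0 8 5 3 7);Node(Pass 0 11)[::Node(MissPath 6 10 0 9 12)[::
leaf(All4 7 14 11 10 6)]];Node(Hit 1 14)[::Node(MissTwo 0 9 5 3 14)[::Node(MissPath 0 9 5 3 14)[::
leaf(Hit 4 12)];Node(MissPath 0 9 5 3 14)[::leaf(Hit 2 12)]]];Node(Hit 1 14)[::
Node(MissPath 6 10 0 9 12)[::leaf(All4 7 14 11 10 6)]];Node(Hit 1 14)[::Node(Hit 0 12)[::
Node(Pass 5 7)[::leaf(Hit 0 14)]]];leaf(Hit 1 14)]]];leaf(MissPath 10 0 9 6 12)]]];leaf(Hit 0 10);
Node(Hit 0 10)[::Node(MissTwo 3 0 1 2 10)[::Node(MissTwo 3 0 1 2 10)[::Node(Dom4 0 9 5 3)[::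
leaf(All4 0 8 5 3 7);Node(Hit 2 13)[::Node(MissTwo 0 9 5 3 13)[::Node(MissTwo 0 9 5 3 13)[::
leaf(MissPath 0 9 5 3 13)];leaf(MissTwo 0 9 5 3 13)]];Node(MissTwo 8 5 3 0 13)[::
Node(MissTwo 8 5 3 0 13)[::Node(Hit 6 13)[::Node(Hit 3 6)[::Node(Hit 4 11)[::leaf(Hit 0 7)];
Node(MissTwo 9 5 3 0 13)[::leaf(Hit 12 6)]];Node(Hit 1 7)[::Node(Hit 4 7)[::Node(Hit 4 11)[::
leaf(Hit 19 15)]]]]]];Node(Hit 3 13)[::Node(MissTwo 5 3 0 9 13)[::Node(MissTwo 5 3 0 9 13)[::
leaf(Hit 0 7)];leaf(Hit 0 7)]];Node(Hit 2 13)[::Node(Dom4 0 9 5 3)[::Node(Hit 6 14)[::Node(Pass 4 13)[::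
Node(Pass 0 14)[::leaf(MissTwo 0 9 5 3 14)]]];leaf(MissTwo 8 5 3 0 14);leaf(MissTwo 5 3 0 9 14);
Node(Pass 6 14)[::leaf(Pass 0 13)]]]]]]];leaf(Hit 0 10);leaf(Hit 0 10);leaf(Hit 0 10);Node(Hit 0 10)[::
Node(MissTwo 5 3 0 8 10)[::leaf(Hit 0 6)]];leaf(Hit 0 10);Node(Hit 0 10)[::Node(MissTwo 5 3 0 9 10)[::
leaf(Hit 0 7)]];Node(Hit 0 10)[::Node(MissTwo 9 6 7 8 10)[::Node(MissTwo 9 6 7 8 10)[::
Node(Dom4 0 9 5 3)[::Node(Hit 0 13)[::Node(Pass 0 13)[::Node(Dom4 3 10 8 13)[::Node(Hit 2 15)[::
leaf(MissTwo 0 9 5 3 13)];Node(MissTwo 10 8 13 3 15)[::leaf(Hit 0 10);Node(MissPath 10 8 13 3 15)[::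
leaf(MissTwo 0 8 13 3 15)];leaf(MissTwo 10 8 13 3 15)];Node(Hit 2 15)[::leaf(MissTwo 0 9 5 3 13)];
Node(Hit 3 15)[::leaf(MissTwo 0 9 5 3 13)]]]];Node(Hit 0 13)[::Node(Hit 5 13)[::Node(Pass 10 10)[::
Node(MissTwo 8 5 3 0 13)[::Node(Hit 1 11)[::Node(Hit 4 12)[::Node(Pass 0 6)[::Node(Hit 22 13)[::
leaf(Hit 1 11)]]]]]]]];Node(Hit 0 13)[::Node(MissTwo 5 3 0 9 13)[::Node(Hit 0 7)[::leaf(Hit 0 13)]]];
leaf(Hit 0 13)]]]];Node(Hit 0 10)[::Node(MissTwo 8 9 6 7 10)[::Node(MissTwo 8 9 6 7 10)[::
Node(Dom4 7 8 12 10)[::leaf(Hit 0 3);Node(MissTwo 0 8 12 10 13)[::leaf(Hit 0 3);leaf(MissTwo 0 8 12 10 13)]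
;Node(Hit 1 13)[::Node(Pass 2 3)[::Node(Pass 0 0)[::leaf(All4 0 9 6 7 10);leaf(All4 0 9 6 7 10)];
Node(MissTwo 8 12 10 7 13)[::Node(MissTwo 8 12 10 7 13)[::Node(Hit 0 6)[::leaf(Pass 3 8);
Node(Pass 0 11)[::leaf(Hit 4 8)]]];leaf(All4 0 4 13 10 3);Node(Dom4 7 8 12 10)[::Node(Pass 7 15)[::
Node(Pass 12 13)[::leaf(All4 0 4 13 10 3)]];Node(Pass 7 15)[::Node(Pass 1 13)[::leaf(All4 0 4 13 10 3)]]
;Node(Pass 7 15)[::Node(Pass 7 13)[::leaf(All4 0 4 13 10 3)]];leaf(MissPath 10 7 8 12 15)];
leaf(MissTwo 8 12 10 7 13);leaf(MissTwo 8 12 10 7 13)]]];Node(Hit 1 13)[::Node(Pass 0 13)[::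
leaf(All4 0 4 13 10 3);Node(Dom4 3 13 8 5)[::Node(Hit 0 15)[::leaf(Hit 0 3)];Node(Hit 0 15)[::
Node(Pass 0 15)[::Node(MissTwo 0 8 5 3 15)[::leaf(MissTwo 0 8 5 3 15);leaf(MissTwo 0 8 5 3 15);
leaf(MissTwo 0 8 5 3 15);leaf(MissTwo 0 8 5 3 15)]]];Node(Hit 0 15)[::Node(Hit 7 15)[::
Node(MissTwo 7 5 3 13 15)[::leaf(Hit 0 11)]]];leaf(Hit 0 15)]]];Node(MissPath 10 7 8 12 13)[::
leaf(All4 1 13 7 5 6);leaf(All4 1 13 7 5 6)]]]]];Node(Hit 0 10)[::Node(Pass 0 10)[::
Node(Dom4 3 10 9 5)[::Node(MissTwo 3 10 9 5 12)[::Node(Hit 0 3)[::leaf(MissTwo 10 8 5 3 7)];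
Node(Hit 1 12)[::Node(MissTwo 3 10 9 5 12)[::Node(MissPath 3 10 9 5 12)[::leaf(All4 0 13 11 10 3)]]];
leaf(MissTwo 3 10 9 5 12)];leaf(MissPath 10 9 5 3 12);Node(Hit 0 12)[::Node(MissTwo 8 5 3 10 12)[::
Node(Pass 0 7)[::leaf(Pass 1 0)]]];Node(Hit 0 12)[::Node(Pass 1 12)[::Node(Hit 1 7)[::
Node(MissTwo 5 3 10 9 12)[::Node(Hit 1 7)[::leaf(MissTwo 7 8 9 6 10)];Node(Hit 1 7)[::
leaf(MissTwo 7 8 9 6 10)]];Node(MissTwo 7 8 9 6 10)[::leaf(MissTwo 10 8 5 3 7);leaf(Hit 1 12);leaf(Hit 1 12)]]
];Node(MissTwo 5 3 10 9 12)[::leaf(Hit 1 7)]]]]];Node(Hit 0 10)[::Node(Pass 0 10)[::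
Node(Dom4 3 10 9 5)[::leaf(Hit 0 12);Node(MissPath 10 9 5 3 12)[::Node(MissPath 0 9 5 3 12)[::
Node(Hit 0 6)[::leaf(MissTwo 6 7 8 9 10)]]];Node(Hit 0 12)[::Node(MissTwo 7 5 3 10 12)[::
Node(Hit 0 6)[::leaf(Pass 1 7)]]];Node(Hit 0 12)[::Node(MissTwo 6 7 8 9 10)[::leaf(MissTwo 10 7 5 3 6);
leaf(Hit 1 12);Node(Hit 1 12)[::Node(MissTwo 6 7 8 9 10)[::Node(Hit 1 12)[::leaf(Hit 15 13)]]]]]]]];
leaf(Hit 0 10);leaf(Hit 0 10);leaf(Hit 0 10);Node(Hit 0 10)[::Node(MissTwo 5 3 0 8 10)[::leaf(Hit 0 6)]];
leaf(Hit 0 10);Node(Hit 0 10)[::Node(MissTwo 5 3 0 9 10)[::leaf(Hit 0 7)]];leaf(Hit 0 10);leaf(Hit 0 10);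
leaf(Hit 0 10);leaf(Hit 0 10);Node(Hit 0 10)[::Node(Pass 0 10)[::Node(Dom4 0 1 2 10)[::Node(Hit 0 12)[::
Node(MissTwo 0 1 2 10 12)[::Node(MissTwo 5 3 0 8 10)[::leaf(Pass 0 6);leaf(Pass 0 6);leaf(Pass 0 6)]]];
leaf(Hit 0 12);leaf(Hit 0 12);leaf(MissPath 10 0 1 2 12)]]];Node(Hit 0 10)[::Node(Pass 0 10)[::
Node(Dom4 2 10 7 5)[::leaf(Hit 0 12);Node(MissPath 10 7 5 2 12)[::leaf(Hit 4 10);leaf(MissTwo 5 3 0 9 10)];
Node(MissTwo 5 3 0 9 10)[::leaf(Hit 0 12);leaf(Hit 0 12)];Node(Hit 0 12)[::Node(MissTwo 8 9 6 7 10)[::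
leaf(Hit 0 12);leaf(Hit 1 12);Node(Hit 1 12)[::Node(Hit 6 11)[::Node(MissTwo 8 9 6 7 10)[::
Node(Hit 1 12)[::leaf(MissTwo 5 3 0 9 10)]]]]]]]]];Node(Hit 0 10)[::Node(Pass 0 10)[::
Node(MissTwo 5 3 0 9 10)[::Node(Hit 0 7)[::Node(Pass 0 7)[::Node(MissTwo 6 7 8 9 0)[::
leaf(All4 0 9 6 3 10);leaf(Hit 2 10)]]];Node(Hit 0 7)[::Node(Pass 0 7)[::Node(MissTwo 6 7 8 9 0)[::
leaf(All4 0 9 6 3 10);leaf(Hit 2 10)]]]]]];Node(Hit 0 10)[::Node(MissTwo 5 3 0 9 10)[::Node(Hit 1 6)[::
leaf(Pass 0 7)]]];leaf(All4 6 7 8 9 10);Node(Hit 0 10)[::Node(Pass 0 10)[::Node(Dom4 0 9 10 3)[::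
Node(Hit 0 12)[::Node(MissTwo 0 9 10 3 12)[::Node(MissTwo 0 1 2 3 10)[::
Node(MissPath 0 9 10 3 12)[::Node(Hit 1 7)[::leaf(Hit 0 12)];leaf(Pass 14 6)]]]];leaf(Hit 0 12);
Node(MissPath 10 3 0 9 12)[::Node(MissTwo 5 3 0 9 12)[::leaf(Hit 0 7)]];leaf(Hit 0 12)]]];leaf(Hit 0 10);
Node(Hit 0 10)[::Node(MissTwo 0 1 2 3 10)[::Node(MissPath 0 1 2 3 10)[::leaf(MissTwo 10 1 4 8 0);
leaf(MissTwo 10 1 4 11 0)]]];Node(MissTwo 0 1 2 3 10)[::leaf(MissTwo 10 8 9 6 0);leaf(MissTwo 0 1 2 3 10)];
leaf(Hit 0 10);Node(MissTwo 0 1 2 3 10)[::leaf(MissTwo 0 1 2 3 10);leaf(MissTwo 0 1 2 3 10)];leaf(Pass 0 10);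
leaf(Pass 0 10);leaf(Pass 0 10);leaf(Pass 0 10);leaf(Hit 0 10);leaf(Hit 0 10);leaf(Hit 0 10);leaf(Hit 0 10);
leaf(All4 6 7 8 9 10);Node(Hit 0 10)[::Node(Pass 0 10)[::Node(Dom4 0 1 10 3)[::Node(Hit 0 12)[::
Node(Pass 0 0)[::Node(MissTwo 0 1 10 3 12)[::Node(Dom4 0 9 12 3)[::leaf(Hit 5 15);Node(Hit 3 15)[::
Node(Hit 4 15)[::Node(Hit 4 7)[::leaf(Hit 1 15)]]];leaf(Hit 0 15);leaf(Hit 0 15)]]]];leaf(Hit 0 12);
leaf(MissPath 10 3 0 1 12);leaf(Hit 0 12)]]];Node(Hit 0 10)[::Node(Pass 0 10)[::Node(Pass 0 1)[::
leaf(MissTwo 10 9 5 1 8);Node(Dom4 0 1 10 3)[::Node(MissPath 0 1 10 3 13)[::leaf(All4 1 4 8 12 0)];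
leaf(Hit 0 13);Node(MissPath 10 3 0 1 13)[::Node(MissTwo 2 3 0 1 13)[::leaf(MissTwo 8 9 6 7 10)]];
leaf(Hit 0 13)]]]];Node(Hit 0 10)[::Node(Pass 0 10)[::Node(Dom4 1 10 9 5)[::
Node(MissTwo 1 10 9 5 12)[::Node(MissTwo 1 10 9 5 12)[::leaf(MissPath 1 10 9 5 12)];
leaf(MissTwo 1 10 9 5 12)];leaf(MissPath 10 9 5 1 12);Node(MissTwo 8 5 1 10 12)[::
Node(MissTwo 8 5 1 10 12)[::Node(Hit 0 7)[::Node(Hit 6 12)[::Node(Pass 3 7)[::leaf(Hit 5 0)]];
Node(Hit 14 12)[::leaf(Hit 5 0)]]]];Node(MissTwo 5 1 10 9 12)[::Node(Hit 0 7)[::Node(Hit 2 12)[::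
leaf(Hit 6 0)];leaf(Pass 4 12)]]]]];Node(Hit 0 10)[::Node(Pass 0 10)[::Node(Dom4 1 10 9 5)[::
Node(Hit 0 12)[::leaf(Pass 0 12)];leaf(MissPath 10 9 5 1 12);Node(MissTwo 7 5 1 10 12)[::
Node(MissTwo 8 5 1 10 12)[::leaf(Pass 0 7)];Node(Pass 0 7)[::leaf(Hit 0 12)]];leaf(Pass 0 12)]]];
leaf(All4 6 7 8 9 10);leaf(All4 6 7 8 9 10)].

(** The same with a 5-cycle 6 7 8 9 10, which is supplied as an extra cycle because of its length.
    The five out-neighbours of 0 are then all named, and 4 has an arc to 8. *)
Definition cert_tf5 : tree :=
Node(Sink 0)[::leaf(Pass 0 1);leaf(All4 0 1 2 3 11);leaf(All4 0 1 2 3 11);leaf(All4 0 1 2 3 11);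
leaf(All4 0 1 2 3 11);leaf(All4 0 1 2 3 11);leaf(Hit 0 11);leaf(Hit 0 11);leaf(Hit 0 11);leaf(Hit 0 11);
Node(Hit 0 11)[::Node(Pass 0 0)[::leaf(MissTwo 3 0 1 2 11)]];Node(Pass 0 11)[::Node(Pass 2 0)[::
leaf(MissTwo 3 0 1 2 11)]];leaf(Hit 0 11);Node(MissTwo 3 0 1 2 11)[::Node(MissTwo 3 0 1 2 11)[::
Node(Dom4 0 10 5 3)[::Node(MissPath 0 10 5 3 14)[::leaf(Hit 0 11)];leaf(Hit 0 14);Node(Hit 0 14)[::
leaf(Hit 0 11)];leaf(Hit 4 14)]]];Node(Hit 0 11)[::Node(MissTwo 3 0 1 2 11)[::leaf(Pass 5 0)]];
Node(Hit 0 11)[::Node(MissTwo 3 0 1 2 11)[::leaf(Pass 5 0)]];leaf(Hit 0 11);leaf(Hit 0 11);leaf(Hit 0 11);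
leaf(Hit 0 11);Node(MissTwo 5 3 0 8 11)[::leaf(Hit 0 6)];Node(MissTwo 5 3 0 9 11)[::leaf(Hit 1 6)];
leaf(Hit 0 11);Node(MissTwo 5 3 0 9 11)[::leaf(Hit 0 7)];Node(MissTwo 5 3 0 10 11)[::leaf(Hit 1 6)];
Node(MissTwo 5 3 0 10 11)[::leaf(Hit 1 6)];Node(Hit 0 11)[::Node(MissTwo 5 1 4 8 0)[::leaf(Pass 1 6)]];
Node(Hit 0 11)[::Node(MissTwo 5 1 4 8 0)[::leaf(Pass 1 6)]];Node(Hit 0 11)[::Node(Dom4 3 11 7 5)[::
Node(MissTwo 5 1 4 8 0)[::leaf(Hit 0 12)];Node(MissTwo 5 1 4 8 0)[::leaf(Hit 1 12)];
Node(MissTwo 5 1 4 8 0)[::leaf(Hit 0 12)];Node(Pass 0 11)[::Node(Hit 0 12)[::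
Node(MissTwo 5 3 11 7 12)[::Node(Hit 0 6)[::Node(Hit 1 8)[::leaf(Hit 3 9)]]];Node(Pass 0 0)[::
leaf(All4 0 10 6 7 11)]]]]];Node(Hit 0 11)[::Node(MissTwo 5 1 4 8 0)[::leaf(Hit 1 7)]];Node(Hit 0 11)[::
Node(MissTwo 5 1 4 8 0)[::leaf(Hit 1 7)]];Node(Hit 0 11)[::Node(MissTwo 5 1 4 8 0)[::leaf(Hit 1 7)]];
Node(MissTwo 5 1 4 8 0)[::Node(Hit 0 11)[::leaf(Hit 1 6);Node(Pass 2 0)[::Node(MissTwo 12 0 8 5 7)[::
leaf(Hit 0 6)]]]];Node(Hit 0 11)[::Node(MissTwo 5 1 4 8 0)[::leaf(Hit 1 6)]];Node(Hit 0 11)[::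
Node(MissTwo 5 1 4 8 0)[::leaf(Hit 1 6)]];Node(MissTwo 5 1 4 8 0)[::Node(Hit 0 11)[::leaf(Hit 1 6);
Node(Pass 3 0)[::leaf(All4 0 8 5 3 7);Node(Pass 0 7)[::Node(Dom4 0 10 6 7)[::
Node(MissPath 11 10 6 7 14)[::leaf(All4 1 4 8 9 0);leaf(All4 1 4 8 9 0)];leaf(Hit 0 14);leaf(Hit 0 14);
leaf(Hit 0 14)]]]]];leaf(Hit 0 11);leaf(Hit 0 11);leaf(Hit 0 11);leaf(Hit 0 11);Node(MissTwo 5 3 0 8 11)[::
leaf(Hit 0 6)];Node(MissTwo 5 3 0 9 11)[::leaf(Hit 1 6)];leaf(Hit 0 11);Node(MissTwo 5 3 0 9 11)[::
leaf(Hit 0 7)];Node(MissTwo 5 3 0 10 11)[::leaf(Hit 1 6)];Node(MissTwo 5 3 0 10 11)[::leaf(Hit 1 6)];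
leaf(Hit 0 11);leaf(Hit 0 11);leaf(Hit 0 11);leaf(Hit 0 11);leaf(Hit 0 11);leaf(Hit 0 11);Node(Hit 0 11)[::
Node(Pass 0 11)[::Node(Pass 2 0)[::Node(MissTwo 3 0 8 5 7)[::Node(Pass 2 0)[::Node(Hit 2 13)[::
leaf(MissTwo 7 0 4 13 3);Node(Hit 7 14)[::leaf(All4 0 8 5 14 7)];leaf(Hit 0 11)]]]]]];leaf(Hit 0 11);
leaf(Hit 0 11);Node(Hit 0 11)[::Node(Pass 0 11)[::Node(Pass 3 0)[::Node(Pass 0 7)[::
Node(Dom4 0 10 6 7)[::leaf(MissPath 11 10 6 7 14);leaf(Hit 0 14);leaf(Hit 0 14);leaf(Hit 0 14)]]]]];
Node(Hit 0 11)[::Node(MissTwo 5 3 0 8 11)[::leaf(Pass 0 6)]];Node(Hit 0 11)[::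
Node(MissTwo 5 3 0 9 11)[::Node(Pass 1 6)[::leaf(Hit 1 11)]]];Node(Hit 0 11)[::Node(Pass 0 11)[::
Node(Pass 1 2)[::Node(Dom4 0 1 2 11)[::Node(MissPath 0 1 2 11 14)[::Node(Hit 6 7)[::
Node(Hit 0 14)[::leaf(MissTwo 11 10 5 14 9)]]];leaf(Hit 1 14);leaf(Hit 1 14);Node(MissPath 11 0 1 2 14)[::
leaf(Hit 10 11)]];leaf(All4 1 4 8 9 0);leaf(MissTwo 11 10 5 2 9)]]];Node(Hit 0 11)[::
Node(MissTwo 5 3 0 9 11)[::leaf(Hit 0 7)]];Node(Hit 0 11)[::Node(MissTwo 5 3 0 10 11)[::leaf(Hit 0 7)]];
Node(Hit 0 11)[::Node(MissTwo 5 3 0 10 11)[::leaf(Hit 0 7)]];Node(MissTwo 5 1 4 8 0)[::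
Node(Hit 0 11)[::Node(MissTwo 5 3 0 9 11)[::leaf(Hit 1 6);leaf(Hit 1 6)];Node(Dom4 0 10 6 11)[::
leaf(Hit 1 13);leaf(Hit 0 13);leaf(Hit 0 13);leaf(Hit 2 13)]]];Node(Hit 0 11)[::Node(MissTwo 5 3 0 10 11)[::
leaf(Hit 1 6)]];Node(Hit 0 11)[::Node(MissTwo 5 3 0 10 11)[::leaf(Hit 1 6)]];Node(MissTwo 5 1 4 8 0)[::
Node(Hit 0 11)[::Node(MissTwo 5 3 0 10 11)[::leaf(Hit 1 6);leaf(Hit 1 6)];Node(Pass 0 6)[::
leaf(All4 4 8 9 10 0);Node(Pass 0 7)[::leaf(Hit 0 6);Node(MissTwo 5 3 0 10 11)[::leaf(Hit 0 7);leaf(Hit 0 7)]]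
]]];Node(MissTwo 5 1 4 8 0)[::Node(Hit 0 11)[::Node(Dom4 2 11 9 5)[::leaf(Hit 0 13);
leaf(MissPath 11 9 5 2 13);leaf(Hit 0 13);Node(Hit 0 13)[::Node(Pass 0 0)[::leaf(Hit 0 11)]]];
Node(Dom4 3 11 9 5)[::leaf(Hit 0 13);leaf(MissPath 0 9 5 3 13);Node(Hit 0 13)[::Node(Pass 2 0)[::
leaf(Hit 0 11)]];Node(Hit 0 13)[::Node(Pass 0 0)[::leaf(Hit 0 11)];Node(Pass 0 11)[::Node(Pass 1 6)[::
leaf(All4 6 7 8 9 11)];Node(Pass 0 13)[::Node(Pass 3 6)[::leaf(All4 6 7 8 9 11)];
Node(MissTwo 5 3 11 9 13)[::Node(Hit 0 7)[::Node(Hit 0 6)[::Node(Hit 3 12)[::Node(Pass 2 6)[::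
leaf(All4 6 7 8 9 11)]]]];Node(Hit 0 7)[::Node(Hit 0 6)[::Node(Pass 3 7)[::Node(Dom4 2 13 9 5)[::
leaf(Hit 0 17);leaf(Hit 0 17);leaf(Hit 0 17);Node(MissPath 5 2 13 9 17)[::leaf(All4 1 2 3 12 5);
leaf(All4 1 2 15 12 5)]]]]];Node(Hit 0 7)[::Node(Hit 0 6)[::Node(Pass 3 7)[::Node(Dom4 2 13 9 5)[::
leaf(Hit 0 18);leaf(Hit 0 18);leaf(Hit 0 18);Node(Hit 0 18)[::Node(MissTwo 5 2 13 9 18)[::Node(Hit 0 7)[::
Node(Hit 5 12)[::leaf(Pass 2 3)]];Node(Hit 0 7)[::Node(Hit 0 6)[::Node(MissPath 5 2 13 6 18)[::
Node(MissPath 5 1 4 8 0)[::leaf(All4 1 2 3 12 5)];Node(Hit 6 16)[::leaf(Hit 3 11)]]]]];Node(Hit 0 7)[::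
leaf(Hit 5 18)]]]]]]]]]]]]];Node(MissTwo 5 1 4 8 0)[::Node(Hit 0 11)[::Node(Dom4 2 11 8 5)[::
leaf(Hit 0 13);leaf(Hit 0 13);leaf(Hit 0 13);Node(Hit 0 13)[::Node(Pass 0 0)[::leaf(All4 0 10 6 7 11)]]];
Node(Dom4 3 11 10 5)[::Node(Hit 0 13)[::Node(Pass 3 0)[::leaf(All4 0 10 6 7 11)]];
Node(MissPath 11 10 5 3 13)[::leaf(Hit 7 11)];Node(Hit 0 13)[::Node(Pass 3 0)[::leaf(All4 0 10 6 7 11)]]
;Node(Pass 0 11)[::Node(Pass 4 3)[::Node(Pass 4 6)[::Node(Pass 4 7)[::Node(Dom4 3 11 10 5)[::
leaf(Hit 0 16);leaf(Hit 0 16);leaf(Hit 0 16);Node(Hit 0 16)[::Node(Pass 0 0)[::leaf(All4 0 10 6 7 11)];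
Node(MissTwo 5 3 11 10 16)[::Node(Hit 0 7)[::Node(Hit 0 6)[::Node(Dom4 5 17 16 6)[::
Node(MissPath 5 17 16 6 18)[::leaf(All4 1 2 3 12 5)];leaf(Hit 0 18);leaf(Hit 0 18);leaf(Hit 0 18)]]]]]]]];
Node(Hit 0 13)[::Node(Pass 0 0)[::leaf(All4 0 10 6 7 11)]]];Node(Pass 0 1)[::leaf(All4 1 4 8 9 0);
Node(Hit 0 13)[::Node(Hit 5 9)[::Node(Hit 0 7)[::leaf(Hit 1 13);leaf(Pass 5 9)]];Node(Pass 3 0)[::
leaf(All4 0 10 6 7 11)]];Node(Hit 0 13)[::leaf(Hit 13 0);Node(MissTwo 5 3 11 10 13)[::Node(Hit 0 7)[::
Node(Hit 0 6)[::leaf(Hit 10 9)]];Node(Hit 0 7)[::Node(Hit 0 6)[::leaf(Hit 10 9)]]];Node(Pass 3 0)[::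
leaf(All4 0 10 6 7 11)]];leaf(All4 0 10 6 7 11);Node(Hit 0 13)[::leaf(Hit 11 7);
Node(MissTwo 5 3 11 10 13)[::Node(Hit 0 7)[::Node(Hit 0 6)[::leaf(Hit 9 9)]];Node(Hit 0 7)[::
Node(Hit 0 6)[::leaf(Hit 9 9)]]];Node(Pass 3 0)[::leaf(All4 0 10 6 7 11)]]]]]]];
Node(MissTwo 5 1 4 8 0)[::Node(Hit 0 11)[::Node(Pass 1 0)[::leaf(All4 0 10 6 7 11);
leaf(All4 0 10 6 7 11);leaf(All4 0 10 6 7 11);leaf(All4 0 10 6 7 11)];Node(Dom4 3 11 10 5)[::
Node(Hit 0 13)[::Node(Pass 0 13)[::Node(Dom4 0 8 13 11)[::leaf(Hit 3 15);leaf(Hit 3 15);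
Node(Hit 3 15)[::leaf(Hit 0 6)];Node(Hit 3 15)[::Node(MissTwo 11 0 8 13 15)[::leaf(Hit 20 11)]]]]];
Node(MissPath 11 10 5 3 13)[::leaf(All4 6 7 9 10 11)];Node(Hit 0 13)[::Node(Hit 5 7)[::leaf(Pass 2 0)]];
Node(Hit 0 12)[::Node(Hit 0 6)[::Node(Hit 1 7)[::Node(Hit 3 11)[::Node(Pass 3 6)[::
Node(Pass 3 7)[::Node(Dom4 2 4 8 5)[::leaf(Hit 0 16);leaf(Hit 1 16);leaf(Hit 0 16);Node(Hit 0 16)[::
Node(MissTwo 5 2 4 8 16)[::Node(MissPath 5 2 4 8 16)[::leaf(All4 1 2 3 17 5);leaf(All4 1 2 12 17 5)]]]]]
]]]];Node(MissTwo 5 3 11 10 13)[::Node(Pass 0 0)[::leaf(All4 0 10 6 7 11)];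
Node(MissTwo 5 3 11 10 13)[::Node(Hit 0 7)[::Node(Hit 0 6)[::Node(Pass 3 6)[::
Node(Dom4 5 14 13 7)[::Node(Pass 3 7)[::Node(MissPath 5 14 13 7 16)[::leaf(All4 1 2 3 12 5);
leaf(All4 1 2 3 12 5)]];leaf(Hit 0 16);leaf(Hit 1 16);leaf(Hit 0 16)]]]]];leaf(MissTwo 5 3 11 10 13)];leaf(Hit 0 11)
;Node(MissPath 0 8 5 12 7)[::leaf(Hit 0 11);leaf(All4 4 8 9 10 0)]]]]];Node(MissTwo 5 1 4 8 0)[::
Node(Dom4 0 10 5 3)[::leaf(All4 0 8 5 3 7);Node(MissPath 0 10 5 3 13)[::Node(Hit 0 11)[::leaf(Hit 3 7)]]
;Node(MissTwo 8 5 3 0 13)[::Node(Hit 0 11)[::leaf(Hit 3 13);Node(Hit 1 7)[::Node(Hit 3 11)[::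
leaf(Hit 14 13)]]]];Node(Hit 0 11)[::Node(Hit 0 7)[::leaf(Pass 2 0)];Node(MissTwo 5 3 0 10 13)[::
Node(Hit 1 11)[::Node(Hit 3 7)[::leaf(Pass 3 7)]];Node(Hit 1 13)[::leaf(Hit 10 7)];
leaf(MissTwo 5 3 0 10 13)]];leaf(MissTwo 12 0 10 5 13)]];Node(MissTwo 5 1 4 8 0)[::Node(Hit 0 11)[::
Node(Hit 0 6)[::Node(Pass 1 7)[::leaf(Pass 3 0)]];Node(Dom4 0 10 5 3)[::Node(MissPath 0 10 5 3 13)[::
Node(Pass 5 7)[::leaf(All4 7 8 9 10 11)]];Node(MissTwo 8 5 3 0 13)[::Node(Hit 0 6)[::leaf(Hit 3 13);
leaf(Hit 3 11)]];Node(Hit 0 13)[::Node(Hit 1 11)[::Node(Hit 2 6)[::Node(Pass 2 7)[::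
leaf(All4 7 8 9 10 11)]]];leaf(Hit 3 11)];Node(Hit 0 13)[::leaf(Hit 3 11)]]]];Node(Hit 0 11)[::
Node(Pass 2 0)[::Node(MissTwo 0 1 2 3 11)[::Node(Pass 0 11)[::Node(Dom4 0 10 11 3)[::
Node(MissPath 0 10 11 3 14)[::Node(Hit 0 7)[::leaf(Hit 1 14)]];leaf(Hit 2 14);leaf(Hit 0 14);leaf(Hit 0 14)]]]
];leaf(MissTwo 0 1 2 3 11)];leaf(MissPath 0 1 2 3 11);leaf(MissPath 0 1 2 3 11);
Node(MissPath 0 1 2 3 11)[::leaf(MissTwo 11 1 4 8 0)];leaf(MissPath 0 1 2 3 11);leaf(MissTwo 0 1 2 3 11);
leaf(MissPath 0 1 2 3 11);leaf(MissTwo 0 1 2 3 11);leaf(MissTwo 0 1 2 3 11);leaf(MissPath 0 1 2 3 11);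
Node(Hit 0 11)[::leaf(MissPath 11 8 9 10 0)];leaf(Hit 0 11);Node(MissTwo 5 1 4 8 0)[::Node(Hit 0 11)[::
Node(Pass 0 11)[::Node(Dom4 7 8 9 11)[::leaf(MissTwo 11 1 4 9 0);Node(Hit 2 14)[::leaf(Hit 1 6)];
Node(Hit 2 14)[::leaf(Hit 1 6)];Node(Hit 2 14)[::leaf(Hit 0 6)];Node(Hit 2 14)[::leaf(Hit 1 6)]]]]];
leaf(Hit 0 11);leaf(Hit 0 11);Node(Hit 0 11)[::leaf(MissTwo 11 1 4 8 0)];Node(Hit 0 11)[::leaf(Hit 2 0)];
leaf(Hit 0 11);leaf(Hit 0 11);Node(Hit 0 11)[::Node(Hit 3 0)[::Node(Pass 0 7)[::Node(Pass 0 11)[::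
Node(Pass 0 0)[::Node(Pass 3 13)[::leaf(All4 5 13 11 8 7);Node(Pass 0 11)[::leaf(MissTwo 3 0 8 5 7)];
leaf(All4 5 13 11 8 7)]]]]]];Node(Hit 0 11)[::Node(MissPath 11 8 9 10 0)[::leaf(All4 0 8 5 3 7)]];
leaf(Hit 0 11);Node(Hit 0 11)[::Node(Pass 0 11)[::Node(Pass 2 0)[::Node(Dom4 0 9 5 3)[::
leaf(All4 0 8 5 3 7);leaf(MissPath 0 9 5 3 14);leaf(Hit 2 14);leaf(Hit 2 14);leaf(Hit 2 14)]]]];leaf(Hit 0 11);
leaf(Hit 0 11);Node(Hit 0 11)[::leaf(MissTwo 11 1 4 8 0)];Node(Hit 0 11)[::leaf(Hit 2 0)];leaf(Hit 0 11);
leaf(Hit 0 11);Node(Hit 0 11)[::Node(Hit 3 0)[::Node(Pass 0 7)[::Node(Pass 0 11)[::Node(Pass 0 0)[::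
Node(Pass 3 13)[::leaf(All4 5 13 11 8 7);Node(Pass 0 11)[::leaf(MissTwo 3 0 8 5 7)];leaf(All4 5 13 11 8 7)]
]]]]];Node(Hit 0 11)[::Node(MissTwo 5 1 4 8 0)[::leaf(Pass 1 6)]];Node(Hit 0 11)[::Node(Pass 0 9)[::
leaf(Hit 0 11);leaf(Hit 2 11);leaf(Hit 2 11);Node(Pass 0 11)[::Node(Dom4 3 11 8 5)[::leaf(Hit 0 14);
leaf(MissPath 0 8 5 3 14);Node(Hit 0 14)[::Node(MissTwo 10 5 3 11 14)[::leaf(Hit 3 0)]];
Node(Hit 0 14)[::Node(MissTwo 5 3 11 8 14)[::Node(Hit 0 6)[::Node(Hit 1 9)[::leaf(Hit 0 7)]]]]]]]];
Node(Hit 0 11)[::Node(MissTwo 5 1 4 8 0)[::Node(Pass 3 9)[::Node(Dom4 0 10 5 3)[::leaf(Hit 0 14);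
leaf(Hit 0 14);Node(Hit 3 14)[::Node(Hit 1 11)[::Node(Pass 16 6)[::Node(Pass 16 7)[::
Node(Dom4 0 8 5 12)[::leaf(Hit 12 17);leaf(Hit 12 17);Node(Hit 2 17)[::Node(Hit 1 11)[::
Node(Dom4 0 1 2 17)[::leaf(Hit 2 18);leaf(Hit 2 18);leaf(Hit 2 18);leaf(Hit 2 18)]];Node(Hit 2 12)[::
leaf(Hit 1 17)]];leaf(Hit 12 17)]]]]];leaf(Hit 0 14)]]]];Node(Hit 0 11)[::Node(MissTwo 5 1 4 8 0)[::
leaf(Hit 1 7)]];Node(Hit 0 11)[::Node(MissTwo 5 1 4 8 0)[::leaf(Hit 1 6)]];Node(MissTwo 5 1 4 8 0)[::
Node(Hit 0 11)[::Node(Pass 0 11)[::Node(Pass 1 1)[::leaf(All4 1 4 8 9 0);leaf(MissPath 11 6 5 1 10)]];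
Node(MissPath 11 8 9 10 0)[::leaf(All4 0 8 5 3 7)]]];Node(Hit 0 11)[::Node(Pass 1 1)[::leaf(Hit 1 0)]];
Node(MissTwo 5 1 4 8 0)[::Node(Hit 0 11)[::Node(Pass 1 1)[::leaf(All4 1 4 8 9 0)];Node(Pass 0 11)[::
Node(Pass 3 0)[::Node(Dom4 0 9 11 3)[::leaf(MissPath 0 9 11 3 14);leaf(Hit 0 14);leaf(Hit 3 14);leaf(Hit 0 14)
];Node(Hit 0 12)[::leaf(Hit 0 6);Node(MissPath 0 8 5 12 7)[::leaf(Hit 2 0);leaf(All4 4 8 9 10 0)]]]]]];
Node(Hit 0 11)[::Node(Hit 0 7)[::Node(Pass 2 1)[::leaf(Hit 1 0)]]];Node(Hit 0 11)[::Node(Hit 0 7)[::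
Node(Pass 2 1)[::leaf(All4 1 4 8 9 0)]]];Node(MissTwo 5 1 4 8 0)[::Node(Hit 0 11)[::Node(Hit 0 7)[::
leaf(Pass 2 1)];Node(Hit 5 7)[::Node(Pass 0 11)[::Node(Dom4 0 8 5 3)[::leaf(Hit 7 14);leaf(Hit 7 14);
Node(Hit 9 14)[::leaf(Hit 10 11)];leaf(Hit 7 14)]]]]];Node(MissTwo 5 1 4 8 0)[::Node(Hit 0 11)[::
Node(Hit 0 6)[::Node(Pass 2 1)[::leaf(Hit 1 0)]];leaf(Hit 2 0)]];Node(Hit 0 11)[::Node(Pass 1 1)[::
leaf(All4 1 4 8 9 0);leaf(Hit 2 0)]];Node(Hit 0 11)[::Node(Hit 0 6)[::leaf(Pass 2 1)]];
Node(MissTwo 5 1 4 8 0)[::Node(Hit 0 11)[::Node(Hit 0 6)[::Node(Hit 1 7)[::leaf(Pass 3 1)]];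
Node(Hit 3 0)[::Node(Pass 0 7)[::Node(Dom4 0 10 6 7)[::leaf(MissPath 11 10 6 7 14);leaf(Hit 0 14);
leaf(Hit 0 14);leaf(Hit 0 14)]]]]];Node(Hit 0 11)[::Node(Pass 0 1)[::leaf(Hit 1 0)]];Node(Hit 0 11)[::
Node(Pass 0 1)[::leaf(All4 1 4 8 9 0)]];Node(Hit 0 11)[::leaf(Pass 0 1)];Node(Hit 0 11)[::
Node(Pass 0 1)[::leaf(Hit 1 11);Node(Hit 3 0)[::leaf(Hit 1 11)]]];Node(Hit 0 11)[::Node(Pass 0 1)[::
leaf(Hit 2 0)]];Node(MissTwo 5 1 4 8 0)[::Node(Hit 0 11)[::Node(Pass 1 1)[::leaf(Hit 1 0)];
Node(Pass 0 1)[::leaf(All4 1 4 8 9 0);Node(Dom4 2 11 9 5)[::leaf(Hit 0 13);Node(MissPath 11 9 5 2 13)[::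
Node(Hit 4 7)[::leaf(Hit 17 0)]];Node(Hit 0 13)[::leaf(Hit 2 0)];Node(Hit 0 13)[::leaf(Hit 1 0)]];
Node(Pass 0 6)[::leaf(All4 6 7 8 9 11)];leaf(Hit 0 11);Node(Pass 0 6)[::leaf(All4 6 7 8 9 11)]]]];
Node(MissTwo 5 1 4 8 0)[::Node(Hit 0 11)[::Node(Pass 1 1)[::leaf(All4 1 4 8 9 0)];
Node(Dom4 2 11 8 5)[::leaf(Hit 0 13);Node(MissPath 11 8 5 2 13)[::Node(Hit 11 0)[::leaf(Hit 0 11)]];
Node(Hit 0 13)[::Node(MissTwo 10 5 2 11 13)[::leaf(Hit 3 0)]];Node(Hit 0 13)[::Node(Pass 0 1)[::
leaf(All4 1 4 8 9 0);leaf(Hit 2 0);leaf(Hit 3 0);leaf(Hit 0 11);Node(Hit 3 0)[::leaf(Hit 0 11)]]]]]];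
Node(MissTwo 5 1 4 8 0)[::Node(Hit 0 11)[::leaf(Pass 1 1);Node(Pass 0 2)[::Node(Pass 0 1)[::
leaf(All4 1 4 8 9 0);Node(Dom4 2 11 10 5)[::leaf(Hit 1 14);Node(Hit 1 14)[::leaf(Hit 2 0)];leaf(Hit 1 14);
leaf(Hit 1 14)];Node(Dom4 2 11 6 5)[::leaf(Hit 1 14);Node(Hit 1 14)[::leaf(Hit 2 0)];leaf(Hit 1 14);
leaf(Hit 1 14)];leaf(Hit 0 11);Node(Dom4 2 11 7 5)[::leaf(Hit 0 14);leaf(Hit 0 14);leaf(Hit 1 14);leaf(Hit 0 14)]]]]
];Node(MissTwo 5 1 4 8 0)[::Node(Hit 0 11)[::Node(Hit 0 7)[::leaf(Pass 2 1)];Node(Pass 0 11)[::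
leaf(Hit 0 7);Node(Dom4 2 11 10 5)[::Node(Hit 0 14)[::Node(Pass 10 6)[::Node(Hit 4 0)[::leaf(Hit 0 11);
leaf(MissTwo 12 0 10 5 14)]]];Node(MissPath 11 10 5 2 14)[::leaf(All4 6 8 9 10 11)];
Node(MissTwo 8 5 2 11 14)[::Node(Hit 0 7)[::leaf(Hit 13 14)]];Node(Hit 0 14)[::Node(Pass 0 1)[::
leaf(All4 1 4 8 9 0);leaf(Hit 3 0);leaf(Hit 0 11);Node(MissTwo 5 2 11 10 14)[::leaf(Hit 0 7);leaf(Hit 0 7)]];
Node(Pass 10 6)[::Node(Hit 4 0)[::leaf(Hit 0 11);Node(Hit 1 13)[::leaf(Hit 4 0);leaf(Pass 4 0)]]]]]]]];
Node(MissTwo 5 1 4 8 0)[::Node(Hit 0 11)[::Node(Hit 0 6)[::leaf(Pass 2 1)];Node(Pass 0 11)[::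
leaf(Hit 1 6);Node(Dom4 2 11 10 5)[::leaf(Hit 0 14);Node(MissPath 11 10 5 2 14)[::leaf(Hit 1 0)];
Node(MissTwo 7 5 2 11 14)[::Node(Hit 0 6)[::leaf(Hit 23 14)]];Node(Hit 0 14)[::Node(Pass 0 1)[::
leaf(All4 1 4 8 9 0);leaf(Hit 2 0);leaf(Hit 0 11);leaf(Hit 8 6)]]]]]];Node(MissTwo 5 1 4 8 0)[::
Node(Dom4 0 10 5 12)[::leaf(All4 0 8 5 12 7);Node(MissPath 0 10 5 12 13)[::Node(Hit 2 0)[::
Node(Pass 0 7)[::leaf(MissPath 0 10 6 7 11)]];Node(Hit 5 0)[::leaf(MissPath 0 10 6 7 11)];
Node(Hit 0 7)[::Node(Dom4 0 9 5 3)[::leaf(MissPath 0 9 5 3 14);Node(Hit 6 14)[::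
Node(MissTwo 8 5 3 0 14)[::Node(Hit 0 11)[::leaf(Hit 21 11)]]];leaf(Hit 6 14);leaf(Hit 6 14)]]];
Node(MissTwo 8 5 12 0 13)[::Node(MissTwo 8 5 12 0 13)[::Node(Hit 0 13)[::Node(Hit 1 11)[::
Node(Dom4 2 11 8 5)[::leaf(Hit 14 16);Node(Hit 2 16)[::leaf(Pass 32 1)];leaf(Hit 14 16);Node(Hit 0 16)[::
leaf(Pass 42 1)]];Node(Pass 1 11)[::Node(Hit 3 11)[::leaf(Pass 14 1);Node(Dom4 3 11 8 5)[::leaf(Hit 26 16);
leaf(Hit 14 17);leaf(MissPath 0 8 5 3 17);leaf(Hit 14 17);Node(Hit 0 17)[::leaf(Pass 42 1)]]]]];
Node(Hit 0 11)[::leaf(Pass 8 1);Node(Dom4 2 11 8 5)[::leaf(Hit 8 16);Node(Hit 2 16)[::leaf(Hit 0 7)];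
leaf(Hit 8 16);Node(Hit 0 16)[::leaf(Hit 10 7)]];Node(Dom4 3 11 8 5)[::leaf(Hit 8 16);
leaf(MissPath 0 8 5 3 16);leaf(Hit 8 16);Node(Hit 0 16)[::leaf(Hit 10 7)]]]]]];Node(Pass 0 1)[::
leaf(All4 1 4 8 9 0);Node(Hit 0 13)[::Node(Hit 0 7)[::leaf(All4 7 8 9 10 11);Node(Dom4 1 2 13 10)[::
Node(Hit 0 14)[::leaf(Hit 5 11)];Node(Hit 3 14)[::leaf(Hit 5 11)];Node(Hit 0 14)[::Node(Hit 0 7)[::
leaf(Hit 0 14)]];Node(MissPath 0 1 2 13 14)[::leaf(Hit 8 11)]]];Node(MissTwo 5 12 0 10 13)[::
Node(Hit 1 11)[::leaf(Hit 3 13);Node(Dom4 3 11 10 5)[::leaf(Hit 0 15);leaf(Hit 0 15);leaf(Hit 0 15);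
Node(Hit 1 15)[::Node(Hit 3 13)[::Node(MissTwo 5 3 11 10 15)[::Node(Hit 0 7)[::leaf(Hit 0 6)]]]]]]];
leaf(Hit 6 11)];Node(Hit 0 11)[::Node(Hit 4 13)[::Node(Hit 0 6)[::Node(Pass 8 2)[::
Node(Dom4 2 13 6 5)[::leaf(Hit 1 15);Node(Hit 0 15)[::leaf(Hit 1 11)];leaf(Hit 1 15);leaf(Hit 1 15)]]]];
Node(Dom4 3 11 9 5)[::leaf(Hit 0 14);leaf(MissPath 0 9 5 3 14);leaf(Hit 0 14);Node(Hit 0 14)[::leaf(Hit 3 0);
Node(MissTwo 5 3 11 9 14)[::Node(Hit 0 7)[::Node(Hit 0 6)[::Node(Hit 4 10)[::leaf(Hit 0 14)]]];
Node(Hit 0 7)[::Node(Hit 0 6)[::Node(Hit 4 10)[::leaf(Hit 0 14)]]]]]]];leaf(MissPath 0 10 6 7 11);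
Node(Hit 0 11)[::Node(Pass 7 2)[::Node(Dom4 2 11 7 5)[::leaf(Hit 0 15);leaf(Hit 0 15);leaf(Hit 0 15);
leaf(Hit 0 15)]];Node(Dom4 3 11 9 5)[::leaf(Hit 0 14);leaf(MissPath 0 9 5 3 14);leaf(Hit 0 14);
Node(Hit 0 14)[::leaf(Hit 8 7);Node(MissTwo 4 8 5 1 7)[::leaf(Hit 0 14);leaf(All4 7 8 9 10 11);leaf(Hit 0 14);
Node(Hit 3 13)[::leaf(Hit 3 11)]]]]]];Node(Hit 0 13)[::leaf(Hit 6 11)]]]].

Lemma certified_33 : certified Free 7 [:: (0,1);(1,2);(2,0);(3,4);(4,5);(5,3);(6,0);(6,1);(6,2);
  (6,3);(6,4)] [::] cert_33.
Proof. by vm_compute. Qed.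
Lemma certified_hub : certified Hub 6 [:: (0,1);(1,2);(2,0);(3,0);(3,1);(3,2);(4,3);(5,3);(0,4);
  (0,5)] [::] cert_hub.
Proof. by vm_compute. Qed.
Lemma certified_tf4 : certified TriangleFree 10 [:: (0,1);(1,2);(2,3);(3,0);(0,4);(1,4);(2,4);
  (3,4);(5,1);(5,2);(5,3);(6,7);(7,8);(8,9);(9,6);(6,5);(7,5);(8,5);(9,5);(0,8);(0,9)] [::]
  cert_tf4.
Proof. by vm_compute. Qed.
Lemma certified_tf5 : certified TriangleFree 11 [:: (0,1);(1,2);(2,3);(3,0);(0,4);(1,4);(2,4);
  (3,4);(5,1);(5,2);(5,3);(6,7);(7,8);(8,9);(9,10);(10,6);(6,5);(7,5);(8,5);(9,5);(10,5);(0,8);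
  (0,9);(0,10);(4,8)] [:: [:: 6;7;8;9;10]] cert_tf5.
Proof. by vm_compute. Qed.

(** * Digons and disjoint triangles in critical digraphs *)

Section CriticalFacts.
Variables (V : finType) (e : rel V).
Hypothesis cr : critical e.
Implicit Types (Z W : {set V}) (s : seq V).

Lemma compl_no2 Z : cycset e Z -> ~~ two_cycles e (~: Z).
Proof.
move=> cZ; apply: contra (crit_no3 cr) => two.
by apply/existsP; exists Z; rewrite subsetT cZ setTD.
Qed.

Lemma outd_compl Z v : 5 <= outd e (~: Z) v + #|[set w in Z | e v w]|.
Proof.
have <- : outd e setT v = 5 by rewrite -(crit_out cr v); apply: eq_card => w; rewrite !inE.
by have := outdD e setT Z v; rewrite setTD.
Qed.

(** Otherwise deleting [Z] leaves outdegrees at least 2, with at most two vertices below 3, and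
    [two_cycles_outd] supplies two more cycles. *)
Lemma heavy_compl Z : cycset e Z -> Z != setT ->
  (forall v, v \notin Z -> #|[set w in Z | e v w]| <= 3) ->
  3 <= #|[set v | (v \notin Z) && (3 <= #|[set w in Z | e v w]|)]|.
Proof.
move=> cZ ZT h; rewrite leqNgt; apply/negP => lt; have /negP := compl_no2 cZ; apply.
apply: two_cycles_outd => [|v _|v|].
- by apply: contraNneq ZT => Z0; rewrite -[Z]setCK Z0 setC0.
- exact: crit_irr cr v.
- by rewrite inE => /h; have := outd_compl Z v; lia.
- apply: leq_trans (_ : _ <= 2); last exact: lt.
  apply/subset_leq_card/subsetP => v; rewrite !inE => /andP[-> /=].
  by have := outd_compl Z v; lia.
Qed.

Lemma card_V5 : 5 < #|V|.
Proof.
have [v _] := card_gt0P (crit_vertex cr); rewrite -(crit_out cr v) -cardsT.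
apply: proper_card; rewrite properEneq subsetT andbT; apply/eqP => /setP/(_ v).
by rewrite !inE (negbTE (crit_irr cr v)).
Qed.

Lemma card_count s v : uniq s -> #|[set w in [set x in s] | e v w]| = count (e v) s.
Proof.
by move=> us; rewrite -size_filter -(card_uniqP (filter_uniq (e v) us)); apply: eq_card => w;
  rewrite inE mem_filter inE andbC.
Qed.

Lemma heavy_cycle s : uniq s -> s != [::] -> cycle e s -> size s < #|V| ->
  (forall v, v \notin s -> count (e v) s <= 3) ->
  3 <= #|[set v | (v \notin s) && (3 <= count (e v) s)]|.
Proof.
move=> us s0 es sV h; apply: leq_trans (heavy_compl (cycle_cycset s0 es) _ _) _.
- by apply: contraTneq sV => sT; rewrite -leqNgt -cardsT -sT cardsE card_size.
- by move=> v; rewrite in_set card_count //; apply: h.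
- by apply/subset_leq_card/subsetP => v; rewrite !inE card_count.
Qed.

(** No vertex can send three arcs to the two vertices of a digon, against [heavy_cycle]. *)
Lemma crit_asym u v : e u v -> ~~ e v u.
Proof.
move=> uv; apply/negP => vu.
have un : uniq [:: u; v] by rewrite /= inE andbT; apply: contraTneq uv => ->; exact: crit_irr cr v.
have := heavy_cycle un isT _ (leq_trans _ card_V5) _; rewrite /= uv vu => /(_ isT isT) h.
suff : 3 <= 0 by []; apply: leq_trans (h _) _; first by move=> w _; case: (e w u); case: (e w v).
rewrite leqn0 cards_eq0; apply/eqP/setP => w; rewrite !inE.
by case: (e w u); case: (e w v); rewrite ?andbF.
Qed.

(** Hence neither two triangles nor a vertex with five of its neighbours can exhaust the digraph,
    and something remains when they are deleted. *)
Lemma card_V6 : 6 < #|V|.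
Proof.
have [v _] := card_gt0P (crit_vertex cr); have [u uv] := crit_in cr v.
have : [set u; v] :|: [set w | e v w] \subset setT by apply: subsetT.
move/subset_leq_card; rewrite cardsT cardsU (crit_out cr) cards2.
rewrite (_ : _ :&: _ = set0) ?cards0; last first.
  apply/setP => w; rewrite !inE; apply/negP => /andP[/orP[/eqP->|/eqP->] vu].
    by have := crit_asym uv; rewrite vu.
  by have := crit_irr cr v; rewrite vu.
case: eqP => [uE|_]; last by lia.
by move: uv; rewrite uE (negbTE (crit_irr cr v)).
Qed.

Lemma ne1 u v : e u v -> u != v.
Proof. by apply: contraTneq => ->; apply: crit_irr cr v. Qed.

Lemma ne1' u v : e v u -> u != v.
Proof. by rewrite eq_sym; apply: ne1. Qed.

Lemma ne2 u v w : e u w -> e w v -> u != v.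
Proof. by move=> uw; apply: contraTneq => <-; apply: crit_asym. Qed.

Lemma ne2' u v w : e v w -> e w u -> u != v.
Proof. by move=> vw wu; rewrite eq_sym; apply: ne2 wu. Qed.

Lemma triangle_rot a b c : triangle e a b c = triangle e b c a.
Proof. by rewrite /triangle andbC andbA. Qed.

Lemma triangle_uniq a b c : triangle e a b c -> uniq [:: a; b; c].
Proof. by case/and3P=> ab bc ca; rewrite /= !inE negb_or (ne1 ab) (ne1 bc) (ne1' ca). Qed.

Lemma triangle_cycset a b c : triangle e a b c -> cycset e [set x in [:: a; b; c]].
Proof. by case/and3P=> ab bc ca; apply: cycle_cycset; rewrite //= ab bc ca. Qed.

Lemma dominate_triangle a b c : triangle e a b c ->
  3 <= #|[set w | [&& e w a, e w b & e w c]]|.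
Proof.
move=> tr; have un := triangle_uniq tr; apply: leq_trans (heavy_cycle un _ _ _ _) _ => //.
- by case/and3P: tr => ab bc ca; rewrite /= ab bc ca.
- exact: leq_trans card_V6.
- by move=> v _; apply: count_size.
- apply/subset_leq_card/subsetP => v; rewrite !inE => /andP[_] /=.
  by case: (e v a); case: (e v b); case: (e v c).
Qed.

Lemma certified_nth md n l extra t h s : certified md n l extra t -> mode_ok e md h ->
  uniq (h :: s) -> size (h :: s) = n -> ~~ holds e (nth h (h :: s)) n l.
Proof.
move=> ct mo us sn; apply: (certified_sound cr crit_asym mo) ct _ _ _ => //.
- exact: dominate_triangle.
- by rewrite -sn.
- by move=> i j; rewrite -sn => ilt jlt /eqP; rewrite nth_uniq // => /eqP.
Qed.

Lemma triangle_last a b c y : triangle e a b c -> y \in [:: a; b; c] ->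
  exists p q, triangle e p q y /\ [:: p; q; y] =i [:: a; b; c].
Proof.
move=> tr; rewrite !inE => /or3P[] /eqP->; [exists b, c|exists c, a|exists a, b]; split=> //.
- by rewrite -triangle_rot.
- by move=> w; rewrite !inE; case: (w == a); case: (w == b); case: (w == c).
- by rewrite triangle_rot.
- by move=> w; rewrite !inE; case: (w == a); case: (w == b); case: (w == c).
Qed.

Lemma disjoint_triangles_sink a b c a' b' c' (s : V) : triangle e a b c -> triangle e a' b' c' ->
  ~~ has [in [:: a; b; c]] [:: a'; b'; c'] -> s \notin [:: a; b; c; a'; b'; c'] ->
  all (e s) [:: a; b; c; a'; b'] -> False.
Proof.
move=> tr tr' dis sn sall.
have un : uniq [:: a; b; c; a'; b'; c'; s].
  rewrite -[_ :: _]/(rcons ([:: a; b; c] ++ [:: a'; b'; c']) s) rcons_uniq sn cat_uniq.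
  by rewrite dis !triangle_uniq.
have := certified_nth certified_33 I un erefl.
case/and3P: tr tr' sall => ab bc ca /and3P[ab' bc' ca'] /and5P[sa sb sc sa' /andP[sb' _]].
by rewrite /holds /= ab bc ca ab' bc' ca' sa sb sc sa' sb'.
Qed.

(** A sink outside two disjoint triangles sends its five arcs to all but one of their six vertices;
    rotation puts the missed vertex last, as in [cert_33]. *)
Lemma triangles_meet a b c a' b' c' : triangle e a b c -> triangle e a' b' c' ->
  has [in [:: a; b; c]] [:: a'; b'; c'].
Proof.
move=> tr tr'; apply/negPn/negP => dis.
have un : uniq ([:: a; b; c] ++ [:: a'; b'; c']) by rewrite cat_uniq dis !triangle_uniq.
set T := [set x in [:: a; b; c]]; set T' := [set x in [:: a'; b'; c']].
have TT' : T :|: T' = [set x in [:: a; b; c] ++ [:: a'; b'; c']].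
  by apply/setP => x; rewrite !inE -!orbA.
have [||s] := pair_sink cr (triangle_cycset tr) (triangle_cycset tr').
- rewrite disjoint_sym disjoints_subset; apply/subsetP => x xT; rewrite in_setC.
  by apply: contra dis => xT'; apply/hasP; exists x; move: xT xT'; rewrite !inE.
- by apply: contraTneq card_V6 => TT; rewrite -leqNgt -cardsT -TT TT' cardsE; apply: card_size.
rewrite -/T -/T' TT' in_set => sn sout.
have c5 : count (e s) ([:: a; b; c] ++ [:: a'; b'; c']) = 5.
  rewrite -card_count // -(crit_out cr s); apply: eq_card => w; rewrite !inE.
  apply: andb_idl => sw; have /(subsetP sout) : w \in [set w | e s w] by rewrite inE.
  by rewrite !inE.
have /allPn[y yL ny] : ~~ all (e s) ([:: a; b; c] ++ [:: a'; b'; c']) by rewrite all_count c5.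
have sall z : z \in [:: a; b; c] ++ [:: a'; b'; c'] -> z != y -> e s z.
  move=> zL zy; apply: contraT => nz.
  have c1 : 5 + count (predC (e s)) ([:: a; b; c] ++ [:: a'; b'; c']) = 6 by rewrite -{1}c5 count_predC.
  have : 2 <= count (predC (e s)) ([:: a; b; c] ++ [:: a'; b'; c']).
    rewrite -size_filter -[2]/(size [:: y; z]); apply: uniq_leq_size; first by rewrite /= inE eq_sym zy.
    by move=> w; rewrite !inE => /orP[/eqP->|/eqP->]; rewrite mem_filter /= ?ny ?nz.
  by rewrite -(leq_add2l 5) c1.
have key p q r x z : triangle e p q r -> triangle e x z y -> ~~ has [in [:: p; q; r]] [:: x; z; y] ->
    [:: p; q; r] ++ [:: x; z; y] =i [:: a; b; c] ++ [:: a'; b'; c'] -> False.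
  move=> pqr xzy dis1 E; have E' w : w \in [:: p; q; r; x; z; y] = (w \in [:: a; b; c] ++ [:: a';
    b'; c']) := E w.
  apply: (disjoint_triangles_sink (s := s) pqr xzy) => //; first by rewrite E'.
  have py w : w \in [:: p; q; r] -> w != y.
    by move=> wp; apply: contraNneq dis1 => <-; apply/hasP; exists w; rewrite // !inE eqxx !orbT.
  have [_ zy yx] := and3P xzy.
  by rewrite /= !sall -?E' ?inE ?eqxx ?orbT // ?(ne1 zy) ?(ne1' yx) // py // !inE eqxx ?orbT.
move: yL; rewrite mem_cat => /orP[/(triangle_last tr)[p [q [trpq pqE]]]|/(triangle_last tr')[p [q
  [trpq pqE]]]].
- apply: (key _ _ _ _ _ tr' trpq) => [|w]; last by rewrite !mem_cat pqE orbC.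
  by rewrite (eq_has_r pqE) // has_sym.
- apply: (key _ _ _ _ _ tr trpq) => [|w]; last by rewrite !mem_cat pqE.
  by rewrite (eq_has_r pqE) // has_sym.
Qed.

End CriticalFacts.

(** * Induced cycles without digons *)

Section MinimalCycles.
Variables (V : finType) (e : rel V).
Hypothesis asym : forall u v, e u v -> ~~ e v u.
Variable C : {set V}.
Hypothesis mC : minset (cycset e) C.

Let ne u v : e u v -> u != v.
Proof. by move=> uv; apply: contraTneq (uv) => <-; apply/negP => uu; have := asym uu; rewrite uu. Qed.

Lemma min_cycset_next v : v \in C -> exists2 w, w \in C & e v w.
Proof. by case/cycsetP: (minsetp mC) => _; apply. Qed.

Lemma min_cycset_cycle s : s != [::] -> cycle e s -> {subset s <= C} -> #|C| <= size s.
Proof.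
move=> s0 es sC; have cs := cycle_cycset s0 es.
have <- : [set x in s] = C.
  by case/minsetP: mC => _; apply => //; apply/subsetP => x; rewrite inE; apply: sC.
by rewrite cardsE card_size.
Qed.

Lemma triangle_min_cycset a b c : a \in C -> b \in C -> c \in C -> triangle e a b c -> #|C| <= 3.
Proof.
move=> aC bC cC /and3P[ab bc ca]; apply: (@min_cycset_cycle [:: a; b; c]); rewrite //= ?ab ?bc ?ca //.
by move=> x; rewrite !inE => /or3P[]/eqP->.
Qed.

Lemma min_cycset_triangle : #|C| <= 3 ->
  exists a b c, [/\ a \in C, b \in C, c \in C & triangle e a b c].
Proof.
move=> C3; have [/set0Pn[a aC] _] := cycsetP _ _ (minsetp mC).
have [b bC ab] := min_cycset_next aC; have [c cC bc] := min_cycset_next bC.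
have ac : a != c by apply: contraTneq bc => <-; apply: asym.
have [d dC cd] := min_cycset_next cC.
have CE : [set x in [:: a; b; c]] = C.
  apply/eqP; rewrite eqEcard; apply/andP; split.
    by apply/subsetP => x; rewrite !inE => /or3P[]/eqP->.
  apply: leq_trans C3 _; rewrite cardsE (card_uniqP _) //.
  by rewrite /= !inE negb_or (ne ab) (ne bc) ac.
exists a, b, c; split=> //; rewrite /triangle ab bc.
move: dC cd; rewrite -CE !inE => /or3P[]/eqP-> // cd; first by have := asym bc; rewrite cd.
by have := asym cd; rewrite cd.
Qed.

(** Vertices satisfying [Q] are pairwise adjacent, and on an induced cycle with at least four
    vertices there are at most two such vertices. *)
Lemma two_consecutive (Q : pred V) : 3 < #|C| ->
  (forall i j, i \in C -> j \in C -> i != j -> ~~ e i j -> ~~ e j i -> ~ (Q i /\ Q j)) ->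
  exists a b, [/\ a \in C, b \in C, e a b & forall q, q \in C -> q != a -> q != b -> ~~ Q q].
Proof.
move=> C4 far.
case: (boolP [exists a in C, exists b in C, [&& e a b, Q a & Q b]]) => [|noab].
  case/exists_inP=> a aC /exists_inP[b bC /and3P[ab Qa Qb]]; exists a, b; split=> // q qC qa qb.
  apply/negP => Qq.
  have adj i : i \in C -> Q i -> q != i -> e i q || e q i.
    move=> iC Qi qi; apply: contraT; rewrite negb_or => /andP[iq qi'].
    by case: (far i q iC qC); rewrite // eq_sym.
  have only i j k : i \in C -> j \in C -> k \in C -> e i j -> e i k -> j = k.
    by move=> iC jC kC ij ik; rewrite (min_cycset_succ mC iC jC ij) -(min_cycset_succ mC iC kC ik).
  have only' i j k : i \in C -> j \in C -> k \in C -> e j i -> e k i -> j = k.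
    move=> iC jC kC ji ki; have [p [_ _ h]] := min_cycset_pred mC iC.
    by rewrite (h j) // -(h k).
  have qa' : e q a.
    by case/orP: (adj a aC Qa qa) => // aq; rewrite (only a q b) ?eqxx in qb.
  have bq : e b q.
    by case/orP: (adj b bC Qb qb) => // qb'; rewrite (only' b q a) ?eqxx in qa.
  by have := triangle_min_cycset aC bC qC; rewrite /triangle ab bq qa' leqNgt C4 => /(_ isT).
case: (boolP [exists a in C, Q a]) => [/exists_inP[a aC Qa]|noa].
  have [b bC ab] := min_cycset_next aC; exists a, b; split=> // q qC qa qb; apply/negP => Qq.
  have no i j : i \in C -> j \in C -> Q i -> Q j -> ~~ e i j.
    move=> iC jC Qi Qj; apply: contra noab => ij.
    by apply/exists_inP; exists i => //; apply/exists_inP; exists j; rewrite // ij Qi.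
  by case: (far a q); rewrite ?no // eq_sym.
have [/set0Pn[a aC] _] := cycsetP _ _ (minsetp mC); have [b bC ab] := min_cycset_next aC.
by exists a, b; split=> // q qC _ _; apply: contra noa => Qq; apply/exists_inP; exists q.
Qed.

End MinimalCycles.

(** * Excluding triangles *)

Section TriangleCase.
Variables (V : finType) (e : rel V).
Hypothesis cr : critical e.
Let asym := crit_asym cr.

Definition dominates x (s : seq V) := all (e x) s.

Lemma min_in_cycset x : exists2 C : {set V}, minset (cycset e) C & {in C, forall c, e c x}.
Proof.
have [A Ax /minimal_cycset[C CA mC]] := in_guard cr x; exists C => // c.
by move/(subsetP (subset_trans CA Ax)); rewrite inE.
Qed.

(** A cycle in the in-neighbourhood of [q] has to meet [Z], in [t] say; [g] follows [t] in it. *)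
Lemma unguarded_in Z q : ~~ guarded e (~: Z) q ->
  exists2 t, t \in Z & e t q /\ exists2 g, e t g & e g q.
Proof.
move=> ng; have [A Aq cA] := in_guard cr q.
have /subsetPn[t tA] : ~~ (A \subset ~: Z).
  by apply: contra ng => AZ; apply/existsP; exists A; rewrite AZ Aq.
have Aq' w : w \in A -> e w q by move/(subsetP Aq); rewrite inE.
rewrite inE negbK => tZ; exists t => //; split; first exact: Aq'.
by have [_ /(_ t tA)[g gA tg]] := cycsetP _ _ cA; exists g; rewrite ?Aq'.
Qed.

(** An induced cycle in the in-neighbourhood of [x] avoids the triangle, so it is not a triangle
    itself. At most two of its at least four vertices are guarded, and any other one receives an arc
    from the triangle. *)
Lemma triangle_unguarded a b c x : triangle e a b c -> dominates x [:: a; b; c] ->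
  exists q1 q2, [/\ q1 != q2, e q1 x, e q2 x, has (e^~ q1) [:: a; b; c] & has (e^~ q2) [:: a; b; c]].
Proof.
move=> tr /allP dx; set Z := [set y in [:: a; b; c]]; have cZ := triangle_cycset tr.
have [C mC Cx] := min_in_cycset x.
have CZ : C \subset ~: Z.
  by apply/subsetP => y yC; rewrite !in_set; apply/negP => /dx xy; have := asym xy; rewrite Cx.
have xZ : x \in ~: Z by rewrite !in_set; apply/negP => /dx; rewrite (negbTE (crit_irr cr x)).
have C4 : 3 < #|C|.
  rewrite ltnNge; apply/negP => /(min_cycset_triangle asym mC)[p [q [r [pC qC rC pqr]]]].
  have /hasP[y yp yT] := triangles_meet cr tr pqr; have yC : y \in C.
    by move: yp; rewrite !inE => /or3P[]/eqP->.
  by move/(subsetP CZ): yC; rewrite !in_set yT.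
have out2 v : 2 <= outd e (~: Z) v.
  have := outd_compl cr Z v; have : #|[set w in Z | e v w]| <= 3.
    by rewrite (card_count e v (triangle_uniq cr tr)) (count_size (e v) [:: a; b; c]).
  by lia.
have [|p [p' [pC pC' pp' ung]]] := @two_consecutive _ e C mC (guarded e (~: Z)) C4 _.
- move=> i j iC jC ij eij eji; apply: (guarded_consecutive asym (compl_no2 cr cZ) CZ mC xZ Cx) => //.
  + by move=> v _; apply: leq_trans (out2 v).
  + by move=> v _ o1; have := out2 v; rewrite o1.
have : 1 < #|C :\ p :\ p'|.
  by move: C4; rewrite (cardsD1 p) (cardsD1 p' (C :\ p)); clear; case: (p \in C); case: (p' \in _) => /=; lia.
case/card_gt1P=> q1 [q2 [q1C q2C q12]]; exists q1, q2; move: q1C q2C.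
rewrite !inE => /and3P[n1 n1' q1C] /and3P[n2 n2' q2C]; split; rewrite ?Cx //; apply/hasP.
  by have [t] := unguarded_in (ung _ q1C n1' n1); rewrite inE => tZ [tq _]; exists t.
by have [t] := unguarded_in (ung _ q2C n2' n2); rewrite inE => tZ [tq _]; exists t.
Qed.

Lemma dominators a b c : triangle e a b c -> 3 <= #|[set x | dominates x [:: a; b; c]]|.
Proof.
move=> tr; apply: leq_trans (dominate_triangle cr tr) _; apply/subset_leq_card/subsetP => x.
by rewrite !inE /dominates /= andbT.
Qed.

Section Link.
Variables a b c : V.
Hypothesis tr : triangle e a b c.
Let T := [:: a; b; c].

(** The vertices [t], [q], [x] form a triangle with one vertex in [T]; links are compared through
    the fact that triangles meet. *)
Definition link x q t := [&& dominates x T, e q x, t \in T & e t q].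

Lemma link_two x : dominates x T -> exists q1 q2 t1 t2, [/\ q1 != q2, link x q1 t1 & link x q2 t2].
Proof.
move=> dx; have [q1 [q2 [q12 q1x q2x /hasP[t1 t1T tq1] /hasP[t2 t2T tq2]]]] := triangle_unguarded tr dx.
by exists q1, q2, t1, t2; rewrite /link dx q1x q2x t1T t2T.
Qed.

Lemma link_triangle x q t : link x q t -> triangle e t q x.
Proof. by case/and4P=> /allP dx qx tT tq; rewrite /triangle tq qx dx. Qed.

Lemma link_not_T x q t y : link x q t -> y \in T -> (q != y) * (x != y).
Proof.
case/and4P=> /allP dx qx tT tq yT; split; first exact: ne2 cr _ _ _ qx (dx _ yT).
exact: ne1 cr _ _ (dx _ yT).
Qed.

(** The two link triangles meet. A middle vertex receives an arc from [T], so it is not a dominator,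
    and neither kind lies in [T]; hence the common vertex is [t]. *)
Lemma link_cross x y q t q' t' : link x q t -> link y q' t' -> x != y -> q != q' -> t = t'.
Proof.
move=> l l' xy qq'; have /hasP[w] := triangles_meet cr (link_triangle l) (link_triangle l').
have ql x1 x2 q1 q2 t1 t2 : link x1 q1 t1 -> link x2 q2 t2 -> q1 != x2.
  move=> /and4P[_ _ t1T t1q] /and4P[/allP d2 _ _ _].
  by apply: contraTneq t1q => ->; apply: asym; apply: d2.
have tT : t \in T by case/and4P: l. have tT' : t' \in T by case/and4P: l'.
rewrite !inE => /or3P[]/eqP-> /or3P[]/eqP E //.
- by have := (link_not_T l tT').1; rewrite E eqxx.
- by have := (link_not_T l tT').2; rewrite E eqxx.
- by have := (link_not_T l' tT).1; rewrite E eqxx.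
- by rewrite E eqxx in qq'.
- by have := ql _ _ _ _ _ _ l' l; rewrite E eqxx.
- by have := (link_not_T l' tT).2; rewrite E eqxx.
- by have := ql _ _ _ _ _ _ l l'; rewrite E eqxx.
- by rewrite E eqxx in xy.
Qed.

(** Each dominator has two links, so one of them avoids a given middle vertex and [link_cross]
    applies; links of the same vertex are compared through a second dominator. *)
Lemma link_hub x y q t q' t' : link x q t -> link y q' t' -> t = t'.
Proof.
have other x0 : exists2 y0, y0 != x0 & dominates y0 T.
  have /card_gt0P[y0] : 0 < #|[set x | dominates x T] :\ x0|.
    by have := dominators tr; rewrite -/T (cardsD1 x0); case: (x0 \in _); lia.
  by rewrite !inE => /andP[]; exists y0.
have avoid x0 y0 q0 t0 : dominates y0 T -> x0 != y0 -> link x0 q0 t0 -> exists q1, q1 != q0 /\ link y0 q1 t0.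
  move=> dy xy l; have [q1 [q2 [t1 [t2 [q12 l1 l2]]]]] := link_two dy.
  case: (eqVneq q1 q0) => [E|q10].
    exists q2; rewrite -E eq_sym q12; split=> //.
    by rewrite (link_cross l l2 xy) // -E.
  by exists q1; split=> //; rewrite (link_cross l l1 xy) // eq_sym.
have within x0 q1 t1 q2 t2 : link x0 q1 t1 -> link x0 q2 t2 -> t1 = t2.
  move=> l1 l2; have [y0 yx dy] := other x0; rewrite eq_sym in yx.
  have [p1 [pq1 m1]] := avoid _ _ _ _ dy yx l1.
  have [p2 [pq2 m2]] := avoid _ _ _ _ dy yx l2.
  case: (eqVneq q1 q2) => [E|q12].
    by rewrite -(link_cross l2 m1 yx) // -E eq_sym.
  case: (eqVneq p1 q2) => [E1|n1]; last by rewrite (link_cross l2 m1 yx) // eq_sym.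
  case: (eqVneq p2 q1) => [E2|n2]; last by rewrite (link_cross l1 m2 yx) // eq_sym.
  (* With the middle vertices swapped, [t1] also links to [x0] through [q2]; a link of [y0] with
     another middle vertex then compares [t1] with [t2]. *)
  subst p1 p2.
  have l3 : link x0 q2 t1 by case/and4P: l2 m1 => dx qx _ _ /and4P[_ _ tT tq]; apply/and4P.
  have [p3 [pq3 m3]] := avoid _ _ _ _ dy yx l3.
  by rewrite (link_cross l2 m3 yx) // eq_sym.
move=> l l'; case: (eqVneq x y) => [E|xy]; first by rewrite E in l; apply: within l l'.
have dy : dominates y T by case/and4P: l'.
by have [q1 [_ m]] := avoid _ _ _ _ dy xy l; apply: within m l'.
Qed.

End Link.

Lemma no_triangle a b c : ~~ triangle e a b c.
Proof.
apply/negP => tr0.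
have [h [b' [c' [tr only]]]] : exists h b' c', triangle e h b' c' /\
    forall x q t, link h b' c' x q t -> t = h.
  have /card_gt0P[x0] : 0 < #|[set x | dominates x [:: a; b; c]]| by apply: leq_trans (dominators tr0).
  rewrite inE => /(link_two tr0)[q0 [_ [h [_ [_ l0 _]]]]].
  have hT : h \in [:: a; b; c] by case/and4P: l0.
  have rot (p q r : V) : triangle e p q r -> [:: p; q; r] =i [:: a; b; c] -> p = h ->
      exists h b' c', triangle e h b' c' /\ forall x q t, link h b' c' x q t -> t = h.
    move=> tr E ph; exists p, q, r; split=> // x q' t; rewrite /link /dominates (eq_all_r E) E ph => l.
    exact: (link_hub tr0 l l0).
  have r3 (x y z : V) : [:: y; z; x] =i [:: x; y; z].
    by move=> w; rewrite !inE; case: (w == x); case: (w == y); case: (w == z).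
  move: hT; rewrite !inE => /or3P[]/eqP hE; first exact: (rot a b c tr0 (fun=> erefl) (esym hE)).
    by apply: (rot b c a _ (r3 _ _ _) (esym hE)); rewrite -triangle_rot.
  apply: (rot c a b _ _ (esym hE)); first by rewrite triangle_rot.
  by move=> w; rewrite -(r3 c a b w).
have two x : dominates x [:: h; b'; c'] -> exists q1 q2, [/\ q1 != q2, [&& e h q1 & e q1 x] & [&& e
  h q2 & e q2 x]].
  move=> dx; have [q1 [q2 [t1 [t2 [q12 l1 l2]]]]] := link_two tr dx; exists q1, q2.
  rewrite -{1}(only _ _ _ l1) -{1}(only _ _ _ l2).
  by case/and4P: l1 l2 => _ -> _ -> /and4P[_ -> _ ->].
(* Suppose a triangle avoids [h] and meets the given one in [t]. For a dominator [x] off it, the two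
   link triangles on [h] and [x] can meet it only in their middle vertices, which are thus its other
   two vertices. One of these gives a link starting at [t], so [t] is [h]. *)
have hubP p q r : triangle e p q r -> [|| p == h, q == h | r == h].
  move=> pqr; apply: contraT => nh; have /hasP[t tp tT] := triangles_meet cr tr pqr.
  have [p' [q' [pqt E]]] := triangle_last pqr tp.
  have nh' w : w \in [:: p; q; r] -> w != h.
    by apply: contraTneq => ->; rewrite !inE !(eq_sym h).
  have /card_gt0P[x] : 0 < #|[set x | dominates x [:: h; b'; c']] :\ p' :\ q'|.
    have := dominators tr; rewrite (cardsD1 p') (cardsD1 q' (_ :\ _)).
    by clear; case: (p' \in _); case: (q' \in _) => /=; lia.
  rewrite !inE => /and3P[xq xp dx]; have [q1 [q2 [q12 /andP[hq1 q1x] /andP[hq2 q2x]]]] := two x dx.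
  have xt : e x t by move/allP: (dx); apply.
  have cover w : e h w -> e w x -> (w == p') || (w == q').
    move=> hw wx; have hwx : triangle e h w x by case/and4P: dx => xh _ _ _; rewrite /triangle hw wx xh.
    have /hasP[z zp] := triangles_meet cr hwx pqt.
    have zh : z != h by apply: nh'; rewrite -E.
    rewrite !inE (negbTE zh) /= => /orP[]/eqP zE; subst z.
      move: zp; rewrite !inE (negbTE (ne2 cr wx xt)) orbF; exact.
    by move: zp; rewrite !inE (negbTE xp) (negbTE xq) (negbTE (ne1 cr xt)).
  have px : e p' x.
    case/orP: (cover _ hq1 q1x) => /eqP E1; first by rewrite -E1.
    case/orP: (cover _ hq2 q2x) => /eqP E2; first by rewrite -E2.
    by rewrite E1 E2 eqxx in q12.
  have tp' : e t p' by case/and3P: pqt.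
  have tE : t = h by apply: (only x p' t); rewrite /link dx px tT tp'.
  by have := nh' _ tp; rewrite tE eqxx.
have mo : mode_ok e Hub h.
  split=> // b1 c1 x1 tr1 dx1; have dx : dominates x1 [:: h; b1; c1] by rewrite /dominates /= andbT.
  have [q1 [q2 [t1 [t2 [q12 l1 l2]]]]] := link_two tr1 dx.
  have th q t : link h b1 c1 x1 q t -> e h q && e q x1.
    move=> l; have /or3P[/eqP<-|/eqP qh|/eqP xh] := hubP _ _ _ (link_triangle l).
    - by case/and4P: l => _ -> _ ->.
    - by have := (link_not_T l (mem_head _ _)).1; rewrite qh eqxx.
    - by have := (link_not_T l (mem_head _ _)).2; rewrite xh eqxx.
  by apply/card_gt1P; exists q1, q2; rewrite !inE (th _ _ l1) (th _ _ l2).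
have /card_gt0P[x] : 0 < #|[set x | dominates x [:: h; b'; c']]| by apply: leq_trans (dominators tr).
rewrite inE => dx; have [q1 [q2 [q12 /andP[hq1 q1x] /andP[hq2 q2x]]]] := two x dx.
case/and3P: tr dx => hb bc ch /and4P[xh xb xc _].
have un : uniq [:: h; b'; c'; x; q1; q2].
  rewrite /= !inE !negb_or q12 (ne1 cr hb) (ne1' cr ch) (ne1' cr xh) (ne1 cr hq1) (ne1 cr hq2).
  rewrite (ne1 cr bc) (ne1' cr xb) (ne1' cr xc) (ne1' cr q1x) (ne1' cr q2x).
  by rewrite (ne2' cr q1x xb) (ne2' cr q2x xb) (ne2' cr q1x xc) (ne2' cr q2x xc).
have := certified_nth cr certified_hub mo un erefl; apply/negP; rewrite negbK.
by rewrite /holds /= hb bc ch xh xb xc q1x q2x hq1 hq2.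
Qed.

End TriangleCase.

(** * The triangle-free case *)

Section TriangleFreeCase.
Variables (V : finType) (e : rel V).
Hypothesis cr : critical e.
Let asym := crit_asym cr.
Let irr := crit_irr cr.

Lemma no_triangle_arc a b c : e a b -> e b c -> ~~ e c a.
Proof. by move=> ab bc; have := no_triangle cr a b c; rewrite /triangle ab bc. Qed.

Lemma min_cycset_card4 C : minset (cycset e) C -> 3 < #|C|.
Proof.
move=> mC; rewrite ltnNge; apply/negP => /(min_cycset_triangle asym mC)[a [b [c [_ _ _ tr]]]].
by have := no_triangle cr a b c; rewrite tr.
Qed.

Section UniqueCommon.
Hypothesis uniq_common : forall u v w w', e u v -> e w u -> e w v -> e w' u -> e w' v -> w = w'.
Hypothesis common_succ : forall u v, e u v -> exists2 w, e u w & e w v.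

(** By [common_succ], the out-neighbourhood of [v] contains a cycle [B] of at most five vertices.
    Uniqueness lets [v] and [B] be deleted together while the two-cycle theorem still applies. *)
Lemma unique_common_absurd : False.
Proof.
have [v _] := card_gt0P (crit_vertex cr).
have N0 : [set u | e v u] != set0 by rewrite -card_gt0 crit_out.
have [|B0 B0N] := @incyclic_cycset _ e _ N0.
  by move=> u; rewrite inE => /common_succ[w vw wu]; exists w; rewrite ?inE.
case/minimal_cycset=> B BB0 mB; have cB := minsetp mB.
have vB u : u \in B -> e v u by move/(subsetP (subset_trans BB0 B0N)); rewrite inE.
have B5 : #|B| <= 5 by rewrite -(crit_out cr v) subset_leq_card // (subset_trans BB0).
pose Z := v |: B; pose k w := #|[set b in B | e w b]|.
have ZB w : #|[set z in Z | e w z]| <= e w v + k w.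
  have -> : [set z in Z | e w z] = [set z in [set v] | e w z] :|: [set b in B | e w b].
    by apply/setP => z; rewrite !inE andb_orl.
  apply: leq_trans (leq_card_setU _ _) _; rewrite leq_add2r.
  case wv: (e w v); first by rewrite /= -(cards1 v) subset_leq_card //; apply/subsetP => z;
    rewrite !inE => /andP[].
  rewrite leqn0 cards_eq0; apply/eqP/setP => z; rewrite !inE.
  by apply/negP => /andP[/eqP->]; rewrite wv.
(* Since [v] is the only vertex that dominates an arc of [B], the out-neighbours of [w] in [B] are
   disjoint from their successors; twice their number is at most 5. *)
have k2 w : w \notin Z -> k w <= 2.
  rewrite !inE negb_or => /andP[wv _]; pose X := [set b in B | e w b].
  have fB := succ_inP cB; have [_ finj] := min_cycset_inj mB fB.
  have XB : X \subset B by apply/subsetP => b; rewrite inE => /andP[].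
  have cX : #|succ_in e B @: X| = #|X|.
    by apply: card_in_imset => a b /(subsetP XB) aB /(subsetP XB); apply: finj.
  have dX : [disjoint X & succ_in e B @: X].
    rewrite disjoints_subset; apply/subsetP => b; rewrite inE => /andP[bB wb]; rewrite inE.
    apply/negP => /imsetP[a]; rewrite inE => /andP[aB wa] bE; have [_] := fB a aB; rewrite -bE => ab.
    by case/eqP: wv; apply: (uniq_common ab); rewrite ?vB.
  have : #|X :|: succ_in e B @: X| <= #|B|.
    apply/subset_leq_card; rewrite subUset XB /=; apply/subsetP => _ /imsetP[a /(subsetP XB) aB ->].
    by case: (fB a aB).
  have -> : #|X :|: succ_in e B @: X| = #|X| + #|X|.
    by rewrite cardsU cX (disjoint_setI0 dX) cards0 subn0.
  by rewrite /k -/X; lia.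
have /negP := compl_no2 cr cB; apply; apply: (@two_cyclesS _ e e (~: Z)) => //.
  by rewrite setCS subsetUr.
have dW w : 5 <= outd e (~: Z) w + (e w v + k w).
  by apply: leq_trans (outd_compl cr Z w) _; rewrite leq_add2l.
apply: two_cycles_outd => [|w _|w|]; rewrite ?irr //.
- apply: contraTneq (card_V6 cr) => Z0; rewrite -leqNgt -cardsT -[setT]setC0 -Z0 setCK.
  by apply: leq_trans (leq_card_setU _ _) _; rewrite cards1.
- by rewrite inE => /k2; have := dW w; case: (e w v) => /=; lia.
(* An exceptional [w] has an arc to [v] and two to [B]. Each [b] in [B] receives an arc from at most
   one of them, the common in-neighbour of [v] and [b], so there are at most two. *)
- set Bad := [set _ in _ | _].
  have bad w : w \in Bad -> e w v /\ 2 <= k w.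
    rewrite in_set in_setC => /andP[wZ o2].
    by have := k2 w wZ; have := dW w; case: (e w v) => /=; lia.
  have sum1 : 2 * #|Bad| <= \sum_(w in Bad) k w.
    by rewrite mulnC -sum_nat_const; apply: leq_sum => w /bad[].
  have sum2 : \sum_(w in Bad) k w <= #|B|.
    rewrite /k; under eq_bigr do rewrite -sum1dep_card big_mkcondr /=.
    rewrite exchange_big /= -sum1_card; apply: leq_sum => b bB.
    rewrite -big_mkcondr sum1dep_card; apply/card_le1_eqP => w w'.
    rewrite in_set => /andP[/bad[wv _] wb]; rewrite in_set => /andP[/bad[wv' _] wb'].
    by apply: (uniq_common (vB b bB)).
  by lia.
Qed.

End UniqueCommon.

Lemma min_cycset_walk C p p' : minset (cycset e) C -> p \in C -> p' \in C -> e p p' ->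
  exists q r, [/\ q \in C, r \in C, e p' q, e q r & uniq [:: p; p'; q; r]].
Proof.
move=> mC pC p'C pp'; have [q qC p'q] := min_cycset_next mC p'C; have [r rC qr] := min_cycset_next mC qC.
exists q, r; split=> //; rewrite /= !inE !negb_or (ne1 cr pp') (ne2 cr pp' p'q) (ne1 cr p'q)
  (ne2 cr p'q qr) (ne1 cr qr) !andbT /=.
by apply: contraTneq qr => <-; apply: no_triangle_arc pp' p'q.
Qed.

Lemma min_cycset_close (C : {set V}) p p' q r : #|C| <= 4 -> p \in C -> p' \in C -> q \in C -> r \in C ->
  minset (cycset e) C -> uniq [:: p; p'; q; r] -> e p' q -> e q r -> e r p.
Proof.
move=> C4 pC p'C qC rC mC us p'q qr; have [y yC ry] := min_cycset_next mC rC.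
have CE : [set z in [:: p; p'; q; r]] = C.
  apply/eqP; rewrite eqEcard; apply/andP; split; last by rewrite cardsE (card_uniqP us).
  by apply/subsetP => z; rewrite !inE => /or4P[]/eqP->.
move: yC ry; rewrite -CE !inE => /or4P[]/eqP-> //.
- by rewrite (negbTE (no_triangle_arc p'q qr)).
- by rewrite (negbTE (asym qr)).
- by rewrite (negbTE (irr r)).
Qed.

(** Otherwise every in-neighbourhood contains an induced cycle on at least five vertices. Indegrees
    sum to five per vertex, so each in-neighbourhood is exactly such a 5-cycle; its predecessors and
    successors provide the hypotheses of [unique_common_absurd]. *)
Lemma square_in_neighbourhood : exists v a b c d, square e a b c d /\ all (e^~ v) [:: a; b; c; d].
Proof.
case: (boolP [exists v, exists a, exists b, exists c, exists d,
    square e a b c d && all (e^~ v) [:: a; b; c; d]]) => [|none0].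
  case/existsP=> v /existsP[a /existsP[b /existsP[c /existsP[d /andP[sq sv]]]]].
  by exists v, a, b, c, d.
have none v a b c d : square e a b c d -> all (e^~ v) [:: a; b; c; d] -> False.
  move=> sq sv; case/negP: none0; apply/existsP; exists v; apply/existsP; exists a.
  by apply/existsP; exists b; apply/existsP; exists c; apply/existsP; exists d; rewrite sq.
have C5 v C : minset (cycset e) C -> {in C, forall c, e c v} -> 5 <= #|C|.
  move=> mC Cv; rewrite ltnNge; apply/negP => C4.
  have [/set0Pn[p pC] _] := cycsetP _ _ (minsetp mC); have [p' p'C pp'] := min_cycset_next mC pC.
  have [q [r [qC rC p'q qr us]]] := min_cycset_walk mC pC p'C pp'.
  apply: (none v p p' q r); rewrite /= ?Cv // /square pp' p'q qr.
  exact: min_cycset_close C4 pC p'C qC rC mC us p'q qr.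
pose ind v := #|[set u in setT | e u v]|.
have indN v : ind v = #|[set u | e u v]| by apply: eq_card => u; rewrite !inE.
have in5 v : 5 <= ind v.
  have [C mC Cv] := min_in_cycset cr v; apply: leq_trans (C5 v C mC Cv) _; rewrite indN.
  by apply/subset_leq_card/subsetP => c /Cv; rewrite inE.
have inE5 v : ind v = 5.
  have : \sum_(v in [set: V]) (ind v - 5) == 0.
    rewrite sumnB //; rewrite -(sum_outd_ind e setT) subn_eq0; apply: leq_sum => u _.
    by rewrite -(crit_out cr u); apply/subset_leq_card/subsetP => w; rewrite !inE.
  rewrite sum_nat_eq0 => /forall_inP/(_ v (in_setT v)); rewrite subn_eq0 => le5.
  by apply/eqP; rewrite eqn_leq le5 in5.
have nbr v : exists2 C, minset (cycset e) C & C = [set u | e u v].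
  have [C mC Cv] := min_in_cycset cr v; exists C => //; apply/eqP; rewrite eqEcard.
  rewrite -indN inE5 (C5 v C mC Cv) andbT.
  by apply/subsetP => c /Cv; rewrite inE.
exfalso; apply: unique_common_absurd => [u v w w' uv wu wv w'u w'v|u v uv].
- have [C mC CE] := nbr v; have [|p [_ _ h]] := @min_cycset_pred _ e C u mC; first by rewrite CE inE.
  by rewrite (h w) ?CE ?inE // -(h w') ?CE ?inE.
- have [C mC CE] := nbr v; have [|w] := @min_cycset_next _ e C mC u; first by rewrite CE inE.
  by rewrite CE inE => wv uw; exists w.
Qed.

(** Without triangles no vertex of the square sends an arc to [x], so [C] avoids the square. A cycle
    in the in-neighbourhood of an unguarded vertex of [C] meets the square, and only in [a]: an arc
    from [b], [c] or [d] would close a triangle through [x]. *)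
Lemma square_miss a b c d x : square e a b c d -> [&& e x b, e x c & e x d] ->
  ~~ e a x /\ exists C p p', [/\ minset (cycset e) C, {in C, forall q, e q x},
    [/\ p \in C, p' \in C & e p p']
    & forall q, q \in C -> q != p -> q != p' -> e a q /\ exists g, [/\ e a g, e g q & g != b]].
Proof.
move=> sq; have [ab bc cd da] := and4P sq.
have noins y t : [&& e y b, e y c & e y d] -> t \in [:: a; b; c; d] -> ~~ e t y.
  case/and3P=> yb yc yd; rewrite !inE => /or4P[]/eqP->; try exact: asym.
  by apply/negP => ay; have := no_triangle_arc ay yd; rewrite da.
move=> dx; split; first by apply: (noins x a dx); rewrite mem_head.
set s := [:: a; b; c; d] in noins; set Z := [set y in s].
have us : uniq s by rewrite /= !inE !negb_or (ne1 cr ab) (ne2 cr ab bc) (ne1' cr da) (ne1 cr bc)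
  (ne2 cr bc cd) (ne1 cr cd).
have cZ : cycset e Z by apply: cycle_cycset; rewrite //= ab bc cd da.
have avoid y (C : {set V}) : [&& e y b, e y c & e y d] -> (forall q, q \in C -> e q y) -> C \subset ~: Z.
  by move=> dy Cy; apply/subsetP => q qC; rewrite !in_set; apply: contraL (Cy q qC) => /(noins y q dy).
have [C mC Cx] := min_in_cycset cr x; have CZ := avoid x C dx Cx.
have cnt v : 5 <= outd e (~: Z) v + count (e v) s by rewrite -(card_count e v us); apply: outd_compl.
have out1 v : 0 < outd e (~: Z) v.
  apply: contraTT (cnt v); rewrite -leqNgt leqn0 => /eqP->.
  by rewrite add0n -ltnNge ltnS (count_size (e v) s).
have xZ : x \in ~: Z.
  case/and3P: dx => xb xc xd; rewrite !inE !negb_or (ne1 cr xb) (ne1 cr xc) (ne1 cr xd) !andbT.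
  by apply: contraTneq xc => ->; apply/negP => ac; have := no_triangle_arc ac cd; rewrite da.
have [|p [p' [pC pC' pp' ung]]] := @two_consecutive _ e C mC (guarded e (~: Z)) (min_cycset_card4 mC) _.
  move=> i j iC jC ij eij eji; apply: (guarded_consecutive asym (compl_no2 cr cZ) CZ mC xZ Cx) => // v _ o1.
  split; last exact: no_triangle_arc.
  (* A vertex keeping one out-neighbour sends four arcs to the square, so a cycle in its
     in-neighbourhood avoids the square and guards it. *)
  have dv : [&& e v b, e v c & e v d].
    by have := cnt v; rewrite o1 /=; do 4 case: (e v _).
  have [A Av cA] := in_guard cr v; apply/existsP; exists A; rewrite Av cA (avoid v) //.
  by move=> q /(subsetP Av); rewrite inE.
exists C, p, p'; split=> // q qC qp qp'; have qx := Cx q qC.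
have [t tZ [tq [g tg gq]]] := unguarded_in cr (ung q qC qp qp').
have xt : ~~ e x t by apply: no_triangle_arc tq qx.
have tE : t = a.
  by have [xb xc xd] := and3P dx; move: tZ xt; rewrite !inE => /or4P[]/eqP->; rewrite ?xb ?xc ?xd.
subst t; split=> //; exists g; split=> //; apply: contraTneq gq => ->.
by case/and3P: dx => xb _ _; apply: contraL xb => bq; apply: no_triangle_arc bq qx.
Qed.

Lemma square_uniq a b c d : square e a b c d -> uniq [:: a; b; c; d].
Proof.
case/and4P=> ab bc cd da; rewrite /= !inE !negb_or.
by rewrite (ne1 cr ab) (ne2 cr ab bc) (ne1' cr da) (ne1 cr bc) (ne2 cr bc cd) (ne1 cr cd).
Qed.

(** [q] and [r] are the two vertices of [C] after the possibly guarded [p] and [p'], so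
    [square_miss] applies to both. *)
Lemma square_path a b c d x : square e a b c d -> [&& e x b, e x c & e x d] ->
  exists g q r, [/\ [/\ e a g, e a q & e a r], [/\ g != b, q != b & r != b]
                  & [/\ e q x, e r x, e q r & e g q]].
Proof.
move=> sq dx; have [_ [C [p [p' [mC Cx [pC p'C pp'] ung]]]]] := square_miss sq dx.
have [q [r [qC rC p'q qr us]]] := min_cycset_walk mC pC p'C pp'.
move: us; rewrite /= !inE !negb_or => /and4P[/and3P[_ pq pr] /andP[p'q' p'r] qr' _].
have [|aq [g [ag gq gb]]] := ung q qC _ (ne1' cr p'q); first by rewrite eq_sym.
have [||ar _] := ung r rC; try by rewrite eq_sym.
have [xb _ _] := and3P dx.
exists g, q, r; split; split=> //; first exact: ne2 cr _ _ _ (Cx q qC) xb.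
- exact: ne2 cr _ _ _ (Cx r rC) xb.
- exact: Cx.
- exact: Cx.
Qed.

Lemma square_not_dominated a b c d x : square e a b c d -> [&& e x b, e x c & e x d] ->
  ~~ e x a /\ 2 <= #|[set w | e a w && e w x]|.
Proof.
move=> sq dx; have [g [q [r [[_ aq ar] _ [qx rx qr _]]]]] := square_path sq dx.
split; first exact: no_triangle_arc aq qx.
by apply/card_gt1P; exists q, r; rewrite !inE aq ar qx rx (ne1 cr qr).
Qed.

Lemma square_dominated a b c d : square e a b c d ->
  3 <= #|[set w | 3 <= count (e w) [:: a; b; c; d]]|.
Proof.
move=> sq; apply: leq_trans (heavy_cycle cr (square_uniq sq) _ _ _ _) _ => //.
- by case/and4P: sq => ab bc cd da; rewrite /= ab bc cd da.
- exact: leq_trans (card_V6 cr).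
- move=> x _; rewrite leqNgt; apply/negP => c4.
  have /and5P[xa xb xc xd _] : all (e x) [:: a; b; c; d].
    by rewrite all_count eqn_leq count_size.
  by have [] := square_not_dominated sq (_ : [&& e x b, e x c & e x d]); rewrite ?xa ?xb ?xc ?xd.
- by apply/subset_leq_card/subsetP => x; rewrite !inE => /andP[].
Qed.

Lemma triangle_free_mode h : mode_ok e TriangleFree h.
Proof.
split; [exact: no_triangle | exact: square_dominated | exact: square_not_dominated | exact: square_path].
Qed.

(** Besides [b] and [v], the vertex [a] has three out-neighbours, and all of [C] except [p] and [p']
    is among them; so [C] has four or five vertices, one certificate for each length. *)
Lemma square_absurd a b c d v x : square e a b c d -> all (e^~ v) [:: a; b; c; d] ->
  [&& e x b, e x c & e x d] -> False.
Proof.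
move=> sq /and5P[av bv cv dv _] dx; have [xb xc xd] := and3P dx; have [ab bc cd da] := and4P sq.
have [nax [C [p [p' [mC Cx [pC p'C pp'] ung]]]]] := square_miss sq dx.
have [q [r [qC rC p'q qr us]]] := min_cycset_walk mC pC p'C pp'.
have out y : y \in C -> y \notin [:: p; p'] -> e a y.
  by move=> yC; rewrite !inE negb_or => /andP[yp yp']; case: (ung y yC yp yp').
move: (us); rewrite /= !inE !negb_or => /and4P[/and3P[npp' npq npr] /andP[np'q np'r] nqr _].
have aq : e a q by apply: out; rewrite // !inE negb_or ![q == _]eq_sym npq.
have ar : e a r by apply: out; rewrite // !inE negb_or ![r == _]eq_sym npr.
have nvx : v != x by apply: ne2' cr _ _ _ xb bv.
have nax' : a != x by apply: ne2 cr _ _ _ aq (Cx q qC).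
have nac y : y \in C -> a != y by move=> yC; apply: contraNneq nax => ->; apply: Cx.
have nbc y : y \in C -> b != y by move=> yC; apply: ne2' cr _ _ _ (Cx y yC) xb.
have ncc y : y \in C -> c != y by move=> yC; apply: ne2' cr _ _ _ (Cx y yC) xc.
have ndc y : y \in C -> d != y by move=> yC; apply: ne2' cr _ _ _ (Cx y yC) xd.
have nvx' : ~~ e v x.
  by apply/negP => vx; have := no_triangle_arc vx xb; rewrite bv.
have nvc y : y \in C -> v != y by move=> yC; apply: contraNneq nvx' => ->; apply: Cx.
have nxc y : y \in C -> x != y by move=> yC; apply: ne1' cr _ _ (Cx y yC).
have us' t : uniq t -> {subset t <= C} -> uniq ([:: a; b; c; d; v; x] ++ t).
  move=> ut tC; rewrite cat_uniq ut andbT; apply/andP; split.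
    rewrite /= !inE !negb_or nax' nvx (ne1 cr ab) (ne2 cr ab bc) (ne1' cr da) (ne1 cr av).
    rewrite (ne1 cr bc) (ne2 cr bc cd) (ne1 cr bv) (ne1' cr xb) (ne1 cr cd) (ne1 cr cv) (ne1' cr xc).
    by rewrite (ne1 cr dv) (ne1' cr xd).
  apply/hasPn => y /tC yC; rewrite /= !inE !negb_or ![y == _]eq_sym.
  by rewrite nac ?nbc ?ncc ?ndc ?nvc ?nxc.
have [C4|C5] := leqP #|C| 4.
  have rp := min_cycset_close C4 pC p'C qC rC mC us p'q qr.
  have un : uniq ([:: a; b; c; d; v; x] ++ [:: p; p'; q; r]).
    by apply: us' => // y; rewrite !inE => /or4P[]/eqP->.
  have := certified_nth cr certified_tf4 (triangle_free_mode a) un erefl; apply/negP; rewrite negbK.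
  rewrite /holds /= ab bc cd da av bv cv dv xb xc xd pp' p'q qr rp aq ar.
  by rewrite (Cx p pC) (Cx p' p'C) (Cx q qC) (Cx r rC).
have [y yC ry] := min_cycset_next mC rC.
have nyp : y != p.
  apply: contraTneq C5 => E; rewrite -leqNgt -[4]/(size [:: p; p'; q; r]).
  apply: (min_cycset_cycle mC) => //; first by rewrite /= pp' p'q qr -E ry.
  by move=> z; rewrite !inE => /or4P[]/eqP->.
have nyp' : y != p'.
  by apply: contraTneq ry => ->; apply: no_triangle_arc p'q qr.
have nyq : y != q by apply: contraTneq ry => ->; apply: asym.
have nyr : y != r := ne1' cr ry.
have ay : e a y by apply: out; rewrite // !inE negb_or nyp.
have uy : uniq [:: p; p'; q; r; y].
  rewrite -[[:: p; p'; q; r; y]]/(rcons [:: p; p'; q; r] y) rcons_uniq us andbT.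
  by rewrite !inE !negb_or nyp nyp' nyq.
have sub5 : {subset [:: p; p'; q; r; y] <= C}.
  by move=> z; rewrite !inE => /or4P[| | |/orP[]]/eqP->.
have u5 : uniq [:: b; v; q; r; y].
  by rewrite /= !inE !negb_or (ne1 cr bv) !nbc ?nvc // nqr (ne1 cr ry) [q == y]eq_sym nyq.
have Na : [set w | e a w] = [set w in [:: b; v; q; r; y]].
  apply/eqP; rewrite eq_sym eqEcard (crit_out cr) cardsE (card_uniqP u5) andbT.
  by apply/subsetP => w; rewrite !inE => /or4P[| | |/orP[]]/eqP->.
have [C5'|C6] := leqP #|C| 5; last first.
  have /subsetPn[z zC] : ~~ (C \subset [set w in [:: p; p'; q; r; y]]).
    by apply: contraL C6 => /subset_leq_card; rewrite cardsE (card_uniqP uy) -leqNgt.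
  rewrite !inE !negb_or => /and5P[zp zp' zq zr zy].
  have : z \in [set w | e a w] by rewrite inE out // !inE negb_or zp.
  by rewrite Na !inE (negbTE zq) (negbTE zr) (negbTE zy) !(eq_sym z) (negbTE (nbc z zC)) (negbTE (nvc z zC)).
have CE : [set w in [:: p; p'; q; r; y]] = C.
  apply/eqP; rewrite eqEcard cardsE (card_uniqP uy) C5' andbT.
  by apply/subsetP => z; rewrite inE; apply: sub5.
have yp : e y p.
  have [z + yz] := min_cycset_next mC yC; rewrite -CE !inE => /or4P[| | |/orP[]]/eqP zE; subst z => //.
  - suff : #|C| <= 4 by rewrite leqNgt C5.
    rewrite -[4]/(size [:: p'; q; r; y]); apply: (min_cycset_cycle mC) => //.
      by rewrite /= p'q qr ry yz.
    by move=> w; rewrite !inE => /or4P[]/eqP->.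
  - by rewrite (negbTE (no_triangle_arc qr ry)) in yz.
  - by rewrite (negbTE (asym ry)) in yz.
  - by rewrite (negbTE (irr y)) in yz.
(* The vertex [g] between [a] and [q] is one of the five out-neighbours of [a], and only [v] is
   possible. *)
have vq : e v q.
  have [||_ [g [ag gq gb]]] := ung q qC; try by rewrite eq_sym.
  have : g \in [set w | e a w] by rewrite inE.
  rewrite Na !inE (negbTE gb) /= => /or4P[]/eqP gE; subst g => //.
  - by rewrite (negbTE (irr q)) in gq.
  - by rewrite (negbTE (asym qr)) in gq.
  - by rewrite (negbTE (no_triangle_arc qr ry)) in gq.
have := certified_nth cr certified_tf5 (triangle_free_mode a) (us' _ uy sub5) erefl; apply/negP;
  rewrite negbK.
rewrite /holds /= ab bc cd da av bv cv dv xb xc xd pp' p'q qr ry yp aq ar ay vq.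
by rewrite (Cx p pC) (Cx p' p'C) (Cx q qC) (Cx r rC) (Cx y yC).
Qed.

Lemma critical_absurd : False.
Proof.
have [v [a [b [c [d [sq sv]]]]]] := square_in_neighbourhood.
have /card_gt0P[x] : 0 < #|[set w | 3 <= count (e w) [:: a; b; c; d]]|.
  by apply: leq_trans (square_dominated sq).
have [ab bc cd da] := and4P sq; have /and5P[av bv cv dv _] := sv; rewrite inE /= addn0.
(* The square is rotated so that the vertex [x] may miss comes first. *)
case xa: (e x a); case xb: (e x b); case xc: (e x c); case xd: (e x d) => // _;
  [apply: (@square_absurd a b c d v x)|apply: (@square_absurd d a b c v x)
  |apply: (@square_absurd c d a b v x)|apply: (@square_absurd b c d a v x)
  |apply: (@square_absurd a b c d v x)]; by rewrite /square /= ?ab ?bc ?cd ?da ?av ?bv ?cv ?dv ?xa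
    ?xb ?xc ?xd.
Qed.

End TriangleFreeCase.

Theorem theorem1 (V : finType) (e : rel V) (V_nonempty : 0 < #|V|)
  (e_loopless : irreflexive e)
  (e_mindeg : forall v : V, 5 <= outdegree e v) :
  exists C : 'I_3 -> seq V,
    (forall i : 'I_3, dicycle e (C i)) /\
    (forall i j : 'I_3, i != j -> [disjoint C i & C j]).
Proof. exact (three_disjoint_dicycles (@critical_absurd) V_nonempty e_loopless e_mindeg). Qed.
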